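(* Let $n\geq 3$ and let $(M,g)$ be a Riemannian $n$-manifold of positive sectional curvature, with curvature tensor $R_{abcd}$. Then $M$ admits a local isometric immersion in $\mathbb{R}^{n+1}$ if and only if the curvature operator of $M$ is positive definite and the following conditions are satisfied: $$C^{*}_{abcd}=0\qquad\text{and}\qquad (e^{P^{*}})_{a[b;c]}=0,$$ where $C^{*}_{abcd}$ and $P^{*}_{ab}$ are the Weyl and Schouten tensors of $R^{*}_{ab}{}^{cd}=\ln(R_{ab}{}^{cd})$.
   Context: All manifolds, metrics and functions are smooth. '';'' is covariant differentiation with respect to the Levi-Civita connection of $g$, and $T_{a[b;c]}=\frac12(T_{ab;c}-T_{ac;b})$. $(M,g)$ admits a local isometric immersion in $\mathbb{R}^{m}$ if every point has an open neighbourhood on which there are scalar fields $u^{(1)},\dots,u^{(m)}$ with $\sum_{\tau} u^{(\tau)}_{;a}u^{(\tau)}_{;b}=g_{ab}$. Curvature sign convention: the unit round sphere has $R_{abcd}=g_{ac}g_{bd}-g_{ad}g_{bc}$. Any tensor $T_{abcd}$ antisymmetric in $ab$ and in $cd$ and satisfying $T_{abcd}=T_{cdab}$ is regarded as a self-adjoint operator on $2$-forms by $\omega_{ab}\mapsto \frac12 T_{ab}{}^{cd}\omega_{cd}$ (so $g_{ac}g_{bd}-g_{ad}g_{bc}$ is the identity operator), and conversely. The curvature operator is the operator associated with $R_{abcd}$. When it is positive definite, $R^{*}_{ab}{}^{cd}=\ln(R_{ab}{}^{cd})$ is its (pointwise) operator logarithm, regarded again as a tensor $R^{*}_{abcd}$.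 Put $R^{*}_{ij}=R^{*\,k}{}_{ikj}$, $\rho^{*}=R^{*\,a}{}_{a}$. The Schouten tensor of $R^{*}$ is $$P^{*}_{ab}=\frac{1}{n-2}\left(R^{*}_{ab}-\frac{\rho^{*}}{2(n-1)}g_{ab}\right),$$ and the Weyl tensor of $R^{*}$ is $$C^{*}_{abcd}=R^{*}_{abcd}-\left(g_{ac}P^{*}_{bd}+P^{*}_{ac}g_{bd}-P^{*}_{ad}g_{bc}-g_{ad}P^{*}_{bc}\right).$$ $e^{P^{*}}$ is the exponential of the endomorphism $P^{*}_{a}{}^{b}$, with its index lowered by $g$, giving a symmetric tensor $(e^{P^{*}})_{ab}$. *)

(* Defs.v *)
From HB Require Import structures.
From mathcomp Require Import all_boot all_order all_algebra.
From mathcomp Require Import all_classical all_reals all_analysis.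
Import Order.TTheory GRing.Theory Num.Theory.
Import numFieldNormedType.Exports.

Set Implicit Arguments.
Unset Strict Implicit.
Unset Printing Implicit Defensive.

Local Open Scope classical_set_scope.
Local Open Scope ring_scope.

(* Manifolds are given by a smooth atlas; tensor fields are given, in each
   chart, by their components as functions of the coordinates x : 'rV[R]_n.
   Component functions are total; they are only meaningful on the image of the
   chart, which is open, so that partial derivatives there do not depend on
   values outside of it. *)

Section Smooth.
Context {R : realType} {n : nat}.

Definition pd (i : 'I_n) (f : 'rV[R]_n -> R) : 'rV[R]_n -> R :=
  fun x => 'D_(delta_mx 0 i) f x.

Definition iter_pd (s : seq 'I_n) (f : 'rV[R]_n -> R) : 'rV[R]_n -> R :=
  foldr pd f s.

(* C^oo on U (used for U open): partial derivatives of all orders exist and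
   are continuous at every point of U. *)
Definition smooth_on (U : set 'rV[R]_n) (f : 'rV[R]_n -> R) : Prop :=
  forall (s : seq 'I_n) (x : 'rV[R]_n), U x ->
    {for x, continuous (iter_pd s f)} /\
    forall i : 'I_n, derivable (iter_pd s f) x (delta_mx 0 i).

End Smooth.

Record manifold (R : realType) (n : nat) := Manifold {
  mpoint :> topologicalType ;
  m_hausdorff : hausdorff_space mpoint ;
  m_second_countable : @second_countable mpoint ;
  chart : Type ;
  dom : chart -> set mpoint ;
  coord : chart -> mpoint -> 'rV[R]_n ;
  param : chart -> 'rV[R]_n -> mpoint ;
  dom_cover : forall p : mpoint, exists c, dom c p ;
  dom_open : forall c, open (dom c) ;
  coord_open : forall c, open (coord c @` dom c) ;
  coordK : forall c p, dom c p -> param c (coord c p) = p ;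
  coord_continuous : forall c, {within dom c, continuous (coord c)} ;
  param_continuous : forall c,
    {within coord c @` dom c, continuous (param c)} ;
  transition_smooth : forall c c' (j : 'I_n),
    smooth_on (coord c @` (dom c `&` dom c'))
              (fun x => coord c' (param c x) 0 j)
}.

Definition smooth_fun (R : realType) (n : nat) (M : manifold R n) (U : set M)
    (u : M -> R) : Prop :=
  forall c : chart M, smooth_on (coord c @` (U `&` dom c)) (u \o param c).

Record metric (R : realType) (n : nat) (M : manifold R n) := Metric {
  gcomp :> chart M -> 'rV[R]_n -> 'M[R]_n ;
  metric_smooth : forall c (a b : 'I_n),
    smooth_on (coord c @` dom c) (fun x => gcomp c x a b) ;
  metric_sym : forall c x, (coord c @` dom c) x ->
    (gcomp c x)^T = gcomp c x ;
  metric_pos : forall c x, (coord c @` dom c) x ->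
    forall v : 'rV[R]_n, v != 0 -> 0 < (v *m gcomp c x *m v^T) 0 0 ;
  (* g_ab = (dx'^k / dx^a) (dx'^l / dx^b) g'_kl *)
  metric_transform : forall c c' x, (coord c @` (dom c `&` dom c')) x ->
    forall a b : 'I_n,
      gcomp c x a b =
      \sum_k \sum_l pd a (fun y => coord c' (param c y) 0 k) x *
                    pd b (fun y => coord c' (param c y) 0 l) x *
                    gcomp c' (coord c' (param c x)) k l
}.

Definition tensor4 (R : realType) (n : nat) : Type :=
  'I_n -> 'I_n -> 'I_n -> 'I_n -> R.

(* At a single point: G = (g_ab), H = (g^ab). *)
Section PointwiseAlgebra.
Context {R : realType} {n : nat}.
Variable G : 'M[R]_n.
Let H : 'M[R]_n := invmx G.
Implicit Types (T : tensor4 R n) (w : 'M[R]_n).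

Definition form2 w : Prop := w^T = - w.

(* Tensors corresponding to self-adjoint operators on 2-forms. *)
Definition operator_tensor T : Prop :=
  [/\ forall a b c d, T b a c d = - T a b c d,
      forall a b c d, T a b d c = - T a b c d
    & forall a b c d, T c d a b = T a b c d].

(* T_ab^cd *)
Definition raise2 T (a b c d : 'I_n) : R :=
  \sum_e \sum_f T a b e f * H e c * H f d.

(* w_ab |-> 1/2 T_ab^cd w_cd *)
Definition op2 T w : 'M[R]_n :=
  \matrix_(a, b) (2^-1 * \sum_c \sum_d raise2 T a b c d * w c d).

(* <v, w> = 1/2 v_ab w^ab *)
Definition inner2 (v w : 'M[R]_n) : R :=
  2^-1 * \sum_a \sum_b \sum_c \sum_d v a b * H a c * H b d * w c d.

Definition op2_posdef T : Prop :=
  forall w, form2 w -> w != 0 -> 0 < inner2 w (op2 T w).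

(* The operator logarithm (functional calculus of ln), for T positive definite:
   the self-adjoint operator acting as ln lam on each eigenspace ker(T - lam).
   It is unique because T is diagonalizable; total by choice otherwise. *)
Definition op2_ln T : tensor4 R n :=
  get [set L | operator_tensor L /\
    forall (lam : R) w, form2 w ->
      op2 T w = lam *: w -> op2 L w = ln lam *: w].

(* Ricci contraction T_ij = T^k_ikj *)
Definition ricci T : 'M[R]_n :=
  \matrix_(i, j) \sum_k \sum_l H k l * T l i k j.

Definition scal T : R := \sum_a \sum_b H a b * ricci T a b.

Definition schouten T : 'M[R]_n :=
  (n%:R - 2)^-1 *: (ricci T - (scal T / (2 * (n%:R - 1))) *: G).

Definition weyl T : tensor4 R n :=
  let P := schouten T in fun a b c d =>
  T a b c d - (G a c * P b d + P a c * G b d - P a d * G b c - G a d * P b c).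

Definition mx_exp (A : 'M[R]_n) : 'M[R]_n :=
  lim (series (fun k : nat => k`!%:R^-1 *: A ^+ k) @ \oo).

(* (e^P)_ab for a symmetric tensor P_ab: P *m H is the matrix of P_a^b, and the
   final product with G lowers the index. *)
Definition exp_tensor (P : 'M[R]_n) : 'M[R]_n := mx_exp (P *m H) *m G.

End PointwiseAlgebra.

(* g is the field of metric components in one chart. *)
Section LocalGeometry.
Context {R : realType} {n : nat}.
Variable g : 'rV[R]_n -> 'M[R]_n.

(* Gamma^k_ij *)
Definition christoffel (k i j : 'I_n) (x : 'rV[R]_n) : R :=
  2^-1 * \sum_l invmx (g x) k l *
    (pd i (fun y => g y j l) x + pd j (fun y => g y i l) x
     - pd l (fun y => g y i j) x).

(* R^a_bcd = d_c Gamma^a_db - d_d Gamma^a_cb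
             + Gamma^a_ce Gamma^e_db - Gamma^a_de Gamma^e_cb *)
Definition riemann_up (x : 'rV[R]_n) (a b c d : 'I_n) : R :=
  pd c (christoffel a d b) x - pd d (christoffel a c b) x
  + \sum_e (christoffel a c e x * christoffel e d b x
            - christoffel a d e x * christoffel e c b x).

(* R_abcd, equal to g_ac g_bd - g_ad g_bc on the unit round sphere. *)
Definition riemann (x : 'rV[R]_n) : tensor4 R n := fun a b c d =>
  \sum_e g x a e * riemann_up x e b c d.

Definition dotp (x X Y : 'rV[R]_n) : R := (X *m g x *m Y^T) 0 0.

Definition sectional (x X Y : 'rV[R]_n) : R :=
  (\sum_a \sum_b \sum_c \sum_d
     riemann x a b c d * X 0 a * Y 0 b * X 0 c * Y 0 d)
  / (dotp x X X * dotp x Y Y - dotp x X Y ^+ 2).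

(* S_ab;c *)
Definition covd2 (S : 'rV[R]_n -> 'M[R]_n) (a b c : 'I_n) (x : 'rV[R]_n) : R :=
  pd c (fun y => S y a b) x
  - \sum_d christoffel d c a x * S x d b
  - \sum_d christoffel d c b x * S x a d.

(* S_a[b;c] *)
Definition covd2_skew (S : 'rV[R]_n -> 'M[R]_n) (a b c : 'I_n)
    (x : 'rV[R]_n) : R :=
  2^-1 * (covd2 S a b c x - covd2 S a c b x).

Definition ln_riemann (x : 'rV[R]_n) : tensor4 R n :=
  op2_ln (g x) (riemann x).

Definition weyl_star (x : 'rV[R]_n) : tensor4 R n :=
  weyl (g x) (ln_riemann x).

Definition schouten_star (x : 'rV[R]_n) : 'M[R]_n :=
  schouten (g x) (ln_riemann x).

Definition exp_schouten_star (x : 'rV[R]_n) : 'M[R]_n :=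
  exp_tensor (g x) (schouten_star x).

End LocalGeometry.

Section GlobalConditions.
Context {R : realType} {n : nat} {M : manifold R n}.
Variable g : metric M.

Definition positive_sectional_curvature : Prop :=
  forall (c : chart M) x, (coord c @` dom c) x ->
    forall X Y : 'rV[R]_n, row_free (col_mx X Y) -> 0 < sectional (g c) x X Y.

Definition positive_curvature_operator : Prop :=
  forall (c : chart M) x, (coord c @` dom c) x ->
    op2_posdef (g c x) (riemann (g c) x).

Definition weyl_star_vanishes : Prop :=
  forall (c : chart M) x, (coord c @` dom c) x ->
    forall i j k l : 'I_n, weyl_star (g c) x i j k l = 0.

Definition exp_schouten_star_codazzi : Prop :=
  forall (c : chart M) x, (coord c @` dom c) x ->
    forall i j k : 'I_n,
      covd2_skew (g c) (exp_schouten_star (g c)) i j k x = 0.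

Definition locally_immersible (m : nat) : Prop :=
  forall p : M, exists2 U : set M, open_nbhs p U &
    exists2 u : 'I_m -> M -> R, (forall t, smooth_fun U (u t)) &
      forall (c : chart M) x, (coord c @` (U `&` dom c)) x ->
        forall a b : 'I_n,
          \sum_t pd a (u t \o param c) x * pd b (u t \o param c) x
          = g c x a b.

End GlobalConditions.

(* Main.v *)
Require Import Defs.
From mathcomp Require Import all_boot all_order all_algebra.
From mathcomp Require Import all_classical all_reals all_analysis.
From mathcomp Require Import ring lra.

(** Why the theorem holds. An immersed hypersurface has a second fundamental form
    h for which the curvature is R_abcd = h_ac h_bd - h_ad h_bc (Gauss) and h_ab;c
    is symmetric (Codazzi); conversely a field h with these two properties comes
    from a local immersion. So the two conditions have to be read as: R is of the
    form h ^ h with h positive, and e^P* is that h.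

    The pointwise part is [log_wedge2] and [exp_weyl_flat]. In a g-orthonormal
    frame e_i diagonalising h, with eigenvalues h_i, the operator h ^ h multiplies
    e_i ^ e_j by h_i h_j, so its logarithm multiplies it by ln h_i + ln h_j: the
    logarithm is the Kulkarni-Nomizu product of g with ln h. Its Weyl tensor
    vanishes, its Schouten tensor is ln h, and e^P* = h. Conversely C* = 0 says
    that ln R is the Kulkarni-Nomizu product of g with P*, and comparing
    eigenvalues gives R = e^P* ^ e^P*. Positive sectional curvature makes the
    products h_i h_j positive, so that h is definite, and positive for the right
    choice of normal ([sectional_posdef]). The existence of the logarithm
    rests on the spectral theorem for operators on 2-forms
    ([operator_eigenforms]), obtained from [simultaneous_diagonalisation].

    The differential part is [immersion_gauss_codazzi] and
    [gauss_codazzi_immersion]. The frame F formed by the unit normal and the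
    coordinate tangent vectors satisfies d_a F = A_a F, where A is built from the
    Christoffel symbols and h; the system is integrable exactly when g and h
    satisfy Gauss and Codazzi ([gauss_codazziP]). Integrable linear systems are
    solved by [linear_frobenius]: the equation is solved along rays, and the
    integrability condition shows that the result is differentiable in all
    directions, with an error of second order controlled by Gronwall's
    inequality. Smoothness of the solution follows from the equation.

    To apply this to h = e^P* one has to know that e^P* is smooth. This is read off
    the curvature: for n >= 3 every entry of h lies in a 3 x 3 block, whose entries
    are polynomials in its 2 x 2 minors, which are components of R, divided by the
    square root of another such polynomial ([wedge2_recover]). *)

Import Order.TTheory GRing.Theory Num.Theory.
Import numFieldNormedType.Exports.

Set Implicit Arguments.
Unset Strict Implicit.
Unset Printing Implicit Defensive.

Local Open Scope classical_set_scope.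
Local Open Scope ring_scope.

(** * Differentiation along coordinates *)

Section Calculus.
Context {R : realType}.

Lemma cvg_mx (T : Type) (F : set_system T) (FF : Filter F) m p
    (f : T -> 'M[R]_(m, p)) (l : 'M[R]_(m, p)) :
  (forall i j, (fun t => f t i j) @ F --> l i j) -> f @ F --> l.
Proof.
move=> fl; apply/cvgrPdist_le => /= e e0; near=> x.
rewrite /Num.Def.normr/= mx_normrE (bigmax_le _ (ltW e0))//= => i _.
rewrite !mxE/=.
move: i; near: x; apply: filter_forall => /= i.
exact: ((cvgrPdist_le _ _).1 (fl i.1 i.2)).
Unshelve. all: by end_near. Qed.

Lemma near_distP (V : normedModType R) (x : V) (P : V -> Prop) :
  (\forall y \near x, P y) <->
  exists2 d : R, 0 < d & forall y, `|y - x| < d -> P y.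
Proof.
split=> [/nbhs_ballP[d /= d0 dP]|[d d0 dP]].
  by exists d => // y yd; apply: dP; rewrite -ball_normE /= distrC.
apply/nbhs_ballP; exists d => // y.
by rewrite -ball_normE /= distrC; exact: dP.
Qed.

Lemma continuous_distP (V W : normedModType R) (f : V -> W) (x : V) :
  {for x, continuous f} <->
  forall e : R, 0 < e -> exists2 d : R, 0 < d &
    forall y, `|y - x| < d -> `|f y - f x| < e.
Proof.
split=> [/(@cvgrPdist_lt _ _ _ (nbhs x)) cf e e0|cf].
  by have /near_distP[d d0 dP] := cf e e0; exists d => // y /dP; rewrite distrC.
apply/(@cvgrPdist_lt _ _ _ (nbhs x)) => e /cf[d d0 dP].
by apply/near_distP; exists d => // y /dP; rewrite distrC.
Qed.

Lemma is_derive_line n (f : 'rV[R]_n -> R) (z v : 'rV[R]_n) (t : R) :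
  derivable f (z + t *: v) v ->
  is_derive t 1 (fun t => f (z + t *: v)) ('D_v f (z + t *: v)).
Proof.
move=> df.
have E : (fun h => h^-1 *: (((fun t => f (z + t *: v)) \o shift t) (h *: 1) -
   f (z + t *: v))) =
   (fun h => h^-1 *: ((f \o shift (z + t *: v)) (h *: v) - f (z + t *: v))).
  apply/funext => h /=; congr (_ *: (f _ - _)).
  by rewrite scalerDl addrCA [h *: 1]mulr1.
by apply: DeriveDef; rewrite /derivable /derive E.
Qed.

Lemma mvt_line n (f : 'rV[R]_n -> R) (z v : 'rV[R]_n) (h : R) :
  (forall t, `|t| <= `|h| -> derivable f (z + t *: v) v) ->
  exists2 c, `|c| <= `|h| & f (z + h *: v) - f z = 'D_v f (z + c *: v) * h.
Proof.
move=> df.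
have [->|h0] := eqVneq h 0.
  by exists 0; rewrite ?normr0// scale0r addr0 subrr mulr0.
pose phi t := f (z + t *: v).
have phi0 : f z = phi 0 by rewrite /phi scale0r addr0.
have dphi (t : R) : `|t| <= `|h| -> is_derive t 1 phi ('D_v f (z + t *: v)).
  by move=> /df; exact: is_derive_line.
have [hp|hn|/esym/eqP] := ltrgtP 0 h; last by rewrite (negbTE h0).
- have I t : t \in `[0, h] -> `|t| <= `|h|.
    by rewrite in_itv /= => /andP[t0 th]; rewrite !ger0_norm// (le_trans t0).
  have [||c ch E] := @MVT R phi (fun t => 'D_v f (z + t *: v)) 0 h hp.
  + by move=> t th; apply/dphi/I/subset_itv_oo_cc.
  + apply: derivable_within_continuous => t /I/dphi.
    by move=> [].
  exists c; first by apply/I/subset_itv_oo_cc.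
  by rewrite phi0 -/(phi h) E subr0.
- have I t : t \in `[h, 0] -> `|t| <= `|h|.
    by rewrite in_itv /= => /andP[t0 th]; rewrite !ler0_norm ?lerN2// ltW.
  have [||c ch E] := @MVT R phi (fun t => 'D_v f (z + t *: v)) h 0 hn.
  + by move=> t th; apply/dphi/I/subset_itv_oo_cc.
  + apply: derivable_within_continuous => t /I/dphi.
    by move=> [].
  exists c; first by apply/I/subset_itv_oo_cc.
  by rewrite phi0 -/(phi h) -opprB E sub0r mulrN opprK.
Qed.

Lemma ler_coord_norm n (x : 'rV[R]_n) i : `|x 0 i| <= `|x|.
Proof.
rewrite [leRHS]/Num.Def.normr/= mx_normrE.
by apply: le_trans; last exact: (le_bigmax _ (fun i => `|x i.1 i.2|) (0, i)).
Qed.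

Lemma rV_norm_le n (x : 'rV[R]_n) (d : R) :
  0 <= d -> (forall i, `|x 0 i| <= d) -> `|x| <= d.
Proof.
move=> d0 H; rewrite [leLHS]/Num.Def.normr/= mx_normrE.
by apply: bigmax_le => // -[i j] _ /=; rewrite ord1.
Qed.

(** Caratheodory form of differentiability: from x to y one coordinate moves at
    a time, and by the mean value theorem each difference quotient is a value of
    a partial derivative near x. It reduces the chain rule to limits of products. *)
Lemma C1_slopes n (f : 'rV[R]_n -> R) (x : 'rV[R]_n) :
  (\forall y \near x, forall i, derivable f y (delta_mx 0 i)) ->
  (forall i, {for x, continuous (pd i f)}) ->
  exists q : 'I_n -> 'rV[R]_n -> R,
    [/\ forall k, {for x, continuous (q k)},
        forall k, q k x = pd k f x &
        \forall y \near x, f y - f x = \sum_k q k y * (y 0 k - x 0 k)].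
Proof.
move=> df cf.
pose hyb (k : nat) (y : 'rV[R]_n) : 'rV[R]_n :=
  \row_(j < n) (if (j < k)%N then y 0 j else x 0 j).
have hyb0 y : hyb 0%N y = x by apply/rowP => j; rewrite mxE.
have hybn y : hyb n y = y by apply/rowP => j; rewrite mxE ltn_ord.
have hybS (k : 'I_n) y :
    hyb k.+1 y = hyb k y + (y 0 k - x 0 k) *: delta_mx 0 k.
  apply/rowP => j; rewrite !mxE eqxx /= ltnS leq_eqVlt.
  have [->|jk] := eqVneq j k; first by rewrite eqxx ltnn /= mulr1 addrC subrK.
  by rewrite -(inj_eq val_inj) /= in jk; rewrite (negbTE jk) /= mulr0 addr0.
have hyb_near (k : 'I_n) y c (d : R) : `|y - x| < d -> `|c| <= `|y 0 k - x 0 k| ->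
    `|hyb k y + c *: delta_mx 0 k - x| < d.
  move=> yd cy; apply: (le_lt_trans _ yd); apply: rV_norm_le => // j.
  rewrite !mxE /=.
  have [->|jk] := eqVneq j k.
    rewrite ltnn /= mulr1 addrAC subrr add0r (le_trans cy)//.
    by have := ler_coord_norm (y - x) k; rewrite !mxE.
  rewrite /= mulr0 addr0; case: ifP => _; last by rewrite subrr normr0.
  by have := ler_coord_norm (y - x) j; rewrite !mxE.
(* The quotient is completed, where it is 0 / 0, by the value making q_k
   continuous at x. *)
exists (fun (k : 'I_n) (y : 'rV[R]_n) => if y 0 k == x 0 k then pd k f x
                   else (f (hyb k.+1 y) - f (hyb k y)) / (y 0 k - x 0 k)).
have mvt (k : 'I_n) (d : R) : (forall y : 'rV[R]_n, `|y - x| < d -> forall i, derivable f y (delta_mx 0 i)) ->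
    forall y : 'rV[R]_n, `|y - x| < d -> exists2 z, `|z - x| < d &
      f (hyb k.+1 y) - f (hyb k y) = pd k f z * (y 0 k - x 0 k).
  move=> dd y yd; rewrite hybS.
  have [|c cy ->] := @mvt_line n f (hyb k y) (delta_mx 0 k) (y 0 k - x 0 k).
    by move=> t ty; apply: dd; exact: hyb_near.
  by exists (hyb k y + c *: delta_mx 0 k) => //; exact: hyb_near.
split=> [k|k|].
- apply/continuous_distP => e e0.
  move: df => /near_distP[d1 d10 df].
  have /continuous_distP/(_ e e0)[d2 d20 cfk] := cf k.
  pose d := Num.min d1 d2.
  have d0 : 0 < d by rewrite lt_min d10.
  exists d => // y yd.
  rewrite eqxx; case: ifPn => [_|yk]; first by rewrite subrr normr0.
  have [|z zd ->] := mvt k d _ y yd.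
    by move=> y' y'd; apply: df; rewrite (lt_le_trans y'd)// ge_min lexx.
  rewrite mulfK ?subr_eq0//; apply: cfk.
  by rewrite (lt_le_trans zd)// ge_min lexx orbT.
- by rewrite eqxx.
- near=> y.
  have -> : f y - f x = f (hyb n y) - f (hyb 0%N y) by rewrite hybn hyb0.
  rewrite -(@telescope_sumr _ 0 n (fun k => f (hyb k y)))// big_mkord.
  apply: eq_bigr => k _.
  case: ifPn => [/eqP yk|yk]; last by rewrite divfK ?subr_eq0.
  by rewrite hybS yk subrr scale0r addr0 subrr mulr0.
Unshelve. all: by end_near. Qed.
End Calculus.

(** * The chain rule and smooth functions *)

Section ChainRule.
Context {R : realType}.

Lemma cvg_sum_ord (T : Type) (F : set_system T) (FF : Filter F) (n : nat)
    (u : 'I_n -> T -> R) (l : 'I_n -> R) :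
  (forall k, u k @ F --> l k) -> (fun t => \sum_k u k t) @ F --> \sum_k l k.
Proof.
elim: n u l => [|n IH] u l ul.
  rewrite big_ord0; under eq_fun do rewrite big_ord0.
  exact: cvg_cst.
rewrite big_ord_recl; under eq_fun do rewrite big_ord_recl.
by apply: cvgD => //; apply: IH => k; exact: ul.
Qed.

Lemma is_derive_growth (V : normedModType R) (f : V -> R) (x v : V) (l : R) :
  (fun h : R => h^-1 *: (f (h *: v + x) - f x)) @ 0^' --> l ->
  is_derive x v f l.
Proof.
by move=> fl; apply: DeriveDef; [apply/cvg_ex; exists l | exact: cvg_lim].
Qed.

Lemma growth_is_derive (V : normedModType R) (f : V -> R) (x v : V) (l : R) :
  is_derive x v f l ->
  (fun h : R => h^-1 *: (f (h *: v + x) - f x)) @ 0^' --> l.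
Proof. by move=> [df <-]. Qed.

Lemma is_derive_lineP (V : normedModType R) (f : V -> R) (x v : V) (l : R) :
  is_derive x v f l <-> is_derive (0 : R) 1 (fun h : R => f (h *: v + x)) l.
Proof.
have E : (fun h : R => h^-1 *: (f (h *: v + x) - f x)) =
   (fun h : R => h^-1 *: (f ((h *: (1 : R) + 0 : R) *: v + x) - f ((0 : R) *: v + x))).
  by apply/funext => h; rewrite addr0 scale0r add0r [_%:A]mulr1.
by split=> /growth_is_derive df; apply: is_derive_growth; move: df; rewrite E.
Qed.

Lemma is_derive_comp_real (V : normedModType R) (phi : R -> R) (f : V -> R)
    (x v : V) (l l' : R) :
  is_derive (f x) 1 phi l -> is_derive x v f l' ->
  is_derive x v (phi \o f) (l * l').
Proof.
move=> dphi /is_derive_lineP df; apply/is_derive_lineP.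
have := @is_derive1_comp _ phi (fun h => f (h *: v + x)) 0 l l'.
by rewrite scale0r add0r => /(_ dphi df).
Qed.

Lemma is_derive_line_cont (V : normedModType R) (f : V -> R) (x v : V) :
  derivable f x v -> (fun h : R => f (h *: v + x)) @ 0^' --> f x.
Proof.
move=> df; suff : {for 0, continuous (fun h : R => f(h *: v + x))}.
  by move=> /continuous_withinNx; rewrite scale0r add0r.
exact/differentiable_continuous/derivable1_diffP/(derivable1P _ _ _).1.
Qed.

Lemma is_derive_comp_rV (V : normedModType R) n (f : 'rV[R]_n -> R)
    (g : V -> 'rV[R]_n) (x v : V) (d : 'I_n -> R) :
  (\forall y \near g x, forall i, derivable f y (delta_mx 0 i)) ->
  (forall i, {for g x, continuous (pd i f)}) ->
  (forall k, is_derive x v (fun y => g y 0 k) (d k)) ->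
  is_derive x v (f \o g) (\sum_k pd k f (g x) * d k).
Proof.
move=> df cf dg; have [q [qc qx qE]] := C1_slopes df cf.
have gl : (fun h : R => g (h *: v + x)) @ 0^' --> g x.
  apply: cvg_mx => i j; rewrite (ord1 i).
  have [dj _] := dg j; exact: (is_derive_line_cont dj).
apply: is_derive_growth.
have H : (fun h : R => \sum_k q k (g (h *: v + x)) *
      (h^-1 *: (g (h *: v + x) 0 k - g x 0 k))) @ 0^'
    --> \sum_k pd k f (g x) * d k.
  apply: cvg_sum_ord => k; apply: cvgM; last exact: growth_is_derive.
  rewrite -qx; exact: (cvg_comp _ _ gl (qc k)).
apply: cvg_trans H; apply: near_eq_cvg.
near=> h; rewrite /= (_ : f (g (h *: v + x)) - f (g x) =
   \sum_k q k (g (h *: v + x)) * (g (h *: v + x) 0 k - g x 0 k)).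
  by rewrite scaler_sumr; apply: eq_bigr => k _; rewrite scalerAr.
by near: h; exact: (gl _ qE).
Unshelve. all: by end_near. Qed.

End ChainRule.

Section SmoothOn.
Context {R : realType}.

Section Fixed.
Context {n : nat}.
Implicit Types (U : set 'rV[R]_n) (f g : 'rV[R]_n -> R).

Lemma smooth_on_continuous U f x : smooth_on U f -> U x -> {for x, continuous f}.
Proof. by move=> sf Ux; have [] := sf [::] x Ux. Qed.

Lemma smooth_on_derivable U f x i :
  smooth_on U f -> U x -> derivable f x (delta_mx 0 i).
Proof. by move=> sf Ux; have [_] := sf [::] x Ux; exact. Qed.

Lemma smooth_on_pd U f i : smooth_on U f -> smooth_on U (pd i f).
Proof.
move=> sf s x Ux; have := sf (rcons s i) x Ux.
by rewrite /iter_pd foldr_rcons.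
Qed.

Lemma smooth_on_sub U V f : U `<=` V -> smooth_on V f -> smooth_on U f.
Proof. by move=> UV sf s x Ux; apply: sf; exact: UV. Qed.

Lemma near_open U x : open U -> U x -> \forall y \near x, U y.
Proof. by move=> Uo Ux; exact: open_nbhs_nbhs. Qed.

Lemma pd_near f g x i : (\forall y \near x, f y = g y) -> pd i f x = pd i g x.
Proof. exact: near_eq_derive. Qed.

Lemma pd_eq_on U f g x i : open U -> U x -> (forall y, U y -> f y = g y) ->
  pd i f x = pd i g x.
Proof.
move=> Uo Ux fg; apply: pd_near.
by apply: filterS (near_open Uo Ux) => y; exact: fg.
Qed.

(** Coinduction: the iterated derivatives of a member of P agree on U with
    members of P, where openness of U lets derivatives be compared. *)
Lemma smooth_on_coind U (P : ('rV[R]_n -> R) -> Prop) : open U ->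
  (forall f, P f -> forall x, U x -> {for x, continuous f} /\
     forall i, derivable f x (delta_mx 0 i)) ->
  (forall f i, P f -> exists2 f', P f' & forall x, U x -> pd i f x = f' x) ->
  forall f, P f -> smooth_on U f.
Proof.
move=> Uo PC PD f Pf s.
have [f' Pf' ff'] : exists2 f', P f' & forall x, U x -> iter_pd s f x = f' x.
  elim: s => [|i s [f' Pf' IH]]; first by exists f.
  have [f'' Pf'' E] := PD f' i Pf'; exists f'' => // x Ux.
  by rewrite -E //= (pd_eq_on _ Uo Ux IH).
move=> x Ux; have [cf' df'] := PC f' Pf' x Ux.
have nf : \forall y \near x, f' y = iter_pd s f y.
  by apply: filterS (near_open Uo Ux) => y Uy; rewrite ff'.
split=> [|i]; last exact: near_eq_derivable (df' i).
rewrite /prop_for /continuous_at ff'//.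
exact: cvg_trans (near_eq_cvg nf) cf'.
Qed.

Lemma smooth_on_ext U f g : open U -> (forall x, U x -> f x = g x) ->
  smooth_on U f -> smooth_on U g.
Proof.
move=> Uo fg sf.
apply: (smooth_on_coind (P := fun g => exists2 f, smooth_on U f & forall x, U x -> g x = f x)) => //.
- move=> h [h' sh' hh'] x Ux.
  have nf : \forall y \near x, h' y = h y.
    by apply: filterS (near_open Uo Ux) => y Uy; rewrite hh'.
  split=> [|i]; last by apply: near_eq_derivable nf _; exact: smooth_on_derivable sh' Ux.
  rewrite /prop_for /continuous_at hh'//.
  by apply: cvg_trans (near_eq_cvg nf) _; exact: smooth_on_continuous sh' Ux.
- move=> h i [h' sh' hh']; exists (pd i h').
    by exists (pd i h') => //; exact: smooth_on_pd.
  by move=> x Ux; exact: pd_eq_on hh'.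
- by exists f => // x Ux; rewrite fg.
Qed.

Lemma is_derive_comp_smooth (V : normedModType R) U f
    (g : V -> 'rV[R]_n) (x v : V) (d : 'I_n -> R) :
  open U -> smooth_on U f -> U (g x) ->
  (forall k, is_derive x v (fun y => g y 0 k) (d k)) ->
  is_derive x v (f \o g) (\sum_k pd k f (g x) * d k).
Proof.
move=> Uo sf Ugx dg; apply: is_derive_comp_rV => //.
  by apply: filterS (near_open Uo Ugx) => y Uy i; exact: smooth_on_derivable sf Uy.
by move=> i; apply: smooth_on_continuous (smooth_on_pd i sf) Ugx.
Qed.

End Fixed.

(** All stability properties of smoothness are proved at once: the derivative of
    a function in this class is again in it, the chain rule being the case of
    compositions, so that the coinduction principle applies to the whole class. *)
Inductive smooth_alg n (U : set 'rV[R]_n) : ('rV[R]_n -> R) -> Prop :=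
| sa_smooth f : smooth_on U f -> smooth_alg U f
| sa_cst c : smooth_alg U (fun=> c)
| sa_add f g : smooth_alg U f -> smooth_alg U g ->
    smooth_alg U (fun x => f x + g x)
| sa_mul f g : smooth_alg U f -> smooth_alg U g ->
    smooth_alg U (fun x => f x * g x)
| sa_inv f : smooth_alg U f -> (forall x, U x -> f x != 0) ->
    smooth_alg U (fun x => (f x)^-1)
| sa_sqrt f : smooth_alg U f -> (forall x, U x -> 0 < f x) ->
    smooth_alg U (fun x => Num.sqrt (f x))
| sa_comp m (W : set 'rV[R]_m) (f : 'rV[R]_m -> R) (phi : 'rV[R]_n -> 'rV[R]_m) :
    open W -> smooth_on W f -> (forall k, smooth_alg U (fun x => phi x 0 k)) ->
    (forall x, U x -> W (phi x)) ->
    smooth_alg U (f \o phi).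

Section AlgSmooth.
Context {n : nat} (U : set 'rV[R]_n) (Uo : open U).

Lemma sa_sum (I : Type) (s : seq I) (P : pred I) (f : I -> 'rV[R]_n -> R) :
  (forall i, smooth_alg U (f i)) -> smooth_alg U (fun x => \sum_(i <- s | P i) f i x).
Proof.
move=> sf; elim: s => [|i s IH].
  rewrite (_ : (fun x => _) = fun=> 0); first exact: sa_cst.
  by apply/funext => x; rewrite big_nil.
have [Pi|Pi] := boolP (P i).
  rewrite (_ : (fun x => _) = fun x => f i x + \sum_(i <- s | P i) f i x).
    exact: sa_add.
  by apply/funext => x; rewrite big_cons Pi.
rewrite (_ : (fun x => _) = fun x => \sum_(i <- s | P i) f i x)//.
by apply/funext => x; rewrite big_cons (negbTE Pi).
Qed.

Lemma smooth_alg_step f : smooth_alg U f ->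
  (forall x, U x -> {for x, continuous f} /\
     forall i, derivable f x (delta_mx 0 i)) /\
  (forall i, exists2 f', smooth_alg U f' &
     forall x, U x -> is_derive x (delta_mx 0 i) f (f' x)).
Proof.
elim=> {f}.
- move=> f sf; split=> [x Ux|i].
    split=> [|i]; [exact: smooth_on_continuous sf Ux|exact: smooth_on_derivable sf Ux].
  exists (pd i f); first by apply: sa_smooth; exact: smooth_on_pd.
  by move=> x Ux; apply: derivableP; exact: smooth_on_derivable sf Ux.
- move=> c; split=> [x Ux|i]; first by split=> [|i]; [exact: cst_continuous|exact: derivable_cst].
  by exists (fun=> 0) => [|x _]; [exact: sa_cst|exact: is_derive_cst].
- move=> f g sf [cf df] sg [cg dg]; split=> [x Ux|i].
    have [[cfx dfx] [cgx dgx]] := (cf x Ux, cg x Ux).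
    by split=> [|i]; [exact: continuousD|exact: derivableD].
  have [[f' sf' ff'] [g' sg' gg']] := (df i, dg i).
  exists (fun x => f' x + g' x); first exact: sa_add.
  by move=> x Ux; have := ff' x Ux; have := gg' x Ux => ? ?; exact: is_deriveD.
- move=> f g sf [cf df] sg [cg dg]; split=> [x Ux|i].
    have [[cfx dfx] [cgx dgx]] := (cf x Ux, cg x Ux).
    by split=> [|i]; [exact: continuousM|exact: derivableM].
  have [[f' sf' ff'] [g' sg' gg']] := (df i, dg i).
  exists (fun x => f x * g' x + g x * f' x).
    by apply: sa_add; apply: sa_mul.
  by move=> x Ux; have := ff' x Ux; have := gg' x Ux => ? ?; exact: is_deriveM.
- move=> f sf [cf df] f0; split=> [x Ux|i].
    have [cfx dfx] := cf x Ux.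
    split=> [|i]; last by apply: derivableV => //; exact: f0.
    by apply: continuousV => //; exact: f0.
  have [f' sf' ff'] := df i.
  exists (fun x => -1 * ((f x)^-1 * (f x)^-1) * f' x).
    apply: sa_mul => //; apply: sa_mul; first exact: sa_cst.
    by apply: sa_mul; apply: sa_inv.
  move=> x Ux; have [fx fE] := ff' x Ux.
  apply: DeriveDef; first by apply: derivableV => //; exact: f0.
  rewrite deriveV//; last exact: f0.
  by rewrite fE -exprVn mulN1r.
- move=> f sf [cf df] f0.
  have D i f' x : U x -> is_derive x (delta_mx 0 i) f f' ->
      is_derive x (delta_mx 0 i) (Num.sqrt \o f) (2^-1 * (Num.sqrt (f x))^-1 * f').
    move=> Ux fx; rewrite -invfM; apply: is_derive_comp_real => //.
    by apply: is_derive1_sqrt; exact: f0.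
  split=> [x Ux|i].
    have [cfx dfx] := cf x Ux; split=> [|i].
      by apply: continuous_comp => //; exact: sqrt_continuous.
    by have [] := D i _ x Ux (derivableP (dfx i)).
  have [f' sf' ff'] := df i.
  exists (fun x => 2^-1 * (Num.sqrt (f x))^-1 * f' x).
    apply: sa_mul => //; apply: sa_mul; first exact: sa_cst.
    apply: sa_inv; first exact: sa_sqrt.
    by move=> x Ux; rewrite gt_eqF// sqrtr_gt0 f0.
  by move=> x Ux; apply: D => //; exact: ff'.
- move=> m W f phi Wo sf sphi IH Wphi.
  have D i x (d : 'I_m -> R) : U x ->
      (forall k, is_derive x (delta_mx 0 i) (fun x => phi x 0 k) (d k)) ->
      is_derive x (delta_mx 0 i) (f \o phi) (\sum_k pd k f (phi x) * d k).
    by move=> Ux dphi; apply: is_derive_comp_smooth Wo sf _ dphi; exact: Wphi.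
  split=> [x Ux|i].
    split=> [|i].
      have cphi : {for x, continuous phi}.
        apply: (@cvg_mx R _ (nbhs x) _ _ _ phi (phi x)) => a j; rewrite (ord1 a).
        exact: ((IH j).1 x Ux).1.
      apply: continuous_comp => //; apply: smooth_on_continuous sf _.
      exact: Wphi.
    have [] // := D i x (fun k => 'D_(delta_mx 0 i) (fun x => phi x 0 k) x) Ux.
    by move=> k; apply: derivableP; have [_] := (IH k).1 x Ux; exact.
  pose d k := sval (cid2 ((IH k).2 i)).
  have sd k : smooth_alg U (d k) by rewrite /d; case: cid2.
  have dP k x : U x -> is_derive x (delta_mx 0 i) (fun x => phi x 0 k) (d k x).
    by rewrite /d; case: (cid2 _) => f' sf' ff'; exact: ff'.
  exists (fun x => \sum_k (pd k f \o phi) x * d k x).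
    apply: sa_sum => k; apply: sa_mul; last exact: sd.
    exact: (sa_comp Wo (smooth_on_pd k sf) sphi Wphi).
  by move=> x Ux; apply: (D i x (fun k => d k x) Ux) => k; exact: dP.
Qed.

Lemma smooth_algP f : smooth_alg U f -> smooth_on U f.
Proof.
apply: smooth_on_coind => // {}f.
  by move=> /smooth_alg_step[].
move=> i /smooth_alg_step[_ /(_ i)[f' sf' ff']]; exists f' => // x Ux.
by have [_ <-] := ff' x Ux.
Qed.
End AlgSmooth.
End SmoothOn.

Section SmoothOps.
Context {R : realType} {n : nat} (U : set 'rV[R]_n) (Uo : open U).
Implicit Types f g : 'rV[R]_n -> R.

Lemma smooth_on_cst c : smooth_on U (fun=> c).
Proof. by apply: (smooth_algP Uo); exact: sa_cst. Qed.

Lemma smooth_onD f g :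
  smooth_on U f -> smooth_on U g -> smooth_on U (fun x => f x + g x).
Proof. by move=> sf sg; apply: (smooth_algP Uo); apply: sa_add; exact: sa_smooth. Qed.

Lemma smooth_onM f g :
  smooth_on U f -> smooth_on U g -> smooth_on U (fun x => f x * g x).
Proof. by move=> sf sg; apply: (smooth_algP Uo); apply: sa_mul; exact: sa_smooth. Qed.

Lemma smooth_onN f : smooth_on U f -> smooth_on U (fun x => - f x).
Proof.
move=> sf; rewrite (_ : (fun x => - f x) = fun x => -1 * f x).
  exact: smooth_onM (smooth_on_cst _) sf.
by apply/funext => x; rewrite mulN1r.
Qed.

Lemma smooth_onB f g :
  smooth_on U f -> smooth_on U g -> smooth_on U (fun x => f x - g x).
Proof. by move=> sf sg; exact: smooth_onD sf (smooth_onN sg). Qed.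

Lemma smooth_onV f : smooth_on U f -> (forall x, U x -> f x != 0) ->
  smooth_on U (fun x => (f x)^-1).
Proof. by move=> sf f0; apply: (smooth_algP Uo); apply: sa_inv f0; exact: sa_smooth. Qed.

Lemma smooth_on_sqrt f : smooth_on U f -> (forall x, U x -> 0 < f x) ->
  smooth_on U (fun x => Num.sqrt (f x)).
Proof. by move=> sf f0; apply: (smooth_algP Uo); apply: sa_sqrt f0; exact: sa_smooth. Qed.

Lemma smooth_on_sum (I : Type) (s : seq I) (P : pred I) (f : I -> 'rV[R]_n -> R) :
  (forall i, smooth_on U (f i)) -> smooth_on U (fun x => \sum_(i <- s | P i) f i x).
Proof. by move=> sf; apply: (smooth_algP Uo); apply: sa_sum => i; exact: sa_smooth. Qed.

Lemma smooth_on_prod (I : Type) (s : seq I) (P : pred I) (f : I -> 'rV[R]_n -> R) :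
  (forall i, smooth_on U (f i)) -> smooth_on U (fun x => \prod_(i <- s | P i) f i x).
Proof.
move=> sf; elim: s => [|i s IH].
  by under eq_fun do rewrite big_nil; exact: smooth_on_cst.
under eq_fun do rewrite big_cons.
by case: (P i); [exact: smooth_onM (sf i) IH|exact: IH].
Qed.

Lemma smooth_on_comp m (W : set 'rV[R]_m) (f : 'rV[R]_m -> R)
    (phi : 'rV[R]_n -> 'rV[R]_m) :
  open W -> smooth_on W f -> (forall k, smooth_on U (fun x => phi x 0 k)) ->
  (forall x, U x -> W (phi x)) -> smooth_on U (f \o phi).
Proof.
move=> Wo sf sphi UW; apply: (smooth_algP Uo); apply: sa_comp Wo sf _ UW => k.
exact: sa_smooth.
Qed.

Section At.
Variables (x : 'rV[R]_n) (Ux : U x) (a : 'I_n).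

Lemma smooth_is_derive f : smooth_on U f -> is_derive x (delta_mx 0 a) f (pd a f x).
Proof. by move=> sf; apply: derivableP; exact: smooth_on_derivable sf Ux. Qed.

Lemma pdD f g : smooth_on U f -> smooth_on U g ->
  pd a (fun x => f x + g x) x = pd a f x + pd a g x.
Proof.
move=> /smooth_is_derive df /smooth_is_derive dg.
exact: (derive_val (is_derive := is_deriveD df dg)).
Qed.

Lemma pdM f g : smooth_on U f -> smooth_on U g ->
  pd a (fun x => f x * g x) x = pd a f x * g x + f x * pd a g x.
Proof.
move=> /smooth_is_derive df /smooth_is_derive dg.
rewrite {1}/pd (derive_val (is_derive := is_deriveM df dg)) addrC mulrC.
by [].
Qed.

Lemma pd_cst (c : R) : pd a (fun=> c) x = 0.
Proof. exact: derive_cst. Qed.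

Lemma pd_sum (I : Type) (s : seq I) (P : pred I) (f : I -> 'rV[R]_n -> R) :
  (forall i, smooth_on U (f i)) ->
  pd a (fun x => \sum_(i <- s | P i) f i x) x = \sum_(i <- s | P i) pd a (f i) x.
Proof.
move=> sf; elim: s => [|i s IH].
  by under eq_fun do rewrite big_nil; rewrite big_nil pd_cst.
under eq_fun do rewrite big_cons.
rewrite big_cons; case: (P i) => //.
by rewrite (pdD (sf i) (smooth_on_sum s P sf)) IH.
Qed.

Lemma pdN f : smooth_on U f -> pd a (fun x => - f x) x = - pd a f x.
Proof.
move=> sf; apply/eqP; rewrite -addr_eq0 -(pdD (smooth_onN sf) sf).
by under eq_fun do rewrite addNr; rewrite pd_cst.
Qed.

Lemma pd_comp m (W : set 'rV[R]_m) (f : 'rV[R]_m -> R)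
    (phi : 'rV[R]_n -> 'rV[R]_m) :
  open W -> smooth_on W f -> (forall k, smooth_on U (fun x => phi x 0 k)) ->
  W (phi x) ->
  pd a (f \o phi) x = \sum_k pd k f (phi x) * pd a (fun y => phi y 0 k) x.
Proof.
move=> Wo sf sphi Wx.
have [] // := is_derive_comp_smooth (g := phi) (x := x) (v := delta_mx 0 a)
  (d := fun k => pd a (fun y => phi y 0 k) x) Wo sf Wx.
by move=> k; exact: smooth_is_derive.
Qed.

End At.
End SmoothOps.

Section Schwarz.
Context {R : realType} {n : nat}.

Lemma is_derive_shift_rV (f : 'rV[R]_n -> R) (x w v : 'rV[R]_n) l :
  is_derive (x + w) v f l -> is_derive x v (fun y => f (y + w)) l.
Proof.
move=> /growth_is_derive df; apply: is_derive_growth.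
by under eq_fun do rewrite -addrA.
Qed.

Let second_difference (f : 'rV[R]_n -> R) (U : set 'rV[R]_n) x (d h : R) i j :
  smooth_on U f -> 0 < h -> h + h < d -> (forall y, `|y - x| < d -> U y) ->
  exists2 p, `|p - x| < d &
    f (x + h *: delta_mx 0 i + h *: delta_mx 0 j) - f (x + h *: delta_mx 0 i)
    - (f (x + h *: delta_mx 0 j) - f x) = pd j (pd i f) p * h * h.
Proof.
move=> sf h0 hd dU.
have normE k (c : R) : `|c *: (delta_mx 0 k : 'rV[R]_n)| <= `|c|.
  apply: rV_norm_le => // l; rewrite !mxE normrM ler_piMr//.
  by case: (_ && _); rewrite ?normr1 ?normr0.
have B (c c' : R) : `|c| <= `|h| -> `|c'| <= `|h| ->
    `|x + c *: delta_mx 0 i + c' *: delta_mx 0 j - x| < d.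
  move=> ch c'h; rewrite addrAC (addrAC x) subrr add0r.
  apply: (le_lt_trans (ler_normD _ _)).
  have := normE i c; have := normE j c'.
  rewrite (gtr0_norm h0) in ch c'h; lra.
pose F y := f (y + h *: delta_mx 0 j) - f y.
have dF (c : R) : `|c| <= `|h| ->
   is_derive (x + c *: delta_mx 0 i) (delta_mx 0 i) F
     (pd i f (x + c *: delta_mx 0 i + h *: delta_mx 0 j) - pd i f (x + c *: delta_mx 0 i)).
  move=> ch.
  have d1 : is_derive (x + c *: delta_mx 0 i + h *: delta_mx 0 j) (delta_mx 0 i) f
      (pd i f (x + c *: delta_mx 0 i + h *: delta_mx 0 j)).
    by apply: (smooth_is_derive (dU _ _) i sf); exact: B.
  have d2 : is_derive (x + c *: delta_mx 0 i) (delta_mx 0 i) f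
      (pd i f (x + c *: delta_mx 0 i)).
    apply: (smooth_is_derive (dU _ _) i sf).
    by have := B c 0 ch; rewrite scale0r addr0 normr0; exact.
  exact: (is_deriveB (is_derive_shift_rV d1) d2).
have [|c ch] := @mvt_line R n F x (delta_mx 0 i) h.
  by move=> t th; case: (dF t th).
rewrite {1 2}/F => ->.
have [_ ->] := dF c ch.
have [|c' c'h ->] := @mvt_line R n (pd i f) (x + c *: delta_mx 0 i) (delta_mx 0 j) h.
  move=> t th; have Ut := dU _ (B c t ch th).
  by case: (smooth_is_derive Ut j (smooth_on_pd i sf)).
by exists (x + c *: delta_mx 0 i + c' *: delta_mx 0 j) => //; exact: B.
Qed.

(** Schwarz: the second difference of f over a small square with sides along i
    and j is h^2 times a value near x of either iterated derivative. *)
Lemma pd_comm (U : set 'rV[R]_n) (f : 'rV[R]_n -> R) x i j :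
  open U -> smooth_on U f -> U x -> pd i (pd j f) x = pd j (pd i f) x.
Proof.
move=> Uo sf Ux; apply/eqP; rewrite -subr_eq0 -normr_eq0 eq_le normr_ge0 andbT.
apply/ler_addgt0Pr => e e0; rewrite add0r.
have e20 : 0 < e / 2 by rewrite divr_gt0.
have /near_distP[d0 d00 dU] := near_open Uo Ux.
have ci k l := (smooth_on_continuous (smooth_on_pd k (smooth_on_pd l sf)) Ux).
have /continuous_distP/(_ _ e20)[d1 d10 c1] := ci i j.
have /continuous_distP/(_ _ e20)[d2 d20 c2] := ci j i.
pose d := Num.min d0 (Num.min d1 d2).
have dp : 0 < d by rewrite !lt_min d00 d10 d20.
have dd0 : d <= d0 by rewrite ge_min lexx.
have dd1 : d <= d1 by rewrite !ge_min lexx orbT.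
have dd2 : d <= d2 by rewrite !ge_min lexx !orbT.
have dU' y : `|y - x| < d -> U y by move=> yd; apply: dU; exact: lt_le_trans dd0.
have h0 : 0 < d / 3 by rewrite divr_gt0.
have hd : d / 3 + d / 3 < d by lra.
have [p pd' E1] := second_difference i j sf h0 hd dU'.
have [q qd' E2] := second_difference j i sf h0 hd dU'.
have E : pd j (pd i f) p = pd i (pd j f) q.
  apply: (mulIf (lt0r_neq0 h0)); apply: (mulIf (lt0r_neq0 h0)).
  apply: etrans (esym E1) (etrans _ E2).
  by rewrite [x + _ *: 'e_j + _]addrAC; ring.
have := c1 q (lt_le_trans qd' dd1); have := c2 p (lt_le_trans pd' dd2).
rewrite -E => A B.
move: A B; move: (pd i (pd j f) x) (pd j (pd i f) x) (pd j (pd i f) p) => u v w.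
rewrite !ltr_norml => /andP[A1 A2] /andP[B1 B2].
by rewrite ler_norml; apply/andP; split; clear -A1 A2 B1 B2; lra.
Qed.
End Schwarz.

(** * Fields of matrices *)

Section MatrixFields.
Context {R : realType} {n : nat} (U : set 'rV[R]_n) (Uo : open U).

Definition smooth_mx p q (F : 'rV[R]_n -> 'M[R]_(p, q)) : Prop :=
  forall i j, smooth_on U (fun x => F x i j).

Definition dmx p q (a : 'I_n) (F : 'rV[R]_n -> 'M[R]_(p, q)) (x : 'rV[R]_n) :
    'M[R]_(p, q) :=
  \matrix_(i, j) pd a (fun y => F y i j) x.

Lemma dmxE p q a (F : 'rV[R]_n -> 'M[R]_(p, q)) x i j :
  dmx a F x i j = pd a (fun y => F y i j) x.
Proof. by rewrite mxE. Qed.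

Lemma smooth_mx_cst p q (A : 'M[R]_(p, q)) : smooth_mx (fun=> A).
Proof. by move=> i j; exact: smooth_on_cst. Qed.

Lemma smooth_mxD p q (F G : 'rV[R]_n -> 'M[R]_(p, q)) :
  smooth_mx F -> smooth_mx G -> smooth_mx (fun x => F x + G x).
Proof. by move=> sF sG i j; under eq_fun do rewrite mxE; exact: smooth_onD. Qed.

Lemma smooth_mxN p q (F : 'rV[R]_n -> 'M[R]_(p, q)) :
  smooth_mx F -> smooth_mx (fun x => - F x).
Proof. by move=> sF i j; under eq_fun do rewrite mxE; exact: smooth_onN. Qed.

Lemma smooth_mxM p q r (F : 'rV[R]_n -> 'M[R]_(p, q)) (G : 'rV[R]_n -> 'M[R]_(q, r)) :
  smooth_mx F -> smooth_mx G -> smooth_mx (fun x => F x *m G x).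
Proof.
move=> sF sG i j; under eq_fun do rewrite mxE.
by apply: smooth_on_sum => // k; exact: smooth_onM.
Qed.

Lemma smooth_mx_tr p q (F : 'rV[R]_n -> 'M[R]_(p, q)) :
  smooth_mx F -> smooth_mx (fun x => (F x)^T).
Proof. by move=> sF i j; under eq_fun do rewrite mxE; exact: sF. Qed.

Lemma smooth_mx_dmx p q a (F : 'rV[R]_n -> 'M[R]_(p, q)) :
  smooth_mx F -> smooth_mx (dmx a F).
Proof. by move=> sF i j; under eq_fun do rewrite mxE; exact: smooth_on_pd. Qed.

Lemma smooth_mx_block p1 p2 q1 q2 (A : 'rV[R]_n -> 'M[R]_(p1, q1)) B C
    (D : 'rV[R]_n -> 'M[R]_(p2, q2)) :
  smooth_mx A -> smooth_mx B -> smooth_mx C -> smooth_mx D ->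
  smooth_mx (fun x => block_mx (A x) (B x) (C x) (D x)).
Proof.
move=> sA sB sC sD i j.
case: (split_ordP i) => i' ->; case: (split_ordP j) => j' ->.
- by under eq_fun do rewrite block_mxEul; exact: sA.
- by under eq_fun do rewrite block_mxEur; exact: sB.
- by under eq_fun do rewrite block_mxEdl; exact: sC.
- by under eq_fun do rewrite block_mxEdr; exact: sD.
Qed.

Lemma smooth_on_det p (F : 'rV[R]_n -> 'M[R]_p) :
  smooth_mx F -> smooth_on U (fun x => \det (F x)).
Proof.
move=> sF; apply: smooth_on_sum => // s; apply: smooth_onM => //.
  exact: smooth_on_cst.
by apply: smooth_on_prod => // i; exact: sF.
Qed.

Lemma smooth_mx_inv p (F : 'rV[R]_n -> 'M[R]_p) :
  smooth_mx F -> (forall x, U x -> F x \in unitmx) ->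
  smooth_mx (fun x => invmx (F x)).
Proof.
move=> sF F1 i j.
apply: (smooth_on_ext (f := fun x => (\det (F x))^-1 * cofactor (F x) j i)) => //.
  by move=> x Ux; rewrite /invmx F1// !mxE.
apply: smooth_onM => //.
  by apply: smooth_onV => // [|x /F1]; [exact: smooth_on_det|rewrite unitmxE unitfE].
apply: smooth_onM => //; first exact: smooth_on_cst.
apply: (@smooth_on_det _ (fun x => row' j (col' i (F x)))) => k l.
by under eq_fun do rewrite !mxE; exact: sF.
Qed.

Section At.
Variables (x : 'rV[R]_n) (Ux : U x).

Lemma dmx_eq_on p q a (F G : 'rV[R]_n -> 'M[R]_(p, q)) :
  (forall y, U y -> F y = G y) -> dmx a F x = dmx a G x.
Proof.
move=> FG; apply/matrixP => i j; rewrite !mxE.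
by apply: (pd_eq_on _ Uo Ux) => y Uy; rewrite FG.
Qed.

Lemma dmx_cst p q a (A : 'M[R]_(p, q)) : dmx a (fun=> A) x = 0.
Proof. by apply/matrixP => i j; rewrite !mxE pd_cst. Qed.

Lemma dmx_tr p q a (F : 'rV[R]_n -> 'M[R]_(p, q)) :
  dmx a (fun y => (F y)^T) x = (dmx a F x)^T.
Proof. by apply/matrixP => i j; rewrite !mxE; under eq_fun do rewrite mxE. Qed.

Lemma dmxD p q a (F G : 'rV[R]_n -> 'M[R]_(p, q)) :
  smooth_mx F -> smooth_mx G ->
  dmx a (fun y => F y + G y) x = dmx a F x + dmx a G x.
Proof.
move=> sF sG; apply/matrixP => i j; rewrite !mxE.
by under eq_fun do rewrite mxE; rewrite (pdD Ux).
Qed.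

Lemma dmxM p q r a (F : 'rV[R]_n -> 'M[R]_(p, q)) (G : 'rV[R]_n -> 'M[R]_(q, r)) :
  smooth_mx F -> smooth_mx G ->
  dmx a (fun y => F y *m G y) x = dmx a F x *m G x + F x *m dmx a G x.
Proof.
move=> sF sG; apply/matrixP => i j; rewrite !mxE -big_split /=.
under eq_fun do rewrite mxE.
rewrite (pd_sum Uo Ux) => [|k]; last exact: smooth_onM.
by apply: eq_bigr => k _; rewrite !mxE (pdM Ux).
Qed.

Lemma dmx_block p1 p2 q1 q2 a (A : 'rV[R]_n -> 'M[R]_(p1, q1)) B C
    (D : 'rV[R]_n -> 'M[R]_(p2, q2)) :
  dmx a (fun y => block_mx (A y) (B y) (C y) (D y)) x =
  block_mx (dmx a A x) (dmx a B x) (dmx a C x) (dmx a D x).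
Proof.
apply/matrixP => i j; rewrite mxE.
case: (split_ordP i) => i' ->; case: (split_ordP j) => j' ->.
- by rewrite block_mxEul mxE; under eq_fun do rewrite block_mxEul.
- by rewrite block_mxEur mxE; under eq_fun do rewrite block_mxEur.
- by rewrite block_mxEdl mxE; under eq_fun do rewrite block_mxEdl.
- by rewrite block_mxEdr mxE; under eq_fun do rewrite block_mxEdr.
Qed.

Lemma dmxC p q a b (F : 'rV[R]_n -> 'M[R]_(p, q)) :
  smooth_mx F -> dmx a (dmx b F) x = dmx b (dmx a F) x.
Proof.
move=> sF; apply/matrixP => i j.
have E c d : dmx c (dmx d F) x i j = pd c (pd d (fun y => F y i j)) x.
  rewrite [LHS]dmxE; congr (pd c _ x); apply/funext => y; exact: dmxE.
exact: etrans (E a b) (etrans (pd_comm a b Uo (sF i j) Ux) (esym (E b a))).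
Qed.

End At.
End MatrixFields.

(** * Linear differential equations *)

Section LinearODE.
Context {R : realType}.

Local Notation I01 t := (0 <= t <= 1).

Lemma antiderivative (phi : R -> R) : continuous phi ->
  exists Phi : R -> R, Phi 0 = 0 /\
    forall t : R, I01 t -> is_derive t 1 Phi (phi t).
Proof.
move=> cphi.
have iphi (a b : R) : lebesgue_measure.-integrable `[a, b] (EFin \o phi).
  apply: continuous_compact_integrable; first exact: segment_compact.
  exact: continuous_subspaceT.
pose F (x : R) := (\int[lebesgue_measure]_(t in [set` `[(-1), x]]) phi t)%R.
exists (fun x => F x - F 0); split=> [|t /andP[t0 t1]]; first by rewrite subrr.
have t2 : t < 2 by apply: (le_lt_trans t1); rewrite ltr1n.
have m1t : -1 < t by apply: lt_le_trans t0; rewrite ltrN10.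
have [dF EF] := continuous_FTC1_closed t2 (iphi _ _) m1t (cphi t).
rewrite -[phi t]subr0 -EF derive1E.
by apply: is_deriveB; apply: derivableP.
Qed.

Lemma is_derive_bound (Phi phi : R -> R) (c : R) :
  (forall t : R, I01 t -> is_derive t 1 Phi (phi t)) ->
  (forall t, I01 t -> `|phi t| <= c) ->
  forall s t : R, I01 s -> I01 t -> `|Phi t - Phi s| <= c * `|t - s|.
Proof.
move=> dP bP.
have bnd (s t : R) : s < t -> I01 s -> I01 t -> `|Phi t - Phi s| <= c * `|t - s|.
  move=> st /andP[s0 s1] /andP[t0 t1].
  have J u : u \in `[s, t] -> I01 u.
    by rewrite in_itv /= => /andP[su ut]; rewrite (le_trans s0 su) (le_trans ut t1).
  have [||u /subset_itv_oo_cc/J u01 ->] := @MVT R Phi phi s t st.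
  - by move=> u /subset_itv_oo_cc/J; exact: dP.
  - by apply: derivable_within_continuous => u /J/dP[].
  by rewrite normrM ler_wpM2r// bP.
move=> s t s01 t01; have [st|ts|->] := ltgtP s t; first exact: bnd.
  by rewrite distrC (distrC t); exact: bnd.
by rewrite !subrr normr0 mulr0.
Qed.

Lemma small_pow2 (C e : R) : 0 < e -> exists k : nat, C * 2^-1 ^+ k < e.
Proof.
move=> e0; exists (Num.bound (`|C| / e)); set k := Num.bound _.
have Ck : `|C| / e < k%:R by apply: archi_boundP; rewrite divr_ge0// ltW.
have k2 : (k%:R : R) <= 2 ^+ k by rewrite -natrX ler_nat ltnW// ltn_expl.
apply: (@le_lt_trans _ _ (`|C| * 2^-1 ^+ k)).
  by rewrite ler_wpM2r ?exprn_ge0 ?invr_ge0// ler_norm.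
rewrite exprVn ltr_pdivrMr ?exprn_gt0// mulrC -ltr_pdivrMr//.
exact: lt_le_trans Ck k2.
Qed.

Lemma le_pow2 (x y C : R) : (forall k : nat, x <= y + C * 2^-1 ^+ k) -> x <= y.
Proof.
move=> H; apply/ler_addgt0Pr => e e0.
have [k kP] := small_pow2 C e0.
by apply: (le_trans (H k)); rewrite lerD2l ltW.
Qed.

(** The intervals of radius 2 C / 2^k around a_k are nested, and L is the
    supremum of their lower ends. *)
Lemma geometric_limit (a : nat -> R) (C : R) :
  (forall k, `|a k.+1 - a k| <= C * 2^-1 ^+ k) ->
  exists L, forall k, `|a k - L| <= 2 * C * 2^-1 ^+ k.
Proof.
move=> aC.
pose lo k := a k - 2 * C * 2^-1 ^+ k; pose hi k := a k + 2 * C * 2^-1 ^+ k.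
have loS k : lo k <= lo k.+1.
  have := aC k; rewrite ler_norml /lo exprS => /andP[h _]; lra.
have hiS k : hi k.+1 <= hi k.
  have := aC k; rewrite ler_norml /hi exprS => /andP[_ h]; lra.
have lom k d : lo k <= lo (k + d)%N.
  by elim: d => [|d IH]; rewrite ?addn0// addnS (le_trans IH).
have him k d : hi (k + d)%N <= hi k.
  by elim: d => [|d IH]; rewrite ?addn0// addnS (le_trans _ IH).
have C0 : 0 <= C by have := aC 0%N; rewrite expr0 mulr1; exact: le_trans.
have lohi k : lo k <= hi k.
  by rewrite /lo /hi lerD2l (@le_trans _ _ 0)// ?oppr_le0 mulr_ge0// ?mulr_ge0// exprn_ge0// invr_ge0.
have LH k l : lo k <= hi l.
  apply: (le_trans (lom k l)); apply: (le_trans (lohi _)).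
  by rewrite addnC.
have hs : has_sup (range lo).
  by split; [exists (lo 0%N), 0%N | exists (hi 0%N) => _ [k _ <-]].
exists (sup (range lo)) => k.
have h1 : lo k <= sup (range lo) by apply: (ub_le_sup hs.2); exists k.
have h2 : sup (range lo) <= hi k.
  by apply: (ge_sup hs.1) => _ [l _ <-].
by rewrite ler_norml; rewrite /lo /hi in h1 h2; apply/andP; split; lra.
Qed.

Let clamp (t : R) : R := Num.max 0 (Num.min t 1).

Let clamp01 t : I01 (clamp t).
Proof.
rewrite /clamp le_max lexx /= ge_max ler01 /=.
by rewrite ge_min lexx orbT.
Qed.

Let clamp_id t : I01 t -> clamp t = t.
Proof. by move=> /andP[t0 t1]; rewrite /clamp (min_idPl t1) (max_idPr t0). Qed.

Let clamp_dist s t : `|clamp t - clamp s| <= `|t - s|.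
Proof.
rewrite /clamp !minEle !maxEle.
by have [] := leP t 1; have [] := leP s 1; try have [] := leP 0 t;
  try have [] := leP 0 s; try have [] := leP 0 1 => *;
  rewrite ?subrr ?normr0// ler_norml; have := ler_norm (t - s);
  have := ler_norm (s - t); rewrite (distrC s); lra.
Qed.

Let lipschitz_continuous (f : R -> R) (K : R) :
  (forall s t, `|f t - f s| <= K * `|t - s|) -> continuous f.
Proof.
move=> fK x; apply/continuous_distP => e e0.
have K0 : 0 <= K.
  by have := fK 0 1; rewrite subr0 normr1 mulr1; exact: le_trans.
exists (e / (K + 1)) => [|y yx]; first by rewrite divr_gt0// ltr_wpDl.
apply: (le_lt_trans (fK x y)).
have K1 : 0 < K + 1 by rewrite ltr_wpDl.
move: yx; rewrite ltr_pdivlMr// => yx.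
apply: le_lt_trans yx; rewrite mulrDr mulr1 mulrC.
by rewrite lerDl.
Qed.

Lemma mulmx_bound m p (B : 'M[R]_m) (F : 'M[R]_(m, p)) (b K : R) i j :
  \sum_l `|B i l| <= b -> (forall l, `|F l j| <= K) -> `|(B *m F) i j| <= b * K.
Proof.
move=> Bb FK; rewrite mxE; apply: (le_trans (ler_norm_sum _ _ _)).
apply: (@le_trans _ _ (\sum_l `|B i l| * K)).
  by apply: ler_sum => l _; rewrite normrM ler_wpM2l.
rewrite -mulr_suml ler_wpM2r//.
exact: le_trans (normr_ge0 _) (FK i).
Qed.

(** Picard iteration: as the coefficients have row sums at most 1/2, each step
    halves the distance, and the iterates share a Lipschitz constant, which their
    limit inherits. Times are clamped to [0, 1] to keep the iterates bounded on
    the whole line. *)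
Lemma linear_ode m p (B : R -> 'M[R]_m) (Y0 : 'M[R]_(m, p)) (K : R) :
  (forall i j, continuous (fun t => B t i j)) ->
  (forall t, I01 t -> forall i, \sum_l `|B t i l| <= 2^-1) ->
  (forall i j, `|Y0 i j| <= K) ->
  exists f : R -> 'M[R]_(m, p),
    [/\ f 0 = Y0,
        forall t : R, I01 t -> forall i j,
          is_derive t 1 (fun t => f t i j) ((B t *m f t) i j) &
        forall t, I01 t -> forall i j, `|f t i j| <= 2 * K].
Proof.
move=> cB bB Y0K.
have [anti antiP] : exists anti : (R -> R) -> R -> R, forall phi, continuous phi ->
    anti phi 0 = 0 /\ forall t : R, I01 t -> is_derive t 1 (anti phi) (phi t).
  exists (fun phi => if pselect (continuous phi) is left c
    then sval (cid (antiderivative c)) else fun=> 0) => phi c.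
  case: pselect => // c'; exact: (svalP (cid (antiderivative c'))).
pose rhs (u : R -> 'M[R]_(m, p)) i j t := (B t *m u t) i j.
pose T u : R -> 'M[R]_(m, p) := fun t => \matrix_(i, j) (Y0 i j + anti (rhs u i j) t).
pose u := fix u k := if k is k'.+1 then (fun t => T (u k') (clamp t)) else fun=> Y0.
have crhs (v : R -> 'M[R]_(m, p)) i j : (forall i j, continuous (fun t => v t i j)) -> continuous (rhs v i j).
  move=> cv t; rewrite /rhs /continuous_at mxE.
  under eq_fun do rewrite mxE.
  apply: (@cvg_sum_ord R _ (nbhs t)) => l.
  by apply: cvgM; [exact: cB|exact: cv].
have I0 : I01 (0 : R) by rewrite lexx ler01.
have Tbound (v : R -> 'M[R]_(m, p)) c i j :
    (forall i j, continuous (fun t => v t i j)) ->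
    (forall t i j, I01 t -> `|v t i j| <= c) ->
    forall s t, I01 s -> I01 t -> `|T v t i j - T v s i j| <= 2^-1 * c * `|t - s|.
  move=> cv vc s t s01 t01; rewrite !mxE opprD addrACA subrr add0r.
  have [_ dA] := antiP _ (crhs v i j cv).
  apply: is_derive_bound dA _ _ _ _ _ => // t' t'01.
  by apply: mulmx_bound; [exact: bB|move=> l; exact: vc].
have T0 (v : R -> 'M[R]_(m, p)) i j : (forall i j, continuous (fun t => v t i j)) -> T v 0 i j = Y0 i j.
  by move=> cv; rewrite mxE; have [-> _] := antiP _ (crhs v i j cv); rewrite addr0.
have Tbound0 (v : R -> 'M[R]_(m, p)) c i j t :
    (forall i j, continuous (fun t => v t i j)) ->
    (forall t i j, I01 t -> `|v t i j| <= c) -> I01 t -> 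
    `|T v t i j - Y0 i j| <= 2^-1 * c.
  move=> cv vc t01; have := Tbound v c i j cv vc 0 t I0 t01; rewrite T0// subr0 => h.
  apply: (le_trans h); rewrite ler_piMr//.
    by rewrite mulr_ge0 ?invr_ge0//; exact: le_trans (normr_ge0 _) (vc 0 i j I0).
  by have /andP[t0 t1] := t01; rewrite ger0_norm.
have Tdiff (v w : R -> 'M[R]_(m, p)) c i j t :
    (forall i j, continuous (fun t => v t i j)) ->
    (forall i j, continuous (fun t => w t i j)) ->
    (forall t i j, I01 t -> `|v t i j - w t i j| <= c) -> I01 t ->
    `|T v t i j - T w t i j| <= 2^-1 * c.
  move=> cv cw vw t01; rewrite !mxE opprD addrACA subrr add0r.
  have [v0 dv] := antiP _ (crhs v i j cv); have [w0 dw] := antiP _ (crhs w i j cw).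
  have H := @is_derive_bound (fun t => anti (rhs v i j) t - anti (rhs w i j) t)
    (fun t => rhs v i j t - rhs w i j t) (2^-1 * c).
  have {}H := H _ _ 0 t I0 t01; rewrite v0 w0 subrr !subr0 in H.
  apply: le_trans (H _ _) _.
  - by move=> t' t'01; apply: is_deriveB; [exact: dv|exact: dw].
  - move=> t' t'01; rewrite /rhs.
    rewrite (_ : _ - _ = (B t' *m (v t' - w t')) i j); last by rewrite mulmxBr !mxE.
    apply: mulmx_bound; first exact: bB.
    by move=> l; rewrite !mxE; exact: vw.
  - rewrite ler_piMr//.
      by rewrite mulr_ge0 ?invr_ge0//; exact: le_trans (normr_ge0 _) (vw 0 i j I0).
    by have /andP[t0 t1] := t01; rewrite ger0_norm.
have uP k : (forall i j, continuous (fun t => u k t i j)) /\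
    [/\ forall t i j, `|u k t i j| <= 2 * K,
        forall s t i j, `|u k t i j - u k s i j| <= K * `|t - s| &
        forall t i j, `|u k.+1 t i j - u k t i j| <= K * 2^-1 ^+ k].
  have K2 i j : `|Y0 i j| <= 2 * K.
    by have := Y0K i j; have := normr_ge0 (Y0 i j); lra.
  elim: k => [|k [cu [bu lu du]]].
    split; first by move=> i j t; exact: cst_continuous.
    split=> // [s t i j|t i j].
      rewrite subrr normr0 mulr_ge0//.
      by exact: le_trans (normr_ge0 _) (Y0K i j).
    rewrite expr0 mulr1 /=; apply: (le_trans (Tbound0 (fun=> Y0) K i j _ _ _ (clamp01 t))) => //.
      by move=> i' j' t'; exact: cst_continuous.
    have := Y0K i j; have := normr_ge0 (Y0 i j); lra.
  have lu' s t i j : `|u k.+1 t i j - u k.+1 s i j| <= K * `|t - s|.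
    have := Tbound (u k) (2 * K) i j cu (fun t i j _ => bu t i j) _ _ (clamp01 s) (clamp01 t).
    rewrite mulrA mulVf// mul1r => /le_trans; apply.
    apply: ler_wpM2l; last exact: clamp_dist.
    exact: le_trans (normr_ge0 _) (Y0K i j).
  have cu' i j : continuous (fun t => u k.+1 t i j).
    by apply: (lipschitz_continuous (K := K)) => s t; exact: lu'.
  split=> //; split=> // [t i j|t i j].
    have := Tbound0 (u k) (2 * K) i j _ cu (fun t i j _ => bu t i j) (clamp01 t).
    have := Y0K i j; rewrite mulrA mulVf// mul1r /= => h1 h2.
    rewrite -(subrK (Y0 i j) (T _ _ _ _)); apply: (le_trans (ler_normD _ _)); lra.
  have := Tdiff (u k.+1) (u k) (K * 2^-1 ^+ k) i j _ cu' cu (fun t i j _ => du t i j) (clamp01 t).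
  by rewrite mulrCA -exprS.
have [L LP] : exists L : R -> 'M[R]_(m, p), forall t k i j,
    `|u k t i j - L t i j| <= 2 * K * 2^-1 ^+ k.
  have H t i j : exists l, forall k, `|u k t i j - l| <= 2 * K * 2^-1 ^+ k.
    by apply: geometric_limit => k; have [_ [_ _]] := uP k; exact.
  exists (fun t => \matrix_(i, j) sval (cid (H t i j))) => t k i j; rewrite mxE.
  exact: (svalP (cid (H t i j))).
have LL s t i j : `|L t i j - L s i j| <= K * `|t - s|.
  apply: (@le_pow2 _ _ (4 * K)) => k.
  have [_ [_ lu _]] := uP k.
  have h1 := LP t k i j; have h2 := LP s k i j; have h3 := lu s t i j.
  rewrite distrC in h1.
  rewrite (_ : L t i j - L s i j = (L t i j - u k t i j) + (u k t i j - u k s i j)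
     + (u k s i j - L s i j)); last by ring.
  apply: (le_trans (ler_normD _ _)).
  have := ler_normD (L t i j - u k t i j) (u k t i j - u k s i j); lra.
have cL i j : continuous (fun t => L t i j).
  by apply: (lipschitz_continuous (K := K)) => s t; exact: LL.
have TL t i j : I01 t -> T L t i j = L t i j.
  move=> t01; apply/eqP; rewrite -subr_eq0 -normr_eq0 eq_le normr_ge0 andbT.
  apply: (@le_pow2 _ _ (4 * K)) => k; rewrite add0r.
  have [cu _] := uP k.
  have := Tdiff (u k) L (2 * K * 2^-1 ^+ k) i j _ cu cL (fun t i j _ => LP t k i j) t01.
  have := LP t k.+1 i j; rewrite /= clamp_id// exprS => h1 h2.
  rewrite distrC in h2; rewrite -(subrKA (T (u k) t i j)).
  apply: (le_trans (ler_normD _ _)).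
  have := le_trans (normr_ge0 _) h1; clear -h1 h2; lra.
exists (T L); split.
- by apply/matrixP => i j; exact: T0.
- move=> t t01 i j.
  have -> : (B t *m T L t) i j = 0 + rhs L i j t.
    by rewrite add0r /rhs !mxE; apply: eq_bigr => l _; rewrite TL.
  rewrite (_ : (fun t => T L t i j) = fun t => Y0 i j + anti (rhs L i j) t); last first.
    by apply/funext => s; rewrite mxE.
  by apply: is_deriveD; have [_] := antiP _ (crhs L i j cL); exact.
- move=> t t01 i j; rewrite TL//.
  have h := LP t; apply: (@le_pow2 _ _ (2 * K)) => k.
  have [_ [bu _ _]] := uP k; have := bu t i j; have := LP t k i j.
  rewrite distrC => h1 h2; rewrite -(subrK (u k t i j) (L t i j)).
  by apply: (le_trans (ler_normD _ _)); lra.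
Qed.

Lemma linear_ode_on m p (B : R -> 'M[R]_m) (Y0 : 'M[R]_(m, p)) (K : R) :
  (forall i j (t : R), I01 t -> {for t, continuous (fun t => B t i j)}) ->
  (forall t, I01 t -> forall i, \sum_l `|B t i l| <= 2^-1) ->
  (forall i j, `|Y0 i j| <= K) ->
  exists f : R -> 'M[R]_(m, p),
    [/\ f 0 = Y0,
        forall t : R, I01 t -> forall i j,
          is_derive t 1 (fun t => f t i j) ((B t *m f t) i j) &
        forall t, I01 t -> forall i j, `|f t i j| <= 2 * K].
Proof.
move=> cB bB Y0K.
have cclamp : continuous clamp.
  by apply: (lipschitz_continuous (K := 1)) => s t; rewrite mul1r clamp_dist.
have cB' i j : continuous (fun t => B (clamp t) i j).
  move=> t; apply: (@continuous_comp _ _ _ clamp (fun t => B t i j) t (cclamp t)).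
  exact: cB.
have [t t01|f [f0 df fK]] := linear_ode (B := fun t => B (clamp t)) cB' _ Y0K.
  by apply: bB.
exists f; split=> // t t01 i j.
by have := df t t01 i j; rewrite clamp_id.
Qed.

(** Gronwall: a family vanishing at 0 whose derivative is at most half its own
    size plus c stays below 2c, because any bound M improves to M/2 + c. *)
Lemma gronwall_half (I : finType) (D D' : I -> R -> R) (c : R) :
  0 <= c ->
  (forall i (t : R), I01 t -> is_derive t 1 (D i) (D' i t)) ->
  (forall i, D i 0 = 0) ->
  (forall M, (forall i t, I01 t -> `|D i t| <= M) ->
     forall i t, I01 t -> `|D' i t| <= 2^-1 * M + c) ->
  forall i t, I01 t -> `|D i t| <= 2 * c.
Proof.
move=> c0 dD D0 HD.
have [M0 M0P] : exists M0, forall i t, I01 t -> `|D i t| <= M0.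
  have H i : exists Mi, forall t, I01 t -> `|D i t| <= Mi.
    have cD : {within `[0, 1], continuous (fun t => `|D i t|)}.
      have cDi : {within `[0, 1], continuous (D i)}.
        by apply: derivable_within_continuous => t; rewrite in_itv /= => t01; case: (dD i t t01).
      by move=> t; apply: cvg_norm; exact: cDi.
    have [s _ sM] := EVT_max ler01 cD.
    by exists `|D i s| => t t01; apply: sM; rewrite in_itv.
  exists (\sum_i sval (cid (H i))) => i t t01.
  apply: (le_trans (svalP (cid (H i)) t t01)).
  rewrite (bigD1 i)//= lerDl; apply: sumr_ge0 => k _.
  exact: le_trans (normr_ge0 _) (svalP (cid (H k)) t t01).
move=> i t t01; apply: (@le_pow2 _ _ M0) => k.
elim: k i t t01 => [|k IH] i t t01.
  by rewrite expr0 mulr1; apply: (le_trans (M0P i t t01)); rewrite lerDr mulr_ge0.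
have bD' := HD _ IH.
have /andP[t0 t1] := t01.
have I0 : I01 (0 : R) by rewrite lexx ler01.
have := @is_derive_bound (D i) (D' i) _ (dD i) (bD' i) 0 t I0 t01.
rewrite D0 !subr0 => /le_trans; apply.
have h0 := le_trans (normr_ge0 _) (bD' i t t01).
apply: (@le_trans _ _ (2^-1 * (2 * c + M0 * 2^-1 ^+ k) + c)).
  by rewrite ler_piMr// ger0_norm.
by rewrite exprS; lra.
Qed.
End LinearODE.

(** * Uniform Taylor estimates *)

Section Taylor.
Context {R : realType} {n : nat}.

Lemma norm_segment (x z w : 'rV[R]_n) (r t : R) :
  `|z - x| < r -> `|z + w - x| < r -> 0 <= t <= 1 -> `|z + t *: w - x| < r.
Proof.
move=> zr wr /andP[t0 t1].
rewrite (_ : z + t *: w - x = (1 - t) *: (z - x) + t *: (z + w - x)); last first.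
  by apply/rowP => i; rewrite !mxE; ring.
apply: (le_lt_trans (ler_normD _ _)); rewrite !normrZ (ger0_norm t0).
rewrite ger0_norm ?subr_ge0//.
have [->|t10] := eqVneq t 1; first by rewrite subrr mul0r add0r mul1r.
have h1 : (1 - t) * `|z - x| < (1 - t) * r.
  by rewrite ltr_pM2l// subr_gt0 lt_neqAle t10.
have h2 : t * `|z + w - x| <= t * r by rewrite ler_wpM2l// ltW.
by clear -h1 h2; lra.
Qed.

Lemma is_derive_segment (U : set 'rV[R]_n) f (z w : 'rV[R]_n) (t : R) :
  open U -> smooth_on U f -> U (z + t *: w) ->
  is_derive t 1 (fun t => f (z + t *: w)) (\sum_a pd a f (z + t *: w) * w 0 a).
Proof.
move=> Uo sf Uz.
apply: (is_derive_comp_smooth (g := fun t : R => z + t *: w)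
  (d := fun a => w 0 a) Uo sf Uz) => k.
rewrite (_ : (fun y => _) = fun y => z 0 k + y * w 0 k); last first.
  by apply/funext => y; rewrite !mxE.
apply: is_derive_growth.
rewrite (_ : (fun h => _) = fun h : R => h^-1 * (h * w 0 k)); last first.
  by apply/funext => h; rewrite [h *: 1]mulr1; congr (_ * _); ring.
apply: (@cvg_trans _ ((fun=> w 0 k) @ (0 : R)^')); last exact: cvg_cst.
apply: near_eq_cvg; near=> h.
rewrite mulrA mulVf ?mul1r//.
near: h; exact: nbhs_dnbhs_neq.
Unshelve. all: by end_near. Qed.

Lemma mean_value_segment (U : set 'rV[R]_n) f (z w : 'rV[R]_n) :
  open U -> smooth_on U f -> (forall t : R, 0 <= t <= 1 -> U (z + t *: w)) ->
  exists2 c : R, 0 <= c <= 1 &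
    f (z + w) - f z = \sum_a pd a f (z + c *: w) * w 0 a.
Proof.
move=> Uo sf Us.
have d (t : R) : 0 <= t <= 1 -> is_derive t 1 (fun t => f (z + t *: w))
    (\sum_a pd a f (z + t *: w) * w 0 a).
  by move=> t01; apply: is_derive_segment Uo sf _; exact: Us.
have [||c c01] := @MVT R (fun t => f (z + t *: w))
    (fun t => \sum_a pd a f (z + t *: w) * w 0 a) 0 1 ltr01.
- by move=> t /subset_itv_oo_cc; rewrite in_itv /=; exact: d.
- by apply: derivable_within_continuous => t; rewrite in_itv /= => t01; case: (d t t01).
rewrite scale1r scale0r addr0 subr0 mulr1 => ->; exists c => //.
by move: c01 => /subset_itv_oo_cc; rewrite in_itv.
Qed.

Lemma near_bounded (f : 'rV[R]_n -> R) (x : 'rV[R]_n) :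
  {for x, continuous f} -> \forall y \near x, `|f y| <= `|f x| + 1.
Proof.
move=> /continuous_distP/(_ 1 ltr01)[d d0 dP]; apply/near_distP; exists d => // y /dP h.
rewrite -(subrK (f x) (f y)); apply: (le_trans (ler_normD _ _)).
by rewrite addrC lerD2l ltW.
Qed.

Lemma sum_bound (I : finType) (g : I -> R) (c : R) :
  (forall i, `|g i| <= c) -> `|\sum_i g i| <= #|I|%:R * c.
Proof.
move=> gc; apply: (le_trans (ler_norm_sum _ _ _)).
apply: (@le_trans _ _ (\sum_(i : I) c)); first exact: ler_sum.
by rewrite sumr_const mulr_natl.
Qed.

(** One constant serves the three bounds, so that the constants of a finite
    family of functions can be added up. *)
Definition taylor_bound (f : 'rV[R]_n -> R) (x0 : 'rV[R]_n) (r C : R) : Prop :=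
  forall z w : 'rV[R]_n, `|z - x0| < r -> `|z + w - x0| < r ->
  [/\ `|f z| <= C, `|f (z + w) - f z| <= C * `|w| &
      `|f (z + w) - f z - \sum_a w 0 a * pd a f z| <= C * `|w| ^+ 2].

Lemma smooth_taylor (U : set 'rV[R]_n) f x0 :
  open U -> smooth_on U f -> U x0 ->
  exists r C, [/\ 0 < r, 0 <= C & taylor_bound f x0 r C].
Proof.
move=> Uo sf Ux0.
pose K := 1 + `|f x0| + \sum_a `|pd a f x0| + \sum_a \sum_b `|pd b (pd a f) x0|.
have p1 : 0 <= \sum_a `|pd a f x0| by apply: sumr_ge0.
have p2 : 0 <= \sum_a \sum_b `|pd b (pd a f) x0|.
  by apply: sumr_ge0 => a _; apply: sumr_ge0.
have p0 := normr_ge0 (f x0).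
have K0 : 0 <= K by rewrite /K; clear -p0 p1 p2; lra.
have nU := near_open Uo Ux0.
have n0 : \forall z \near x0, `|f z| <= K.
  apply: filterS (near_bounded (smooth_on_continuous sf Ux0)) => z zf.
  by apply: (le_trans zf); rewrite /K; clear -p0 p1 p2; lra.
have n1 : \forall z \near x0, forall a, `|pd a f z| <= K.
  apply: (filter_forall (F := nbhs x0) (f := fun a z => `|pd a f z| <= K)) => a.
  apply: filterS (near_bounded (smooth_on_continuous (smooth_on_pd a sf) Ux0)) => z zf.
  have h : `|pd a f x0| <= \sum_a `|pd a f x0|.
    by rewrite [leRHS](bigD1 a)//= lerDl sumr_ge0.
  by apply: (le_trans zf); rewrite /K; clear -p0 p2 h; lra.
have n2 : \forall z \near x0, forall a b, `|pd b (pd a f) z| <= K.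
  apply: (filter_forall (F := nbhs x0) (f := fun a z => forall b, `|pd b (pd a f) z| <= K)) => a.
  apply: (filter_forall (F := nbhs x0) (f := fun b z => `|pd b (pd a f) z| <= K)) => b.
  apply: filterS (near_bounded (smooth_on_continuous (smooth_on_pd b (smooth_on_pd a sf)) Ux0)) => z zf.
  have h : `|pd b (pd a f) x0| <= \sum_a \sum_b `|pd b (pd a f) x0|.
    rewrite [leRHS](bigD1 a)//= [X in _ <= X + _](bigD1 b)//= -addrA lerDl.
    by rewrite addr_ge0// sumr_ge0// => i _; apply: sumr_ge0.
  by apply: (le_trans zf); rewrite /K; clear -p0 p1 h; lra.
have [r r0 rP] := (near_distP _ _).1 (filterI nU (filterI n0 (filterI n1 n2))).
have {}rP (z : 'rV[R]_n) : `|z - x0| < r -> [/\ U z, `|f z| <= K, forall a, `|pd a f z| <= K &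
    forall a b, `|pd b (pd a f) z| <= K].
  by move=> zr; have [? [? [? ?]]] := rP z zr.
pose N : R := n%:R.
have N0 : 0 <= N by rewrite ler0n.
have SB (h : 'I_n -> R) c : (forall i, `|h i| <= c) -> `|\sum_i h i| <= N * c.
  by move=> /sum_bound; rewrite card_ord.
exists r, (K + N * K + N * (N * K)); split=> //.
  by rewrite !addr_ge0// !mulr_ge0.
move=> z w zr wr.
have seg (t : R) : 0 <= t <= 1 -> `|z + t *: w - x0| < r by exact: norm_segment.
have Us (t : R) : 0 <= t <= 1 -> U (z + t *: w) by move=> t01; have [] := rP _ (seg t t01).
have lip a (t : R) : 0 <= t <= 1 -> `|pd a f (z + t *: w) - pd a f z| <= N * K * `|w|.
  move=> t01; have [c c01|c c01 ->] := @mean_value_segment U (pd a f) z (t *: w) Uo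
      (smooth_on_pd a sf).
    rewrite scalerA; apply: Us; case/andP: c01 => c0 c1; case/andP: t01 => t0 t1.
    by rewrite mulr_ge0//= mulr_ile1.
  rewrite -mulrA.
  apply: SB => b; rewrite normrM; apply: ler_pM => //.
    case/andP: c01 => c0 c1; case/andP: t01 => t0 t1.
    have ct01 : 0 <= c * t <= 1 by rewrite mulr_ge0//= mulr_ile1.
    by have [_ _ _ h] := rP _ (seg _ ct01); rewrite scalerA; exact: h.
  rewrite mxE normrM.
  case/andP: t01 => t0 t1; rewrite (ger0_norm t0).
  by apply: (le_trans (ler_piMl (normr_ge0 _) t1)); exact: ler_coord_norm.
have NK0 : 0 <= N * K by rewrite mulr_ge0.
have NNK0 : 0 <= N * (N * K) by rewrite mulr_ge0.
have [c c01 E] := mean_value_segment Uo sf Us.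
split.
- have [_ fz _ _] := rP _ zr; apply: (le_trans fz).
  by clear -NK0 NNK0; lra.
- rewrite E; apply: (@le_trans _ _ (N * (K * `|w|))).
    apply: SB => b; rewrite normrM; apply: ler_pM => //.
      by have [_ _ h _] := rP _ (seg c c01); exact: h.
    exact: ler_coord_norm.
  rewrite (_ : N * (K * `|w|) = (N * K) * `|w|); last by rewrite mulrA.
  by apply: ler_wpM2r => //; clear -K0 NNK0; lra.
- rewrite E -sumrB.
  apply: (@le_trans _ _ (N * (N * K * `|w| * `|w|))).
    apply: SB => b; rewrite [w 0 b * _]mulrC -mulrBl normrM.
    by apply: ler_pM => //; [exact: lip|exact: ler_coord_norm].
  rewrite (_ : N * (N * K * `|w| * `|w|) = N * (N * K) * `|w| ^+ 2); last by ring.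
  by apply: ler_wpM2r; rewrite ?exprn_ge0//; clear -K0 NK0; lra.
Qed.

Lemma taylor_bound_mono f x0 (r r' C C' : R) :
  r' <= r -> C <= C' -> taylor_bound f x0 r C -> taylor_bound f x0 r' C'.
Proof.
move=> rr CC H z w zr wr; have [h1 h2 h3] := H z w (lt_le_trans zr rr) (lt_le_trans wr rr).
split; first exact: le_trans CC.
- by apply: (le_trans h2); rewrite ler_wpM2r.
- by apply: (le_trans h3); rewrite ler_wpM2r// exprn_ge0.
Qed.

Lemma smooth_taylor_family (I : finType) (U : set 'rV[R]_n) (f : I -> 'rV[R]_n -> R) x0 :
  open U -> (forall i, smooth_on U (f i)) -> U x0 ->
  exists r C, [/\ 0 < r, 0 <= C & forall i, taylor_bound (f i) x0 r C].
Proof.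
move=> Uo sf Ux0.
have H i : exists rC : R * R, [/\ 0 < rC.1, 0 <= rC.2 & taylor_bound (f i) x0 rC.1 rC.2].
  by have [r [C rC]] := smooth_taylor Uo (sf i) Ux0; exists (r, C).
pose q i := sval (cid (H i)).
have qP i : [/\ 0 < (q i).1, 0 <= (q i).2 & taylor_bound (f i) x0 (q i).1 (q i).2].
  exact: (svalP (cid (H i))).
exists (\big[Num.min/1]_i (q i).1), (\sum_i (q i).2); split.
- by apply: lt_bigmin => // i _; have [] := qP i.
- by apply: sumr_ge0 => i _; have [] := qP i.
- move=> i; have [q1 q2 qt] := qP i; apply: taylor_bound_mono qt.
    exact: bigmin_le_cond.
  by rewrite [leRHS](bigD1 i)//= lerDl; apply: sumr_ge0 => j _; have [] := qP j.
Qed.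

End Taylor.

(** * The Frobenius theorem for linear systems *)

Section Frobenius.
Context {R : realType}.

Lemma is_derive_mulmx m q p (P : R -> 'M[R]_(m, q)) (Q : R -> 'M[R]_(q, p))
    (P' : 'M[R]_(m, q)) (Q' : 'M[R]_(q, p)) (t : R) :
  (forall i j, is_derive t 1 (fun t => P t i j) (P' i j)) ->
  (forall i j, is_derive t 1 (fun t => Q t i j) (Q' i j)) ->
  forall i j, is_derive t 1 (fun t => (P t *m Q t) i j) ((P' *m Q t + P t *m Q') i j).
Proof.
move=> dP dQ i j.
rewrite (_ : (fun t => _) = \sum_l (fun t => P t i l * Q t l j)); last first.
  by apply/funext => s; rewrite mxE fct_sumE.
rewrite !mxE -big_split /=.
apply: is_derive_sum => l.
apply: is_derive_eq (is_deriveM (dP i l) (dQ l j)) _.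
by rewrite addrC; congr (_ + _); exact: mulrC.
Qed.

Let mxE3 m p (P Q S : 'M[R]_(m, p)) (t : R) i j :
  (P - Q - t *: S) i j = P i j - Q i j - t * S i j.
Proof. by rewrite !mxE. Qed.

Let mxE4 m p (P Q S Z : 'M[R]_(m, p)) (t : R) i j :
  (P - Q - (t *: S + Z)) i j = P i j - Q i j - (t * S i j + Z i j).
Proof. by rewrite !mxE. Qed.

Let error_identity m p (B' B W X : 'M[R]_m) (F' F : 'M[R]_(m, p)) (t : R) :
  B' *m (F' - F - t *: (W *m F)) +
    (B' - B - W - t *: X + t *: ((B' - B) *m W)) *m F =
  B' *m F' - B *m F - (t *: ((X + B *m W) *m F) + W *m F).
Proof.
rewrite !mulmxBr -!scalemxAr !mulmxBl !scalerBr !(mulmxDl, scalerDr).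
rewrite !mulNmx -!scalemxAl !mulmxA.
move: (B' *m F') (B' *m F) (B' *m W *m F) (B *m F) (W *m F) (X *m F) (B *m W *m F).
by move=> Z1 Z2 Z3 Z4 Z5 Z6 Z7; apply/matrixP => k l; rewrite !mxE; ring.
Qed.

Section Fixed.
Variables (n m p : nat) (U : set 'rV[R]_n) (A : 'I_n -> 'rV[R]_n -> 'M[R]_m)
  (x0 : 'rV[R]_n) (r C K : R).
Hypothesis Uo : open U.
Hypothesis sA : forall a, smooth_mx U (A a).
Hypothesis flatA : forall x, U x -> forall a b,
  dmx b (A a) x + A a x *m A b x = dmx a (A b) x + A b x *m A a x.
Hypothesis r1 : r <= 1.
Hypothesis C0 : 0 <= C.
Hypothesis rU : forall z, `|z - x0| < r -> U z.
Hypothesis tA : forall a i j, taylor_bound (fun x => A a x i j) x0 r C.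
Hypothesis rC : m%:R * (n%:R * r * C) <= 2^-1.

Let W (v w : 'rV[R]_n) (t : R) : 'M[R]_m := \sum_a w 0 a *: A a (x0 + t *: v).
Let W' (v w : 'rV[R]_n) (t : R) : 'M[R]_m :=
  \sum_a \sum_b (w 0 a * v 0 b) *: dmx b (A a) (x0 + t *: v).
Let X (v w : 'rV[R]_n) (t : R) : 'M[R]_m :=
  \sum_a \sum_b (w 0 a * v 0 b) *: dmx a (A b) (x0 + t *: v).

Let ray v (t : R) : `|v| < r -> 0 <= t <= 1 -> `|x0 + t *: v - x0| < r.
Proof.
move=> vr /andP[t0 t1]; rewrite addrAC subrr add0r normrZ (ger0_norm t0).
exact: le_lt_trans (ler_piMl (normr_ge0 _) t1) vr.
Qed.

Let SB (h : 'I_n -> R) c : (forall i, `|h i| <= c) -> `|\sum_i h i| <= n%:R * c.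
Proof. by move=> /sum_bound; rewrite card_ord. Qed.

Let SBm (h : 'I_m -> R) c : (forall i, `|h i| <= c) -> \sum_i `|h i| <= m%:R * c.
Proof.
move=> hc; apply: (@le_trans _ _ (\sum_(i < m) c)); first exact: ler_sum.
by rewrite sumr_const card_ord mulr_natl.
Qed.

Let WE v w t i j : W v w t i j = \sum_a w 0 a * A a (x0 + t *: v) i j.
Proof. by rewrite /W summxE; apply: eq_bigr => a _; rewrite mxE. Qed.

Let W_bound v w t i j : `|v| < r -> 0 <= t <= 1 -> `|W v w t i j| <= n%:R * (`|w| * C).
Proof.
move=> vr t01; rewrite WE; apply: SB => a; rewrite normrM.
apply: ler_pM => //; first exact: ler_coord_norm.
have zr := ray vr t01.
have [|h _ _] := @tA a i j (x0 + t *: v) 0 zr; last exact: h.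
by rewrite addr0.
Qed.

Let B_bound v t i : `|v| < r -> 0 <= t <= 1 -> \sum_l `|W v v t i l| <= 2^-1.
Proof.
move=> vr t01; apply: le_trans rC; apply: SBm => l.
apply: (le_trans (W_bound v i l vr t01)).
by rewrite mulrA ler_wpM2r// ler_wpM2l// ltW.
Qed.

Let dA v (t : R) a i j : `|v| < r -> 0 <= t <= 1 ->
  is_derive t 1 (fun t => A a (x0 + t *: v) i j)
    (\sum_b pd b (fun x => A a x i j) (x0 + t *: v) * v 0 b).
Proof.
move=> vr t01; apply: (is_derive_segment Uo (sA a i j)); apply: rU.
exact: ray.
Qed.

Let dW v w (t : R) i j : `|v| < r -> 0 <= t <= 1 ->
  is_derive t 1 (fun t => W v w t i j) (W' v w t i j).
Proof.
move=> vr t01.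
rewrite (_ : (fun t => _) = \sum_a (fun t => w 0 a * A a (x0 + t *: v) i j)); last first.
  by apply/funext => s; rewrite WE fct_sumE.
rewrite (_ : W' v w t i j = \sum_a w 0 a *
   (\sum_b pd b (fun x => A a x i j) (x0 + t *: v) * v 0 b)); last first.
  rewrite /W' summxE; apply: eq_bigr => a _; rewrite summxE mulr_sumr.
  by apply: eq_bigr => b _; rewrite mxE dmxE; ring.
apply: is_derive_sum => a.
exact: (is_deriveZ (w 0 a) (dA a i j vr t01)).
Qed.

(** Flatness contracted with v and w: it exchanges the derivative W' of W along
    the ray with the variation X of the ray coefficients in the direction w. *)
Let flat_ray v w t : `|v| < r -> 0 <= t <= 1 ->
  X v w t + W v v t *m W v w t = W' v w t + W v w t *m W v v t.
Proof.
move=> vr t01.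
have E u u' : W v u t *m W v u' t =
   \sum_a \sum_b (u 0 a * u' 0 b) *: (A a (x0 + t *: v) *m A b (x0 + t *: v)).
  rewrite /W mulmx_suml; apply: eq_bigr => a _.
  rewrite mulmx_sumr; apply: eq_bigr => b _.
  by rewrite -scalemxAl -scalemxAr scalerA.
rewrite !E [in LHS]exchange_big /X /W' -!big_split /=; apply: eq_bigr => a _.
rewrite -!big_split /=; apply: eq_bigr => b _.
rewrite [v 0 b * _]mulrC -!scalerDr.
by rewrite -(flatA (rU (ray vr t01)) a b).
Qed.

Let p0 : R := 2 * n%:R * C + 2 * m%:R * n%:R ^+ 2 * C ^+ 2.

Let W_diff v w t i j : `|v| < r -> `|v + w| < r -> 0 <= t <= 1 ->
  `|(W (v + w) (v + w) t - W v v t - W v w t - t *: X v w t) i j|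
    <= 2 * n%:R * C * `|w| ^+ 2 /\
  `|(W (v + w) (v + w) t - W v v t) i j| <= 2 * n%:R * C * `|w|.
Proof.
move=> vr vwr t01; have /andP[t0 t1] := t01.
have zr := ray vr t01; have zr' := ray vwr t01.
rewrite scalerDr addrA in zr'.
have tw : `|t *: w| <= `|w| by rewrite normrZ (ger0_norm t0) ler_piMl.
have v1 a : `|v 0 a| <= 1.
  by apply: (le_trans (ler_coord_norm v a)); exact: le_trans (ltW vr) r1.
have w1 a := ler_coord_norm w a.
have T a : [/\ `|A a (x0 + t *: v + t *: w) i j| <= C,
   `|A a (x0 + t *: v + t *: w) i j - A a (x0 + t *: v) i j| <= C * `|w| &
   `|A a (x0 + t *: v + t *: w) i j - A a (x0 + t *: v) i j -
      \sum_b (t *: w) 0 b * pd b (fun x => A a x i j) (x0 + t *: v)| <= C * `|w| ^+ 2].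
  have [_ h2 h3] := @tA a i j _ _ zr zr'.
  split.
  - have [|h _ _] := @tA a i j (x0 + t *: v + t *: w) 0 zr'; last exact: h.
    by rewrite addr0.
  - by apply: (le_trans h2); rewrite ler_wpM2l.
  - apply: (le_trans h3); rewrite ler_wpM2l// lerXn2r ?nnegrE//.
have WE' : W (v + w) (v + w) t i j =
    \sum_a (v 0 a + w 0 a) * A a (x0 + t *: v + t *: w) i j.
  by rewrite WE; apply: eq_bigr => a _; rewrite mxE scalerDr addrA.
split.
- have -> : (W (v + w) (v + w) t - W v v t - W v w t - t *: X v w t) i j =
    \sum_a (v 0 a * (A a (x0 + t *: v + t *: w) i j - A a (x0 + t *: v) i j -
      \sum_b (t *: w) 0 b * pd b (fun x => A a x i j) (x0 + t *: v)) +
      w 0 a * (A a (x0 + t *: v + t *: w) i j - A a (x0 + t *: v) i j)).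
    have -> : X v w t = \sum_b \sum_a (w 0 a * v 0 b) *: dmx a (A b) (x0 + t *: v).
      by rewrite /X exchange_big.
    rewrite !mxE WE' !WE summxE mulr_sumr -!sumrB; apply: eq_bigr => a _.
    rewrite summxE !mulrBr !mulr_sumr.
    have -> : \sum_(i0 < n) t * ((w 0 i0 * v 0 a) *: dmx i0 (A a) (x0 + t *: v)) i j =
       \sum_(i0 < n) v 0 a * ((t *: w) 0 i0 * pd i0 (fun x => A a x i j) (x0 + t *: v)).
      by apply: eq_bigr => b _; rewrite mxE [(t *: w) 0 b]mxE dmxE; ring.
    by ring.
  rewrite (_ : 2 * _ * _ * _ = n%:R * (1 * (C * `|w| ^+ 2) + `|w| * (C * `|w|))); last by ring.
  apply: SB => a; apply: (le_trans (ler_normD _ _)); have [h1 h2 h3] := T a.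
  by rewrite !normrM; apply: lerD; apply: ler_pM.
- rewrite !mxE WE' WE -sumrB.
  rewrite (_ : 2 * _ * _ * _ = n%:R * (1 * (C * `|w|) + `|w| * C)); last by ring.
  apply: SB => a; have [h1 h2 h3] := T a.
  rewrite (_ : _ - _ = v 0 a * (A a (x0 + t *: v + t *: w) i j - A a (x0 + t *: v) i j)
     + w 0 a * A a (x0 + t *: v + t *: w) i j); last by ring.
  apply: (le_trans (ler_normD _ _)).
  by rewrite !normrM; apply: lerD; apply: ler_pM.
Qed.

Variables (Y0 : 'M[R]_(m, p)) (F : 'rV[R]_n -> R -> 'M[R]_(m, p)).
Hypothesis F0 : forall v, `|v| < r -> F v 0 = Y0.
Hypothesis dF : forall v (t : R), `|v| < r -> 0 <= t <= 1 -> forall i j,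
  is_derive t 1 (fun t => F v t i j) ((W v v t *m F v t) i j).
Hypothesis FK : forall v t, `|v| < r -> 0 <= t <= 1 -> forall i j, `|F v t i j| <= K.

(** To first order in w, the solutions along the rays of directions v and v + w
    differ at time t by t W F. By flatness the error satisfies the ray equation
    of v + w up to a source of size |w|^2, and Gronwall applies. *)
Lemma ray_variation v w : `|v| < r -> `|v + w| < r -> forall i j,
  `|(F (v + w) 1 - F v 1 - W v w 1 *m F v 1) i j| <=
     2 * (m%:R * p0 * K) * `|w| ^+ 2.
Proof.
move=> vr vwr.
(* Dm is the error, and Em F the source in its equation. *)
pose Dm t := F (v + w) t - F v t - t *: (W v w t *m F v t).
pose Em t := W (v + w) (v + w) t - W v v t - W v w t - t *: X v w t
  + t *: ((W (v + w) (v + w) t - W v v t) *m W v w t).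
pose D' (ij : 'I_m * 'I_p) t := (W (v + w) (v + w) t *m Dm t + Em t *m F v t) ij.1 ij.2.
have K0 (i : 'I_m) (j : 'I_p) : 0 <= K.
  by apply: le_trans (normr_ge0 _) (FK (t := 0) vr _ i j); rewrite lexx ler01.
have p00 : 0 <= p0.
  by rewrite /p0 !addr_ge0// !mulr_ge0// exprn_ge0.
have I1 : 0 <= (1 : R) <= 1 by rewrite ler01 lexx.
suff H : forall ij t, 0 <= t <= 1 -> `|Dm t ij.1 ij.2| <= 2 * (m%:R * p0 * K * `|w| ^+ 2).
  move=> i j; have := H (i, j) 1 I1; rewrite /Dm scale1r /= => h.
  by apply: (le_trans h); rewrite !mulrA.
move=> ij.
apply: (gronwall_half (D := fun ij t => Dm t ij.1 ij.2) (D' := D')).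
- case: ij => i j; rewrite !mulr_ge0// ?exprn_ge0//.
  exact: K0 i j.
- move=> [i j] t t01.
  have d1 := dF vwr t01 i j; have d2 := dF vr t01 i j.
  have d3 := is_derive_mulmx (fun i j => dW w i j vr t01) (fun i j => dF vr t01 i j) i j.
  have d4 := is_deriveM (is_derive_id t 1) d3.
  have d5 := is_deriveB (is_deriveB d1 d2) d4.
  rewrite (_ : (fun t => _) = (fun t => F (v + w) t i j) - (fun t => F v t i j)
     - (id * (fun t => (W v w t *m F v t) i j))); last first.
    by apply/funext => s; rewrite /Dm mxE3.
  apply: is_derive_eq d5 _.
  rewrite /D' /=.
  have -> : W (v + w) (v + w) t *m Dm t + Em t *m F v t =
     W (v + w) (v + w) t *m F (v + w) t - W v v t *m F v t -
     (t *: (W' v w t *m F v t + W v w t *m (W v v t *m F v t)) + W v w t *m F v t).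
    have E := flat_ray w vr t01.
    have -> : W' v w t *m F v t + W v w t *m (W v v t *m F v t) =
       (X v w t + W v v t *m W v w t) *m F v t.
      by rewrite E mulmxDl !mulmxA.
    exact: error_identity.
  by rewrite mxE4 /GRing.scale /= mulr1.
- move=> [i j] /=; rewrite /Dm !F0// subrr add0r scale0r oppr0 mxE.
  by [].
- move=> M DM [i j] t t01; rewrite /D' mxE /=.
  apply: (le_trans (ler_normD _ _)); apply: lerD.
    apply: mulmx_bound; first exact: B_bound.
    by move=> l; exact: (DM (l, j)).
  have /andP[t0 t1] := t01.
  rewrite (_ : m%:R * p0 * K * `|w| ^+ 2 = m%:R * (p0 * `|w| ^+ 2) * K); last by ring.
  apply: mulmx_bound; last by move=> l; exact: FK.
  apply: SBm => l; rewrite mxE; apply: (le_trans (ler_normD _ _)).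
  have [h1 h2] := W_diff i l vr vwr t01.
  rewrite /p0 mulrDl; apply: lerD; first exact: h1.
  rewrite mxE normrM (ger0_norm t0).
  apply: (le_trans (ler_piMl (normr_ge0 _) t1)).
  rewrite (_ : 2 * m%:R * _ * _ * _ =
      m%:R * (2 * n%:R * C * `|w|) * (n%:R * (`|w| * C))); last by ring.
  apply: mulmx_bound; last by move=> k; exact: W_bound.
  by apply: SBm => k; have [] := W_diff i k vr vwr t01.
Qed.

End Fixed.
End Frobenius.

Section FrobeniusTheorem.
Context {R : realType}.

Let mxB2E m p (P Q S : 'M[R]_(m, p)) i j :
  (P - Q - S) i j = P i j - Q i j - S i j.
Proof. by rewrite !mxE. Qed.

(** Bootstrapping: the combinations of the entries of Y with smooth coefficients
    form a class stable under derivation. *)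
Lemma smooth_linear_system n m p (V : set 'rV[R]_n) (A : 'I_n -> 'rV[R]_n -> 'M[R]_m)
    (Y : 'rV[R]_n -> 'M[R]_(m, p)) :
  open V -> (forall a, smooth_mx V (A a)) ->
  (forall x i j, V x -> {for x, continuous (fun y => Y y i j)}) ->
  (forall x a i j, V x ->
     is_derive x (delta_mx 0 a) (fun y => Y y i j) ((A a x *m Y x) i j)) ->
  smooth_mx V Y.
Proof.
move=> Vo sA cY dY i j.
pose P (h : 'rV[R]_n -> R) := exists2 c : 'I_m -> 'rV[R]_n -> R,
  (forall l, smooth_on V (c l)) & h = fun x => \sum_l c l x * Y x l j.
apply: (smooth_on_coind (P := P) Vo).
- move=> _ [c sc ->] x Vx; split.
    apply: (@cvg_sum_ord R _ (nbhs x)) => l.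
    by apply: cvgM; [exact: (smooth_on_continuous (sc l) Vx)|exact: cY].
  move=> a; rewrite (_ : (fun x => _) = \sum_l (fun x => c l x * Y x l j)); last first.
    by apply/funext => y; rewrite fct_sumE.
  apply: derivable_sum => l; apply: derivableM.
    by case: (smooth_is_derive Vx a (sc l)).
  by case: (dY x a l j Vx).
- move=> _ a [c sc ->].
  pose c' l x := pd a (c l) x + \sum_k c k x * A a x k l.
  exists (fun x => \sum_l c' l x * Y x l j).
    exists c' => // l; apply: (smooth_onD Vo (smooth_on_pd a (sc l))).
    apply: (smooth_on_sum Vo) => k; exact: (smooth_onM Vo (sc k) (sA a k l)).
  move=> x Vx; rewrite /pd.
  rewrite (_ : (fun x => _) = \sum_l (fun x => c l x * Y x l j)); last first.
    by apply/funext => y; rewrite fct_sumE.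
  set val := (X in _ = X).
  suff [] : is_derive x (delta_mx 0 a) (\sum_l (fun x => c l x * Y x l j)) val by [].
  have d l : is_derive x (delta_mx 0 a) (fun x => c l x * Y x l j)
     (pd a (c l) x * Y x l j + c l x * (A a x *m Y x) l j).
    apply: is_derive_eq (is_deriveM (smooth_is_derive Vx a (sc l)) (dY x a l j Vx)) _.
    by rewrite addrC; congr (_ + _); exact: mulrC.
  apply: is_derive_eq.
  rewrite /val /c'; under [RHS]eq_bigr do rewrite mulrDl.
  rewrite !big_split /=; congr (_ + _).
  under eq_bigr do rewrite mxE mulr_sumr.
  rewrite exchange_big /=; apply: eq_bigr => k _; rewrite mulr_suml.
  by apply: eq_bigr => l _; rewrite mulrA.
- exists (fun l _ => (l == i)%:R) => [l|]; first exact: smooth_on_cst.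
  apply/funext => x; rewrite (bigD1 i)//= eqxx mul1r big1 ?addr0// => l /negbTE ->.
  by rewrite mul0r.
Qed.

(** Y x is the value at time 1 of the solution along the ray from x0 to x. The
    second-order estimate of ray_variation yields both the continuity of Y and
    its partial derivatives A_a Y; smoothness follows by bootstrapping. *)
Theorem linear_frobenius n m p (U : set 'rV[R]_n) (A : 'I_n -> 'rV[R]_n -> 'M[R]_m)
    (x0 : 'rV[R]_n) (Y0 : 'M[R]_(m, p)) :
  open U -> U x0 -> (forall a, smooth_mx U (A a)) ->
  (forall x, U x -> forall a b,
     dmx b (A a) x + A a x *m A b x = dmx a (A b) x + A b x *m A a x) ->
  exists (r : R) (Y : 'rV[R]_n -> 'M[R]_(m, p)),
    [/\ 0 < r, forall x, `|x - x0| < r -> U x, Y x0 = Y0,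
        smooth_mx [set x | `|x - x0| < r] Y &
        forall x a, `|x - x0| < r -> dmx a Y x = A a x *m Y x].
Proof.
move=> Uo Ux0 sA flatA.
have [r1 [C [r10 C0 tA]]] := smooth_taylor_family
  (f := fun (aij : 'I_n * ('I_m * 'I_m)) x => A aij.1 x aij.2.1 aij.2.2) Uo
  (fun aij => sA aij.1 aij.2.1 aij.2.2) Ux0.
have /near_distP[r2 r20 r2U] := near_open Uo Ux0.
have n0 : 0 <= (n%:R : R) by rewrite ler0n.
have m0 : 0 <= (m%:R : R) by rewrite ler0n.
pose Q := m%:R * (n%:R * C).
have Q0 : 0 <= Q by rewrite !mulr_ge0.
pose r := Num.min (Num.min r1 r2) (Num.min 1 (2 * (Q + 1))^-1).
have Q10 : 0 < 2 * (Q + 1) by clear -Q0; lra.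
have r0 : 0 < r by rewrite !lt_min r10 r20 ltr01 invr_gt0.
have rr1 : r <= r1 by rewrite !ge_min lexx.
have rr2 : r <= r2 by rewrite !ge_min lexx orbT.
have rle1 : r <= 1 by rewrite !ge_min lexx !orbT.
have rQ : r <= (2 * (Q + 1))^-1 by rewrite !ge_min lexx !orbT.
(* On the rays of length at most r the coefficients have row sums at most 1/2. *)
have rC : m%:R * (n%:R * r * C) <= 2^-1.
  rewrite (_ : m%:R * _ = r * Q); last by rewrite /Q; ring.
  apply: (@le_trans _ _ ((2 * (Q + 1))^-1 * (Q + 1))).
    apply: ler_pM => //; first exact: ltW.
    by clear; lra.
  by rewrite invfM mulfVK// gt_eqF//; clear -Q0; lra.
have rU z : `|z - x0| < r -> U z by move=> zr; apply: r2U; exact: lt_le_trans rr2.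
have tA' a i j : taylor_bound (fun x => A a x i j) x0 r C.
  exact: taylor_bound_mono rr1 (lexx C) (tA (a, (i, j))).
pose W (v w : 'rV[R]_n) (t : R) : 'M[R]_m := \sum_a w 0 a *: A a (x0 + t *: v).
have ray (v : 'rV[R]_n) (t : R) : `|v| < r -> 0 <= t <= 1 -> `|x0 + t *: v - x0| < r.
  move=> vr /andP[t0 t1]; rewrite addrAC subrr add0r normrZ (ger0_norm t0).
  exact: le_lt_trans (ler_piMl (normr_ge0 _) t1) vr.
have WE v w t i j : W v w t i j = \sum_a w 0 a * A a (x0 + t *: v) i j.
  by rewrite /W summxE; apply: eq_bigr => a _; rewrite mxE.
have Wb (v w : 'rV[R]_n) (t : R) i : `|v| < r -> 0 <= t <= 1 ->
    \sum_l `|W v w t i l| <= Q * `|w|.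
  move=> vr t01; apply: (@le_trans _ _ (\sum_(l < m) n%:R * (`|w| * C))); last first.
    by rewrite sumr_const card_ord -mulr_natl /Q le_eqVlt; apply/orP; left; apply/eqP; ring.
  apply: ler_sum => l _; rewrite WE.
  rewrite -[X in X%:R * _](card_ord n); apply: sum_bound => a; rewrite normrM.
  apply: ler_pM => //; first exact: ler_coord_norm.
  have [|h _ _] := @tA' a i l (x0 + t *: v) 0 (ray _ _ vr t01); last exact: h.
  by rewrite addr0; exact: ray.
pose K : R := \sum_i \sum_j `|Y0 i j|.
have YK i j : `|Y0 i j| <= K.
  rewrite /K (bigD1 i)//= (bigD1 j)//= -addrA lerDl.
  by rewrite addr_ge0// sumr_ge0// => k _; apply: sumr_ge0.
have Fex v : exists F : R -> 'M[R]_(m, p), `|v| < r ->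
    [/\ F 0 = Y0,
        forall t : R, 0 <= t <= 1 -> forall i j,
          is_derive t 1 (fun t => F t i j) ((W v v t *m F t) i j) &
        forall t, 0 <= t <= 1 -> forall i j, `|F t i j| <= 2 * K].
  have [vr|vr] := boolP (`|v| < r); last by exists (fun=> 0).
  have [||F FP] := @linear_ode_on R m p (W v v) Y0 K _ _ YK; last by exists F.
  - move=> i j t t01.
    rewrite (_ : (fun t => _) = fun t => \sum_a v 0 a * A a (x0 + t *: v) i j); last first.
      by apply/funext => s; rewrite WE.
    apply: (@cvg_sum_ord R _ (nbhs t)) => a.
    apply: cvgM; first exact: cvg_cst.
    have [d _] := is_derive_segment Uo (sA a i j) (rU _ (ray _ _ vr t01)).
    by have /derivable1_diffP/differentiable_continuous := d.
  - move=> t t01 i; apply: (le_trans (Wb _ _ _ _ vr t01)).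
    apply: le_trans rC; rewrite (_ : m%:R * _ = Q * r); last by rewrite /Q; ring.
    by rewrite ler_wpM2l// ltW.
pose F v := sval (cid (Fex v)).
have FP v : `|v| < r -> [/\ F v 0 = Y0,
        forall t : R, 0 <= t <= 1 -> forall i j,
          is_derive t 1 (fun t => F v t i j) ((W v v t *m F v t) i j) &
        forall t, 0 <= t <= 1 -> forall i j, `|F v t i j| <= 2 * K].
  exact: (svalP (cid (Fex v))).
pose Y x := F (x - x0) 1.
have I1 : 0 <= (1 : R) <= 1 by rewrite ler01 lexx.
pose c := 2 * (m%:R * (2 * n%:R * C + 2 * m%:R * n%:R ^+ 2 * C ^+ 2) * (2 * K)).
have K0 : 0 <= K by rewrite sumr_ge0// => i _; rewrite sumr_ge0.
have c0 : 0 <= c by rewrite /c !(mulr_ge0, addr_ge0, exprn_ge0).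
have cP (x w : 'rV[R]_n) i j : `|x - x0| < r -> `|x + w - x0| < r ->
    `|Y (x + w) i j - Y x i j - ((\sum_a w 0 a *: A a x) *m Y x) i j| <= c * `|w| ^+ 2.
  move=> xr xwr; have xwr' : `|x - x0 + w| < r by rewrite addrAC.
  have := ray_variation Uo sA flatA rle1 C0 rU tA' rC (K := 2 * K) (F := F)
    (fun v vr => let: And3 h _ _ := FP v vr in h)
    (fun v t vr => let: And3 _ h _ := FP v vr in h t)
    (fun v t vr => let: And3 _ _ h := FP v vr in h t) xr xwr' i j.
  have Ex : x0 + 1 *: (x - x0) = x by rewrite scale1r addrC subrK.
  by rewrite mxB2E Ex /Y (addrAC x w).
pose V := [set x : 'rV[R]_n | `|x - x0| < r].
have Vo : open V.
  rewrite (_ : V = ball x0 r); first exact: ball_open.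
  by apply/seteqP; split=> x; rewrite -ball_normE /V /= distrC.
have YK2 x i j : V x -> `|Y x i j| <= 2 * K by move=> xr; have [_ _] := FP _ xr; exact.
have dY x a i j : V x ->
    is_derive x (delta_mx 0 a) (fun y => Y y i j) ((A a x *m Y x) i j).
  move=> xr; apply: is_derive_growth.
  have /near_distP[d d0 dV] := near_open Vo xr.
  apply/cvgrPdist_le => e e0.
  have ec : 0 < e / (c + 1) by rewrite divr_gt0// ltr_wpDl.
  near=> h.
  have h0 : h != 0 by near: h; exact: nbhs_dnbhs_neq.
  have hd : `|h| < d by near: h; exact: dnbhs0_lt.
  have he : `|h| < e / (c + 1) by near: h; exact: dnbhs0_lt.
  have hn : `|h *: (delta_mx 0 a : 'rV[R]_n)| <= `|h|.
    apply: rV_norm_le => // l; rewrite !mxE normrM ler_piMr//.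
    by case: (_ && _); rewrite ?normr1 ?normr0.
  have xh : `|x + h *: delta_mx 0 a - x0| < r.
    by apply: dV; rewrite addrAC subrr add0r; exact: le_lt_trans hd.
  have := cP x (h *: delta_mx 0 a) i j xr xh.
  have -> : \sum_b (h *: (delta_mx 0 a : 'rV[R]_n)) 0 b *: A b x = h *: A a x.
    rewrite (bigD1 a)//= !mxE !eqxx mulr1 big1 ?addr0// => b /negbTE ba.
    by rewrite !mxE ba mulr0 scale0r.
  have -> : ((h *: A a x) *m Y x) i j = h * (A a x *m Y x) i j.
    by rewrite -scalemxAl mxE.
  move=> hc.
  rewrite distrC [h *: _ + x]addrC.
  rewrite (_ : _ - _ = h^-1 * (Y (x + h *: delta_mx 0 a) i j - Y x i j -
     h * (A a x *m Y x) i j)); last by rewrite mulrBr mulKf.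
  rewrite normrM normfV ler_pdivrMl ?normr_gt0//.
  apply: (le_trans hc); rewrite (@le_trans _ _ (c * `|h| ^+ 2))//.
    by rewrite ler_wpM2l// lerXn2r ?nnegrE.
  rewrite expr2 mulrA [_ * e]mulrC ler_wpM2r//.
  move/ltW: he; rewrite ler_pdivlMr ?ltr_wpDl// mulrDr mulr1 mulrC.
  by apply: le_trans; rewrite lerDl.
have cY x i j : V x -> {for x, continuous (fun y => Y y i j)}.
  move=> xr; have /near_distP[d d0 dV] := near_open Vo xr.
  pose L := c + Q * (2 * K).
  have L0 : 0 <= L by rewrite addr_ge0// mulr_ge0// mulr_ge0.
  apply/continuous_distP => e e0.
  exists (Num.min (Num.min d 1) (e / (L + 1))).
    by rewrite !lt_min d0 ltr01 divr_gt0// ltr_wpDl.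
  move=> y; rewrite !lt_min => /andP[/andP[yd y1] ye].
  have yr := dV y yd.
  have := cP x (y - x) i j xr; rewrite addrCA subrr addr0 => /(_ yr) h1.
  have h2 : `|((\sum_a (y - x) 0 a *: A a x) *m Y x) i j| <= Q * `|y - x| * (2 * K).
    apply: mulmx_bound => [|l]; last exact: YK2.
    have := @Wb (x - x0) (y - x) 1 i xr I1.
    have Ex : x0 + 1 *: (x - x0) = x by rewrite scale1r addrC subrK.
    by rewrite /W Ex.
  have h3 : c * `|y - x| ^+ 2 <= c * `|y - x|.
    by rewrite ler_wpM2l// expr2 ler_piMl// ltW.
  have h4 : L * `|y - x| < e.
    move: ye; rewrite ltr_pdivlMr ?ltr_wpDl// mulrDr mulr1 mulrC.
    by apply: le_lt_trans; rewrite lerDl.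
  apply: le_lt_trans h4.
  rewrite -(subrK (((\sum_a (y - x) 0 a *: A a x) *m Y x) i j) (_ - _)).
  apply: (le_trans (ler_normD _ _)).
  rewrite /L mulrDl; apply: lerD; first exact: le_trans h3.
  by apply: (le_trans h2); rewrite mulrAC.
have sY : smooth_mx V Y.
  apply: smooth_linear_system Vo _ cY dY => a i j.
  by apply: smooth_on_sub (sA a i j) => x; exact: rU.
exists r, Y; split=> //.
  have z0 : `|x0 - x0| < r by rewrite subrr normr0.
  rewrite /Y; have [F0 dF _] := FP _ z0.
  have I0 : 0 <= (0 : R) <= 1 by rewrite ler01 lexx.
  apply/matrixP => i j.
  have W0 t : W (x0 - x0) (x0 - x0) t = 0.
    by rewrite /W subrr big1// => b _; rewrite mxE scale0r.
  have d (t : R) (t01 : 0 <= t <= 1) := dF t t01 i j.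
  have := is_derive_bound d (c := 0) _ I0 I1.
  rewrite mul0r normr_le0 F0 subr_eq0 => /(_ _)/eqP; apply => t _.
  by rewrite W0 mul0mx mxE normr0.
move=> x a xr; apply/matrixP => i j; rewrite dmxE.
by case: (dY x a i j xr).
Unshelve. all: by end_near. Qed.
End FrobeniusTheorem.

(** * Simultaneous diagonalisation *)

Section Diagonalisation.
Context {R : realType}.

Definition quad n (G : 'M[R]_n) (v : 'rV[R]_n) : R := (v *m G *m v^T) 0 0.

Definition posdef n (G : 'M[R]_n) : Prop :=
  G^T = G /\ forall v : 'rV[R]_n, v != 0 -> 0 < quad G v.

Lemma quadZ n (G : 'M[R]_n) (c : R) v : quad G (c *: v) = c ^+ 2 * quad G v.
Proof. by rewrite /quad linearZ /= -scalemxAr -!scalemxAl !mxE; ring. Qed.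

Lemma quadE n (G : 'M[R]_n) v : quad G v = \sum_j (\sum_i v 0 i * G i j) * v 0 j.
Proof.
by rewrite /quad mxE; apply: eq_bigr => j _; rewrite !mxE.
Qed.

Lemma quad_line n (Q : 'M[R]_n) (v w : 'rV[R]_n) (t : R) : Q^T = Q ->
  quad Q (v + t *: w) = quad Q v + 2 * t * (v *m Q *m w^T) 0 0 + t ^+ 2 * quad Q w.
Proof.
move=> Qs.
have E : (w *m Q *m v^T) 0 0 = (v *m Q *m w^T) 0 0.
  by rewrite -[w *m Q *m v^T]trmxK mxE !trmx_mul trmxK Qs mulmxA.
rewrite /quad linearD /= linearZ /= !mulmxDl !mulmxDr -!scalemxAl -!scalemxAr.
rewrite scalerA -expr2; move: E.
move: (w *m Q *m v^T) (v *m Q *m w^T) (v *m Q *m v^T) (w *m Q *m w^T) => A B C D E.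
by rewrite !mxE E; ring.
Qed.

Lemma quad_continuous n (G : 'M[R]_n) : continuous (quad G).
Proof.
move=> v; rewrite (_ : quad G = fun v => \sum_j (\sum_i v 0 i * G i j) * v 0 j); last first.
  by apply/funext => w; exact: quadE.
apply: (@cvg_sum_ord R _ (nbhs v)) => j; apply: cvgM; last exact: coord_continuous.
apply: (@cvg_sum_ord R _ (nbhs v)) => i; apply: cvgM; first exact: coord_continuous.
exact: cvg_cst.
Qed.

(** Let v maximise the Rayleigh quotient of S relative to G, with value lam: then
    S - lam G is nonpositive and vanishes at v, so that v is in its kernel. *)
Lemma relative_eigenvector n (G S : 'M[R]_n.+1) : posdef G -> S^T = S ->
  exists (v : 'rV[R]_n.+1) (lam : R), quad G v = 1 /\ v *m S = lam *: (v *m G).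
Proof.
move=> [Gs Gp] Ss.
pose f v := quad S v / quad G v.
pose A := [set v : 'rV[R]_n.+1 | `|v| = 1].
have A0 v : A v -> v != 0.
  by rewrite /A /= => v1; apply/eqP => v0; move: v1; rewrite v0 normr0 => /esym/eqP; rewrite oner_eq0.
have Acompact : compact A.
  apply: bounded_closed_compact.
    by exists 1; split=> // x x1 v /= ->; exact: ltW.
  rewrite (_ : A = (fun v => `|v|) @^-1` [set 1]); last by [].
  apply: closed_comp => [v _|]; first exact: norm_continuous.
  exact: closed_eq.
have Anon : A !=set0.
  pose e : 'rV[R]_n.+1 := const_mx 1.
  have e0 : `|e| != 0.
    by rewrite normr_eq0; apply/eqP => /rowP/(_ 0)/eqP; rewrite !mxE oner_eq0.
  by exists (`|e|^-1 *: e); rewrite /A /= normrZ normfV normr_id mulVf.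
have cf : {within A, continuous f}.
  apply: continuous_in_subspaceT => v /set_mem/A0/Gp Gv.
  apply: (cvgM (F := nbhs v)); first exact: quad_continuous.
  apply: (cvgV (F := nbhs v)); first by rewrite gt_eqF.
  exact: quad_continuous.
have [v Av vmax] := EVT_max_rV Anon Acompact cf.
have v0 := A0 v (set_mem Av).
pose lam := f v.
pose Q := S - lam *: G.
have Qs : Q^T = Q by rewrite /Q linearB /= linearZ /= Ss Gs.
have QE w : quad Q w = quad S w - lam * quad G w.
  by rewrite /quad /Q mulmxBr mulmxBl -scalemxAr -scalemxAl !mxE.
have Qle w : quad Q w <= 0.
  have [->|w0] := eqVneq w 0; first by rewrite /quad !mul0mx mxE.
  have nw : 0 < `|w| by rewrite normr_gt0.
  have Aw : A (`|w|^-1 *: w).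
    by rewrite /A /= normrZ normfV normr_id mulVf// gt_eqF.
  have := vmax _ (mem_set Aw).
  rewrite /f !quadZ -mulf_div divff ?mul1r; last first.
    by rewrite expf_neq0// invr_eq0 gt_eqF.
  by rewrite -/lam ler_pdivrMr ?Gp// QE subr_le0.
have Qv : quad Q v = 0.
  by rewrite QE /lam /f divfK ?subrr// gt_eqF// Gp.
have vQ : v *m Q = 0.
  pose w := v *m Q.
  pose b := (w *m w^T) 0 0.
  have bE : b = \sum_i w 0 i ^+ 2.
    by rewrite /b mxE; apply: eq_bigr => i _; rewrite !mxE expr2.
  have qt t : quad Q (v + t *: w) = 2 * t * b + t ^+ 2 * quad Q w.
    by rewrite quad_line// Qv add0r.
  have b0 : b = 0.
    have bp : 0 <= b by rewrite bE sumr_ge0// => i _; rewrite sqr_ge0.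
    apply/eqP; rewrite eq_le bp andbT leNgt; apply/negP => b0.
    pose c := 1 - quad Q w.
    have c0 : 0 < c by rewrite /c subr_gt0 (le_lt_trans (Qle w)).
    have := Qle (v + (b / c) *: w); rewrite qt.
    have -> : 2 * (b / c) * b + (b / c) ^+ 2 * quad Q w =
       b ^+ 2 / c ^+ 2 * (2 * c + quad Q w) by field; rewrite gt_eqF.
    rewrite leNgt mulr_gt0//; first by rewrite divr_gt0// exprn_gt0.
    by rewrite /c; have := Qle w; clear -c0; lra.
  apply/rowP => i; rewrite [RHS]mxE; apply/eqP; rewrite -sqrf_eq0.
  have := b0; rewrite bE => /eqP; rewrite psumr_eq0 => [/allP/(_ i)|j _]; last exact: sqr_ge0.
  by rewrite mem_index_enum => /(_ isT).
have Gv : 0 < quad G v by exact: Gp.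
exists ((Num.sqrt (quad G v))^-1 *: v), lam; split.
  by rewrite quadZ exprVn sqr_sqrtr ?ltW// mulVf// gt_eqF.
move: vQ; rewrite /Q mulmxBr => /eqP; rewrite subr_eq0 => /eqP vS.
by rewrite -!scalemxAl vS -scalemxAr !scalerA mulrC.
Qed.

Lemma posdef_congr n p (G : 'M[R]_n) (C : 'M[R]_(p, n)) :
  posdef G -> row_free C -> posdef (C *m G *m C^T).
Proof.
move=> [Gs Gp] Cf; split; first by rewrite !trmx_mul trmxK Gs mulmxA.
move=> v v0; rewrite /quad (_ : v *m _ *m _ = (v *m C) *m G *m (v *m C)^T); last first.
  by rewrite trmx_mul !mulmxA.
apply: Gp; apply: contra v0 => /eqP vC.
by apply/eqP; apply: (row_free_inj Cf); rewrite vC mul0mx.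
Qed.

(** By induction, splitting off an eigenvector and restricting both forms to its
    G-orthogonal complement, spanned by the rows of C. *)
Theorem simultaneous_diagonalisation n (G S : 'M[R]_n) : posdef G -> S^T = S ->
  exists (V : 'M[R]_n) (d : 'rV[R]_n), V *m G *m V^T = 1%:M /\ V *m S *m V^T = diag_mx d.
Proof.
elim: n G S => [|n IH] G S Gp Ss.
  by exists 0, 0; split; apply/matrixP => -[].
have [v [lam [vG vS]]] := relative_eigenvector Gp Ss.
have [Gs Gpos] := Gp.
have v0 : v != 0.
  by apply/eqP => v0; move: vG; rewrite v0 /quad !mul0mx mxE => /esym/eqP; rewrite oner_eq0.
pose c := G *m v^T.
have [C Cf Cc] : exists2 C : 'M[R]_(n, n.+1), row_free C & C *m c = 0.
  have rK : \rank (kermx c) = n.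
    rewrite mxrank_ker (_ : \rank c = 1%N) ?subn1//.
    apply/eqP; rewrite eqn_leq rank_leq_col lt0n mxrank_eq0.
    apply/eqP => c0; move: vG; rewrite /quad -mulmxA -/c c0 mulmx0 mxE => /esym/eqP.
    by rewrite oner_eq0.
  have := row_base_free (kermx c).
  have : row_base (kermx c) *m c = 0.
    by apply/eqP; rewrite -sub_kermx; rewrite eq_row_base.
  move: (row_base (kermx c)); rewrite rK => C Cc Cf.
  by exists C.
have vC : v *m G *m C^T = 0.
  by apply: trmx_inj; rewrite !trmx_mul trmxK Gs trmx0 -/c.
have [|V' [d' [V'G V'S]]] := IH (C *m G *m C^T) (C *m S *m C^T) (posdef_congr Gp Cf).
  by rewrite !trmx_mul trmxK Ss mulmxA.
have vG1 : v *m G *m v^T = 1%:M.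
  by apply/matrixP => i j; rewrite !ord1 [RHS]mxE.
pose V : 'M[R]_(1 + n, n.+1) := col_mx v (V' *m C).
have blk (Q : 'M[R]_n.+1) (e : 'M[R]_1) (E : 'M[R]_n) : Q^T = Q ->
    v *m Q *m v^T = e -> v *m Q *m C^T = 0 -> V' *m (C *m Q *m C^T) *m (V')^T = E ->
    V *m Q *m V^T = block_mx e 0 0 E.
  move=> Qs h1 h2 h3; rewrite /V tr_col_mx mul_col_mx mul_col_row h1.
  have h2' : C *m Q *m v^T = 0.
    by apply: trmx_inj; rewrite !trmx_mul trmxK Qs mulmxA h2 trmx0.
  rewrite trmx_mul; congr block_mx.
  - by rewrite mulmxA h2 mul0mx.
  - by rewrite -!mulmxA [C *m _]mulmxA h2' mulmx0.
  - by rewrite -h3 !mulmxA.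
exists V, (row_mx ((lam%:M) : 'M[R]_1) d'); split.
  rewrite (blk G 1%:M 1%:M)//.
  by rewrite -scalar_mx_block.
have D : diag_mx (row_mx (lam%:M : 'M[R]_1) d') = block_mx (lam%:M) 0 0 (diag_mx d').
  rewrite diag_mx_row; congr block_mx; apply/matrixP => i j.
  by rewrite !ord1 !mxE.
apply: etrans (esym D); apply: blk => //.
- by rewrite vS -!scalemxAl vG1 scalemx1.
- by rewrite vS -scalemxAl vC scaler0.
Qed.
End Diagonalisation.

(** * The exponential of a diagonalisable matrix *)

Section MatrixExponential.
Context {R : realType}.

Lemma mx_exp_diag n (V : 'M[R]_n) (d : 'rV[R]_n) : V \in unitmx ->
  mx_exp (invmx V *m diag_mx d *m V) = invmx V *m diag_mx (map_mx expR d) *m V.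
Proof.
move=> Vu.
have pw k : (invmx V *m diag_mx d *m V) ^+ k =
    invmx V *m diag_mx (map_mx (fun x => x ^+ k) d) *m V.
  elim: k => [|k IH].
    rewrite expr0 (_ : map_mx _ d = const_mx 1); last by apply/rowP => i; rewrite !mxE.
    by rewrite diag_const_mx mulmx1 mulVmx.
  rewrite exprS IH -[LHS]/(_ *m _) !mulmxA mulmxK// -[_ *m diag_mx d *m _]mulmxA mulmx_diag.
  by congr (_ *m diag_mx _ *m _); apply/rowP => i; rewrite !mxE exprS.
apply: cvg_lim; first exact: norm_hausdorff.
apply: cvg_mx => i j.
have E (e : 'rV[R]_n) : (invmx V *m diag_mx e *m V) i j = \sum_l e 0 l * (invmx V i l * V l j).
  rewrite mxE; apply: eq_bigr => l _; rewrite mul_mx_diag mxE; ring.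
rewrite E.
rewrite (_ : (fun t => _) = fun t => \sum_l series (exp_coeff (d 0 l)) t * (invmx V i l * V l j)).
  apply: cvg_sum_ord => l; rewrite mxE; apply: cvgM; last exact: cvg_cst.
  exact: is_cvg_series_exp_coeff.
apply/funext => t; rewrite /series /= summxE.
transitivity (\sum_(0 <= k < t) \sum_l
    k`!%:R^-1 * (d 0 l ^+ k * (invmx V i l * V l j))).
  apply: eq_bigr => k _.
  transitivity ((k`!%:R^-1 *: (invmx V *m diag_mx (map_mx (fun x => x ^+ k) d) *m V)) i j).
    congr (fun_of_matrix (_ *: _) i j); exact: pw.
  by rewrite mxE E mulr_sumr; apply: eq_bigr => l _; rewrite mxE.
rewrite exchange_big /=; apply: eq_bigr => l _; rewrite mulr_suml.
by apply: eq_bigr => k _; rewrite /exp_coeff /=; ring.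
Qed.
End MatrixExponential.

(** * Operators on 2-forms *)

Section TwoForms.
Context {R : realType} {n : nat}.
Implicit Types (G V P S X Y w : 'M[R]_n) (T : tensor4 R n).

(** The Kulkarni-Nomizu product of G and P. *)
Definition kulkarni G P : tensor4 R n := fun a b c d =>
  G a c * P b d + P a c * G b d - P a d * G b c - G a d * P b c.

(** The operator induced by S on 2-forms: half the Kulkarni-Nomizu square of S. *)
Definition wedge2 S : tensor4 R n := fun a b c d => S a c * S b d - S a d * S b c.

Lemma op2D G T T' w :
  op2 G (fun a b c d => T a b c d + T' a b c d) w = op2 G T w + op2 G T' w.
Proof.
apply/matrixP => a b; rewrite !mxE -mulrDr -big_split /=; congr (_ * _).
apply: eq_bigr => c _; rewrite -big_split /=; apply: eq_bigr => d _.
rewrite -mulrDl; congr (_ * _); rewrite /raise2 -big_split /=.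
apply: eq_bigr => e _; rewrite -big_split /=; apply: eq_bigr => f _; ring.
Qed.

Lemma op2N G T w : op2 G (fun a b c d => - T a b c d) w = - op2 G T w.
Proof.
apply/matrixP => a b; rewrite !mxE -mulrN -sumrN; congr (_ * _).
apply: eq_bigr => c _; rewrite -sumrN; apply: eq_bigr => d _.
rewrite -mulNr; congr (_ * _); rewrite /raise2 -sumrN.
apply: eq_bigr => e _; rewrite -sumrN; apply: eq_bigr => f _; ring.
Qed.

Lemma op2_lin G T (c : R) w w' : op2 G T (c *: w + w') = c *: op2 G T w + op2 G T w'.
Proof.
apply/matrixP => a b; rewrite !mxE mulrCA -mulrDr; congr (_ * _).
rewrite mulr_sumr -big_split /=; apply: eq_bigr => k _.
rewrite mulr_sumr -big_split /=; apply: eq_bigr => l _; rewrite !mxE; ring.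
Qed.

Lemma op2_sum G T (I : finType) (x : I -> R) (w : I -> 'M[R]_n) :
  op2 G T (\sum_i x i *: w i) = \sum_i x i *: op2 G T (w i).
Proof.
have op20 : op2 G T 0 = 0.
  have := op2_lin G T (-1) 0 0.
  by rewrite scaler0 add0r scaleN1r addNr.
by elim/big_rec2: _ => // i y z _ <-; rewrite op2_lin.
Qed.

Lemma op2_pair G X Y w :
  op2 G (fun a b c d => X a c * Y b d) w =
  2^-1 *: (X *m invmx G *m w *m (Y *m invmx G)^T).
Proof.
apply/matrixP => a b; rewrite [LHS]mxE [RHS]mxE; congr (_ * _).
rewrite [RHS]mxE exchange_big /=; apply: eq_bigr => d _.
rewrite [(X *m _ *m w) a d]mxE mulr_suml; apply: eq_bigr => c _.
rewrite (_ : raise2 _ _ a b c d = (X *m invmx G) a c * (Y *m invmx G) b d).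
  by rewrite [(_^T) d b]mxE; ring.
rewrite /raise2 !mxE big_distrlr /=; apply: eq_bigr => e _.
by apply: eq_bigr => f _; ring.
Qed.

Lemma op2_swap G X Y w :
  op2 G (fun a b c d => X a d * Y b c) w =
  2^-1 *: (X *m invmx G *m w^T *m (Y *m invmx G)^T).
Proof.
rewrite -(op2_pair G X Y w^T); apply/matrixP => a b; rewrite !mxE; congr (_ * _).
rewrite exchange_big /=; apply: eq_bigr => d _; apply: eq_bigr => c _.
rewrite mxE; congr (_ * _); rewrite /raise2 exchange_big /=.
by apply: eq_bigr => e _; apply: eq_bigr => f _; ring.
Qed.

Lemma op2_wedge2 G S w : form2 w ->
  op2 G (wedge2 S) w = S *m invmx G *m w *m (S *m invmx G)^T.
Proof.
move=> fw; rewrite /wedge2.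
rewrite (op2D G (fun a b c d => S a c * S b d) (fun a b c d => - (S a d * S b c))).
rewrite (op2N G (fun a b c d => S a d * S b c)) op2_pair op2_swap fw.
rewrite mulmxN mulNmx scalerN opprK -scalerDl.
by rewrite (_ : _ + _ = 1) ?scale1r//; lra.
Qed.

Lemma op2_kulkarni G P w : G \in unitmx -> form2 w ->
  op2 G (kulkarni G P) w = P *m invmx G *m w + w *m (P *m invmx G)^T.
Proof.
move=> Gu fw; rewrite /kulkarni.
rewrite (op2D G (fun a b c d => G a c * P b d + P a c * G b d - P a d * G b c)
  (fun a b c d => - (G a d * P b c))).
rewrite (op2D G (fun a b c d => G a c * P b d + P a c * G b d)
  (fun a b c d => - (P a d * G b c))).
rewrite (op2D G (fun a b c d => G a c * P b d) (fun a b c d => P a c * G b d)).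
rewrite (op2N G (fun a b c d => G a d * P b c)) (op2N G (fun a b c d => P a d * G b c)).
rewrite !op2_pair !op2_swap fw mulmxV// trmx1 !mul1mx !mulmx1.
rewrite mulmxN mulNmx !scalerN !opprK.
move: (w *m _) (_ *m w) => A B; apply/matrixP => i j; rewrite !mxE.
by clear; lra.
Qed.

Lemma kulkarni_operator G P : G^T = G -> P^T = P -> operator_tensor (kulkarni G P).
Proof.
move=> Gs Ps; have g a b : G a b = G b a by rewrite -[in RHS]Gs mxE.
have p a b : P a b = P b a by rewrite -[in RHS]Ps mxE.
rewrite /kulkarni; split=> a b c d; [ring|ring|].
by rewrite (g a c) (p a c) (g b d) (p b d) (g a d) (p a d) (g b c) (p b c); ring.
Qed.

Lemma wedge2_operator S : S^T = S -> operator_tensor (wedge2 S).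
Proof.
move=> Ss; have s a b : S a b = S b a by rewrite -[in RHS]Ss mxE.
rewrite /wedge2; split=> a b c d; [ring|ring|].
by rewrite (s a c) (s b d) (s a d) (s b c); ring.
Qed.

Definition eform (i j : 'I_n) : 'M[R]_n := delta_mx i j - delta_mx j i.

Lemma form2_eform i j : form2 (eform i j).
Proof. by rewrite /form2 /eform linearB /= !trmx_delta opprB. Qed.

Lemma form2_sum_eform w : form2 w ->
  w = \sum_(ij : 'I_n * 'I_n) (2^-1 * w ij.1 ij.2) *: eform ij.1 ij.2.
Proof.
move=> fw; have wa a b : w b a = - w a b by have /matrixP/(_ a b) := fw; rewrite !mxE.
rewrite -(pair_bigA _ (fun i j => (2^-1 * w i j) *: eform i j)) /=.
have -> : \sum_i \sum_j (2^-1 * w i j) *: eform i j =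
   2^-1 *: (\sum_i \sum_j w i j *: delta_mx i j) -
   2^-1 *: (\sum_i \sum_j w i j *: delta_mx j i).
  rewrite !scaler_sumr -sumrB; apply: eq_bigr => i _.
  rewrite !scaler_sumr -sumrB; apply: eq_bigr => j _.
  by rewrite /eform !scalerA scalerBr.
rewrite -matrix_sum_delta [X in _ - _ *: X]exchange_big /=.
have -> : \sum_j \sum_i w i j *: delta_mx j i = - w.
  rewrite [in RHS](matrix_sum_delta w) -sumrN; apply: eq_bigr => i _.
  by rewrite -sumrN; apply: eq_bigr => j _; rewrite wa scaleNr.
by rewrite scalerN opprK -scalerDl (_ : _ + _ = 1) ?scale1r//; clear; lra.
Qed.

(** Evaluation on the forms e_c ^ e_d recovers T with its last pair of indices
    raised. *)
Lemma op2_inj G T T' : G \in unitmx ->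
  (forall a b c d, T a b d c = - T a b c d) ->
  (forall a b c d, T' a b d c = - T' a b c d) ->
  (forall w, form2 w -> op2 G T w = op2 G T' w) ->
  forall a b c d, T a b c d = T' a b c d.
Proof.
move=> Gu aT aT' TT' a b.
pose Q T : 'M[R]_n := \matrix_(e, f) T a b e f.
have rE T0 c d : raise2 G T0 a b c d = ((invmx G)^T *m Q T0 *m invmx G) c d.
  rewrite mxE /raise2 exchange_big /=; apply: eq_bigr => f _.
  by rewrite mxE mulr_suml; apply: eq_bigr => e _; rewrite !mxE; ring.
have Qa T0 : (forall a b c d, T0 a b d c = - T0 a b c d) -> (Q T0)^T = - Q T0.
  by move=> aT0; apply/matrixP => e f; rewrite !mxE aT0.
have ra T0 c d : (forall a b c d, T0 a b d c = - T0 a b c d) ->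
    raise2 G T0 a b d c = - raise2 G T0 a b c d.
  move=> aT0; rewrite !rE.
  rewrite (_ : (_ *m _ *m _) d c = ((invmx G)^T *m Q T0 *m invmx G)^T c d); last by rewrite [RHS]mxE.
  rewrite !trmx_mul trmxK (Qa _ aT0).
  by rewrite mulNmx mulmxN mulmxA [LHS]mxE.
have opE T0 c d : (forall a b c d, T0 a b d c = - T0 a b c d) ->
    op2 G T0 (eform c d) a b = raise2 G T0 a b c d.
  move=> aT0; rewrite mxE.
  have E (x y : 'I_n) : \sum_i \sum_j raise2 G T0 a b i j * delta_mx x y i j
      = raise2 G T0 a b x y :> R.
    rewrite (bigD1 x)//= [X in _ + X]big1 ?addr0 => [|i /negbTE ix]; last first.
      by rewrite big1// => j _; rewrite mxE ix mulr0.
    rewrite (bigD1 y)//= [X in _ + X]big1 ?addr0 => [|j /negbTE jy]; last first.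
      by rewrite mxE jy andbF mulr0.
    by rewrite mxE !eqxx mulr1.
  rewrite (_ : \sum_i \sum_j _ = raise2 G T0 a b c d - raise2 G T0 a b d c).
    by rewrite (ra _ c d aT0); clear; lra.
  rewrite -!E -sumrB; apply: eq_bigr => i _; rewrite -sumrB.
  by apply: eq_bigr => j _; rewrite -mulrBr /eform !mxE.
have QQ : Q T = Q T'.
  have Hu : invmx G \in unitmx by rewrite unitmx_inv.
  have : (invmx G)^T *m Q T *m invmx G = (invmx G)^T *m Q T' *m invmx G.
    apply/matrixP => c d; rewrite -!rE -!opE//.
    by rewrite (TT' _ (form2_eform c d)).
  move/(can_inj (mulmxK Hu)); apply: (can_inj (mulKmx _)).
  by rewrite unitmx_tr.
by move=> c d; have /matrixP/(_ c d) := QQ; rewrite !mxE.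
Qed.

Section Frame.
Variables (G V : 'M[R]_n).
Hypothesis VG : V *m G *m V^T = 1%:M.

Lemma frame_unit : V \in unitmx.
Proof. by have := VG; rewrite -mulmxA => /mulmx1_unit[]. Qed.

Lemma frame_metric_unit : G \in unitmx.
Proof.
have := VG; rewrite -mulmxA => /mulmx1C; rewrite -mulmxA => /mulmx1_unit[].
by [].
Qed.

Lemma frame_inv : invmx G = V^T *m V.
Proof.
have := VG; rewrite -mulmxA => /mulmx1C; rewrite -mulmxA => h.
by rewrite -[LHS]mulmx1 -h mulKmx// frame_metric_unit.
Qed.

Lemma frame_lower : V *m G = (invmx V)^T.
Proof.
have Vu : V^T \in unitmx by rewrite unitmx_tr frame_unit.
by rewrite -(mulmxK Vu (V *m G)) VG mul1mx trmx_inv.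
Qed.

Lemma frame_metric : G = invmx V *m (invmx V)^T.
Proof. by rewrite -frame_lower mulKmx// frame_unit. Qed.

(** The components of w in the orthonormal frame formed by the rows of V. *)
Definition hat w : 'M[R]_n := V *m w *m V^T.

Lemma hat_inj : injective hat.
Proof.
move=> w w' /(can_inj (mulmxK _)) h; apply: (can_inj (mulKmx frame_unit)).
by apply: h; rewrite unitmx_tr frame_unit.
Qed.

Lemma hat_form w : form2 w -> form2 (hat w).
Proof. by move=> fw; rewrite /form2 /hat !trmx_mul trmxK fw mulNmx mulmxN mulmxA. Qed.

Lemma inner2_hat v w : inner2 G v w = 2^-1 * \sum_i \sum_j hat v i j * hat w i j.
Proof.
rewrite /inner2; congr (_ * _).
have Hs : (invmx G)^T = invmx G by rewrite frame_inv trmx_mul trmxK.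
have -> : \sum_a \sum_b \sum_c \sum_d v a b * invmx G a c * invmx G b d * w c d =
    \sum_a \sum_b v a b * (invmx G *m w *m (invmx G)^T) a b.
  apply: eq_bigr => a _; apply: eq_bigr => b _.
  rewrite mxE mulr_sumr exchange_big /=; apply: eq_bigr => d _.
  rewrite !mxE mulr_suml mulr_sumr; apply: eq_bigr => c _.
  by ring.
have tr2 (A B : 'M[R]_n) : \sum_a \sum_b A a b * B a b = \tr (A *m B^T).
  by rewrite /mxtrace; apply: eq_bigr => a _; rewrite mxE; apply: eq_bigr => b _; rewrite mxE.
rewrite !tr2 Hs frame_inv /hat !trmx_mul !trmxK !mulmxA.
by rewrite [LHS]mxtrace_mulC !mulmxA.
Qed.

Lemma inner2_posdef w : w != 0 -> 0 < inner2 G w w.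
Proof.
move=> w0; rewrite inner2_hat mulr_gt0 ?invr_gt0//.
rewrite lt_neqAle; apply/andP; split; last first.
  by apply: sumr_ge0 => i _; apply: sumr_ge0 => j _; rewrite -expr2 sqr_ge0.
apply: contra w0; rewrite eq_sym psumr_eq0 => [/allP h|i _]; last first.
  by apply: sumr_ge0 => j _; rewrite -expr2 sqr_ge0.
apply/eqP; apply: hat_inj; rewrite /hat mulmx0 mul0mx.
apply/matrixP => i j; rewrite [RHS]mxE.
have := h i (mem_index_enum i); rewrite psumr_eq0 => [/allP/(_ j (mem_index_enum j))|k _].
  by rewrite -expr2 sqrf_eq0 => /eqP.
by rewrite -expr2 sqr_ge0.
Qed.

Section Diagonal.
Variables (S : 'M[R]_n) (d : 'rV[R]_n).
Hypothesis VS : V *m S *m V^T = diag_mx d.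

Lemma frame_diag : S = invmx V *m diag_mx d *m (invmx V)^T.
Proof.
have Vu := frame_unit.
by rewrite -VS !mulmxA mulVmx// mul1mx trmx_inv mulmxK// unitmx_tr.
Qed.

Lemma frame_diag_endo : S *m invmx G = invmx V *m diag_mx d *m V.
Proof.
rewrite frame_diag frame_inv !mulmxA -[_ *m (invmx V)^T *m _]mulmxA.
by rewrite -trmx_mul mulmxV ?frame_unit// trmx1 mulmx1.
Qed.

Lemma hat_wedge2 w i j : form2 w ->
  hat (op2 G (wedge2 S) w) i j = d 0 i * d 0 j * hat w i j.
Proof.
move=> fw; have -> : hat (op2 G (wedge2 S) w) = diag_mx d *m hat w *m diag_mx d.
  rewrite op2_wedge2// frame_diag_endo /hat !trmx_mul tr_diag_mx !mulmxA trmx_inv.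
  by rewrite mulmxKV ?unitmx_tr ?frame_unit// mulmxV ?frame_unit// mul1mx.
by move: (hat w) => W; rewrite mul_mx_diag mul_diag_mx !mxE mulrAC.
Qed.

Lemma hat_kulkarni w i j : form2 w ->
  hat (op2 G (kulkarni G S) w) i j = (d 0 i + d 0 j) * hat w i j.
Proof.
move=> fw.
have -> : hat (op2 G (kulkarni G S) w) = diag_mx d *m hat w + hat w *m diag_mx d.
  rewrite op2_kulkarni ?frame_metric_unit// frame_diag_endo /hat.
  rewrite mulmxDr mulmxDl !trmx_mul tr_diag_mx !mulmxA trmx_inv.
  by rewrite mulmxKV ?unitmx_tr ?frame_unit// mulmxV ?frame_unit// mul1mx.
move: (hat w) => W; rewrite mul_mx_diag mul_diag_mx !mxE mulrDl.
by rewrite [d 0 j * _]mulrC.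
Qed.

End Diagonal.
End Frame.

(** Contracting the Kulkarni-Nomizu product gives (n - 2) P + tr(P) G, which the
    Schouten tensor inverts. *)
Lemma kulkarni_schouten G P : (2 < n)%N -> G^T = G -> G \in unitmx -> P^T = P ->
  schouten G (kulkarni G P) = P.
Proof.
move=> n3 Gs Gu Ps.
have n30 : (n%:R - 2 : R) != 0.
  by rewrite subr_eq0 -[2]/(2%:R) eqr_nat gtn_eqF.
have n10 : (n%:R - 1 : R) != 0.
  by rewrite subr_eq0 -[1]/(1%:R) eqr_nat gtn_eqF// (ltn_trans _ n3).
have Hs : (invmx G)^T = invmx G by rewrite trmx_inv Gs.
have g a b : G a b = G b a by rewrite -[in RHS]Gs mxE.
have p a b : P a b = P b a by rewrite -[in RHS]Ps mxE.
have h a b : invmx G a b = invmx G b a by rewrite -[in RHS]Hs mxE.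
pose tau := \sum_k \sum_l invmx G k l * P l k.
have HG i j : \sum_k invmx G i k * G k j = (i == j)%:R.
  by have /matrixP/(_ i j) := mulVmx Gu; rewrite !mxE.
have trG : \sum_k \sum_l invmx G k l * G l k = n%:R.
  under eq_bigr do rewrite HG eqxx.
  by rewrite sumr_const card_ord.
have ric : ricci G (kulkarni G P) = (n%:R - 2) *: P + tau *: G.
  apply/matrixP => i j; rewrite !mxE.
  transitivity ((\sum_k \sum_l invmx G k l * G l k) * P i j + tau * G i j
     - \sum_k (\sum_l invmx G k l * P l j) * G i k
     - \sum_k (\sum_l invmx G k l * G l j) * P i k).
    rewrite /tau !mulr_suml -big_split -!sumrB /=; apply: eq_bigr => k _.
    rewrite !mulr_suml -big_split -!sumrB /=; apply: eq_bigr => l _.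
    by rewrite /kulkarni; ring.
  rewrite trG.
  have -> : \sum_k (\sum_l invmx G k l * G l j) * P i k = P i j.
    under eq_bigr do rewrite HG.
    rewrite (bigD1 j)//= eqxx mul1r big1 ?addr0// => k /negbTE ->.
    by rewrite mul0r.
  have -> : \sum_k (\sum_l invmx G k l * P l j) * G i k = P i j.
    transitivity (\sum_l (\sum_k invmx G l k * G k i) * P l j).
      under eq_bigr do rewrite mulr_suml.
      rewrite exchange_big /=; apply: eq_bigr => l _; rewrite mulr_suml.
      by apply: eq_bigr => k _; rewrite (h k l) (g i k); ring.
    under eq_bigr do rewrite HG.
    rewrite (bigD1 i)//= eqxx mul1r big1 ?addr0// => k /negbTE ->.
    by rewrite mul0r.
  by ring.
have sc : scal G (kulkarni G P) = 2 * (n%:R - 1) * tau.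
  rewrite /scal ric.
  transitivity ((n%:R - 2) * tau + tau * \sum_k \sum_l invmx G k l * G l k).
    rewrite /tau !mulr_sumr -big_split /=; apply: eq_bigr => a _.
    rewrite !mulr_sumr -big_split /=; apply: eq_bigr => b _.
    by rewrite !mxE (p b a) (g b a); ring.
  by rewrite trG; ring.
rewrite /schouten ric sc (_ : _ / _ = tau); last by field.
by rewrite addrK scalerA mulVf// scale1r.
Qed.

Lemma kulkarni_weyl G P : (2 < n)%N -> G^T = G -> G \in unitmx -> P^T = P ->
  forall a b c d, weyl G (kulkarni G P) a b c d = 0.
Proof.
move=> n3 Gs Gu Ps a b c d; rewrite /weyl kulkarni_schouten//.
by rewrite /kulkarni subrr.
Qed.

Lemma schouten_sym G T : G^T = G -> operator_tensor T -> (schouten G T)^T = schouten G T.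
Proof.
move=> Gs [_ _ sT]; have Hs : (invmx G)^T = invmx G by rewrite trmx_inv Gs.
rewrite /schouten linearZ /= linearB /= linearZ /= Gs; congr (_ *: (_ - _)).
apply/matrixP => i j; rewrite !mxE exchange_big /=; apply: eq_bigr => k _.
apply: eq_bigr => l _; rewrite sT; congr (_ * _).
by rewrite -[in RHS]Hs mxE.
Qed.
End TwoForms.

(** * The spectral theorem on 2-forms *)

Section OperatorLogarithm.
Context {R : realType} {n : nat}.
Implicit Types (G V P S v w : 'M[R]_n) (T : tensor4 R n).

Lemma op2_sharp G T w a b : op2 G T w a b =
  2^-1 * \sum_c \sum_d T a b c d * (invmx G *m w *m (invmx G)^T) c d.
Proof.
rewrite mxE; congr (_ * _).
transitivity (\sum_c \sum_d \sum_e \sum_f T a b e f * (invmx G e c * invmx G f d * w c d)).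
  apply: eq_bigr => c _; apply: eq_bigr => d _; rewrite /raise2 mulr_suml.
  apply: eq_bigr => e _; rewrite mulr_suml.
  by apply: eq_bigr => f _; ring.
under eq_bigr do rewrite exchange_big /=.
rewrite exchange_big /=; apply: eq_bigr => e _.
under eq_bigr do rewrite exchange_big /=.
rewrite exchange_big /=; apply: eq_bigr => f _.
under eq_bigr do rewrite -mulr_sumr.
rewrite -mulr_sumr; congr (_ * _); rewrite mxE exchange_big /=.
apply: eq_bigr => d _; rewrite !mxE mulr_suml.
by apply: eq_bigr => c _; ring.
Qed.

Lemma inner2_sharp G v w : inner2 G v w =
  2^-1 * \sum_c \sum_d ((invmx G)^T *m v *m invmx G) c d * w c d.
Proof.
rewrite /inner2; congr (_ * _).
under eq_bigr do rewrite exchange_big /=.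
rewrite exchange_big /=; apply: eq_bigr => c _.
under eq_bigr do rewrite exchange_big /=.
rewrite exchange_big /=; apply: eq_bigr => d _.
rewrite exchange_big /= mxE mulr_suml; apply: eq_bigr => b _.
rewrite !mxE !mulr_suml; apply: eq_bigr => a _; rewrite !mxE; ring.
Qed.

Lemma inner2_linear G (c : R) v v' w :
  inner2 G (c *: v + v') w = c * inner2 G v w + inner2 G v' w.
Proof.
rewrite /inner2 mulrCA -mulrDr; congr (_ * _).
rewrite mulr_sumr -big_split /=; apply: eq_bigr => i _.
rewrite mulr_sumr -big_split /=; apply: eq_bigr => j _.
rewrite mulr_sumr -big_split /=; apply: eq_bigr => k _.
rewrite mulr_sumr -big_split /=; apply: eq_bigr => l _; rewrite !mxE; ring.
Qed.

Section Metric.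
Variables (G : 'M[R]_n).
Hypothesis Gp : posdef G.

Lemma posdef_frame : exists V, V *m G *m V^T = 1%:M.
Proof.
have [V [d [VG _]]] := simultaneous_diagonalisation Gp (trmx0 _ _ _).
by exists V.
Qed.

Let Gs : G^T = G := Gp.1.
Let Hs : (invmx G)^T = invmx G. Proof. by rewrite trmx_inv Gs. Qed.

Lemma posdef_unit : G \in unitmx.
Proof. by have [V VG] := posdef_frame; exact: frame_metric_unit VG. Qed.

Lemma inner2C v w : inner2 G v w = inner2 G w v.
Proof.
have [V VG] := posdef_frame; rewrite !(inner2_hat VG); congr (_ * _).
by apply: eq_bigr => i _; apply: eq_bigr => j _; rewrite mulrC.
Qed.

Lemma inner2_linear_r (c : R) v w w' :
  inner2 G v (c *: w + w') = c * inner2 G v w + inner2 G v w'.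
Proof. by rewrite inner2C inner2_linear inner2C [in X in _ + X]inner2C. Qed.

Lemma inner2Z_r (c : R) v w : inner2 G v (c *: w) = c * inner2 G v w.
Proof.
have E0 : inner2 G v 0 = 0.
  have := inner2_linear_r (-1) v 0 0.
  by rewrite scaler0 add0r mulN1r addNr.
by rewrite -[c *: w]addr0 inner2_linear_r E0 addr0.
Qed.

Lemma op2_selfadjoint T v w : operator_tensor T ->
  inner2 G v (op2 G T w) = inner2 G (op2 G T v) w.
Proof.
move=> [_ _ sT].
have E u u' : inner2 G u (op2 G T u') = 2^-1 * (2^-1 * \sum_c \sum_d \sum_e \sum_f
    T c d e f * (invmx G *m u *m invmx G) c d * (invmx G *m u' *m invmx G) e f).
  rewrite inner2_sharp; congr (_ * _); rewrite mulr_sumr; apply: eq_bigr => c _.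
  rewrite mulr_sumr; apply: eq_bigr => d _; rewrite op2_sharp Hs mulrCA; congr (_ * _).
  rewrite mulr_sumr; apply: eq_bigr => e _; rewrite mulr_sumr.
  by apply: eq_bigr => f _; ring.
rewrite [RHS]inner2C !E; congr (_ * (_ * _)).
transitivity (\sum_e \sum_f \sum_c \sum_d
   T c d e f * (invmx G *m v *m invmx G) c d * (invmx G *m w *m invmx G) e f).
  under eq_bigr do rewrite exchange_big /=.
  rewrite exchange_big /=; apply: eq_bigr => e _.
  under eq_bigr do rewrite exchange_big /=.
  by rewrite exchange_big.
apply: eq_bigr => e _; apply: eq_bigr => f _; apply: eq_bigr => c _.
by apply: eq_bigr => d _; rewrite (sT e f c d); ring.
Qed.

Lemma gram_matrix (beta : 'M[R]_n -> 'M[R]_n -> R) :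
  (forall c v v' w, beta (c *: v + v') w = c * beta v w + beta v' w) ->
  (forall v w, beta v w = beta w v) ->
  exists Q : 'M[R]_(n * n), Q^T = Q /\
    forall v w, beta v w = (mxvec v *m Q *m (mxvec w)^T) 0 0.
Proof.
move=> bl bs.
pose b (i : 'I_(n * n)) : 'M[R]_n := vec_mx (delta_mx 0 i).
exists (\matrix_(i, j) beta (b i) (b j)); split.
  by apply/matrixP => i j; rewrite !mxE bs.
have b0 w : beta 0 w = 0.
  by have := bl (-1) 0 0 w; rewrite scaler0 add0r mulN1r addNr.
have bsum u w : beta (vec_mx u) w = \sum_i u 0 i * beta (b i) w.
  rewrite {1}(row_sum_delta u) linear_sum /=.
  elim/big_rec2: _ => // i y z _ <-; by rewrite linearZ /= bl.
move=> v w; rewrite -{1}(mxvecK v) bsum -mulmxA mxE; apply: eq_bigr => i _.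
congr (_ * _); rewrite bs -{1}(mxvecK w) bsum mxE; apply: eq_bigr => j _.
by rewrite !mxE bs mulrC.
Qed.

(** Spectral theorem for self-adjoint operators on 2-forms. The eigenvectors are
    computed among all bilinear forms and then antisymmetrised, which leaves
    a tight frame of eigenforms, some of which may vanish. *)
Theorem operator_eigenforms T : operator_tensor T ->
  exists (m : nat) (w : 'I_m -> 'M[R]_n) (mu : 'I_m -> R),
    [/\ forall i, form2 (w i), forall i, op2 G T (w i) = mu i *: w i &
        forall v, form2 v -> v = \sum_i inner2 G (w i) v *: w i].
Proof.
move=> Top; have [aT1 aT2 _] := Top.
have [V VG] := posdef_frame.
have [Q1 [Q1s Q1E]] := gram_matrix (inner2_linear G) inner2C.
have [Q2 [Q2s Q2E]] : exists Q : 'M[R]_(n * n), Q^T = Q /\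
    forall v w, inner2 G v (op2 G T w) = (mxvec v *m Q *m (mxvec w)^T) 0 0.
  apply: gram_matrix => [c v v' w|v w]; first exact: inner2_linear.
  by rewrite op2_selfadjoint// inner2C.
have Q1p : posdef Q1.
  split=> // v v0; rewrite /quad -[v]vec_mxK -Q1E; apply: inner2_posdef VG _ _.
  by apply: contra v0 => /eqP h; rewrite -[v]vec_mxK h linear0.
have [W [d [WQ1 WQ2]]] := simultaneous_diagonalisation Q1p Q2s.
pose e i : 'M[R]_n := vec_mx (row i W).
have complete v : v = \sum_i inner2 G (e i) v *: e i.
  apply: (can_inj (@mxvecK _ n n)); rewrite linear_sum /=.
  transitivity (mxvec v *m Q1 *m W^T *m W).
    have := frame_inv WQ1; rewrite -[_ *m W^T *m W]mulmxA => <-.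
    by rewrite mulmxK// (frame_metric_unit WQ1).
  rewrite mulmx_sum_row; apply: eq_bigr => i _; rewrite linearZ /= vec_mxK; congr (_ *: _).
  rewrite inner2C Q1E vec_mxK mxE [RHS]mxE; apply: eq_bigr => k _.
  by rewrite !mxE.
have eig i : op2 G T (e i) = d 0 i *: e i.
  rewrite [LHS]complete (bigD1 i)//= big1 ?addr0 => [|k ki].
    congr (_ *: _); rewrite Q2E vec_mxK.
    have := WQ2 => /matrixP/(_ i i); rewrite [RHS]mxE eqxx mulr1n => <-.
    rewrite -[in LHS]row_mul [LHS]mxE [RHS]mxE; apply: eq_bigr => l _.
    by rewrite !mxE.
  rewrite Q2E !vec_mxK (_ : _ 0 0 = (W *m Q2 *m W^T) k i).
    by rewrite WQ2 mxE (negbTE ki) mulr0n scale0r.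
  by rewrite -row_mul [LHS]mxE [RHS]mxE; apply: eq_bigr => l _; rewrite !mxE.
have op2_anti v : (op2 G T v)^T = - op2 G T v.
  apply/matrixP => a b; rewrite mxE [RHS]mxE !op2_sharp -mulrN -sumrN; congr (_ * _).
  apply: eq_bigr => k _; rewrite -sumrN; apply: eq_bigr => l _.
  by rewrite aT1 mulNr.
have op2_tr v : op2 G T v^T = - op2 G T v.
  apply/matrixP => a b; rewrite [RHS]mxE !op2_sharp -mulrN -sumrN; congr (_ * _).
  rewrite exchange_big /=; apply: eq_bigr => k _; rewrite -sumrN; apply: eq_bigr => l _.
  rewrite aT2 mulNr; congr (- (_ * _)).
  rewrite (_ : _ *m v^T *m _ = (invmx G *m v *m (invmx G)^T)^T); first by rewrite mxE.
  by rewrite !trmx_mul trmxK mulmxA.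
pose w i := 2^-1 *: (e i - (e i)^T).
have half (A : 'M[R]_n) : 2^-1 *: (A + A) = A.
  by apply/matrixP => a b; rewrite !mxE; clear; lra.
have fw i : form2 (w i).
  by rewrite /form2 /w linearZ /= linearB /= trmxK -scalerN opprB.
exists (n * n)%N, w, (fun i => d 0 i); split=> // [i|v fv].
- have h1 : op2 G T (w i) = op2 G T (e i).
    have -> : e i = 1 *: w i + 2^-1 *: (e i + (e i)^T).
      by apply/matrixP => a b; rewrite !mxE; clear; lra.
    have h (u : 'M[R]_n) : u^T = u -> op2 G T u = 0.
      move=> us; have := op2_tr u; rewrite us => /eqP; rewrite -addr_eq0 => /eqP uu.
      by rewrite -[LHS]half uu scaler0.
    rewrite op2_lin scale1r [X in _ + X]h ?addr0//.
    by rewrite linearZ /= linearD /= trmxK addrC.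
  have := op2_anti (e i); rewrite h1 eig linearZ /= => h2.
  by rewrite /w scalerA mulrC -scalerA scalerBr h2 opprK half.
- have iv i : inner2 G (w i) v = inner2 G (e i) v.
    have tr u : inner2 G u^T v = - inner2 G u v.
      have hT : hat V u^T = (hat V u)^T by rewrite /hat !trmx_mul trmxK mulmxA.
      have hv k l : hat V v l k = - hat V v k l.
        by have /matrixP/(_ k l) := hat_form V fv; rewrite mxE [RHS]mxE.
      rewrite !(inner2_hat VG) -mulrN -sumrN exchange_big /=; congr (_ * _).
      apply: eq_bigr => k _; rewrite -sumrN; apply: eq_bigr => l _.
      by rewrite hT hv mxE mulrN.
    rewrite inner2C /w inner2Z_r -scaleN1r addrC inner2_linear_r.
    rewrite inner2C tr inner2C; clear; lra.
  under eq_bigr do rewrite iv.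
  have c1 := complete v.
  have c2 : v = - \sum_i inner2 G (e i) v *: (e i)^T.
    have := congr1 trmx c1; rewrite fv linear_sum /= => /(congr1 -%R); rewrite opprK => h.
    apply: (etrans h); congr (- _).
    by apply: eq_bigr => i _; rewrite linearZ.
  apply: (etrans (esym (half v))); rewrite {1}c1 [X in _ + X]c2 -sumrB scaler_sumr; apply: eq_bigr => i _.
  by rewrite /w -scalerBr !scalerA mulrC.
Qed.
End Metric.
End OperatorLogarithm.

(** * The operator logarithm and its Weyl tensor *)

Section PointwiseTheorem.
Context {R : realType} {n : nat}.
Implicit Types (G V P S v w : 'M[R]_n) (T : tensor4 R n).

(** The logarithm exists: for a tight frame of eigenforms w_i of eigenvalues
    mu_i it is the sum of ln(mu_i) w_i (x) w_i, because an eigenform of T pairs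
    to zero with the w_i of other eigenvalues. *)
Lemma op2_lnP G T : posdef G -> operator_tensor T ->
  operator_tensor (op2_ln G T) /\
  forall lam w, form2 w -> op2 G T w = lam *: w -> op2 G (op2_ln G T) w = ln lam *: w.
Proof.
move=> Gp Top; rewrite /op2_ln; apply: (@getPex (tensor4 R n)
  [set L | operator_tensor L /\ forall lam w, form2 w ->
      op2 G T w = lam *: w -> op2 G L w = ln lam *: w]).
have [m [w [mu [fw ew cw]]]] := operator_eigenforms Gp Top.
exists (fun a b c d => \sum_i ln (mu i) * w i a b * w i c d).
have wa i a b : w i b a = - w i a b by have /matrixP/(_ a b) := fw i; rewrite !mxE.
split; first split=> [a b c d|a b c d|a b c d].
- by rewrite -sumrN; apply: eq_bigr => i _; rewrite (wa i a b); ring.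
- by rewrite -sumrN; apply: eq_bigr => i _; rewrite (wa i c d); ring.
- by apply: eq_bigr => i _; ring.
move=> lam v fv ev.
have E i : ln (mu i) * inner2 G (w i) v = ln lam * inner2 G (w i) v.
  have : lam * inner2 G (w i) v = mu i * inner2 G (w i) v.
    rewrite -inner2Z_r// -ev op2_selfadjoint// ew inner2C//.
    by rewrite inner2Z_r// inner2C.
  have [->|nz] := eqVneq (inner2 G (w i) v) 0; first by rewrite !mulr0.
  by move=> /(mulIf nz) ->.
have -> : op2 G (fun a b c d => \sum_i ln (mu i) * w i a b * w i c d) v =
    \sum_i (ln (mu i) * inner2 G (w i) v) *: w i.
  apply/matrixP => a b; rewrite summxE mxE.
  transitivity (2^-1 * \sum_c \sum_d \sum_e \sum_f \sum_i
     (ln (mu i) * w i a b) * (w i e f * invmx G e c * invmx G f d * v c d)).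
    congr (_ * _); apply: eq_bigr => c _; apply: eq_bigr => d _.
    rewrite /raise2 mulr_suml; apply: eq_bigr => e _.
    rewrite mulr_suml; apply: eq_bigr => f _.
    by rewrite !mulr_suml; apply: eq_bigr => i _; ring.
  transitivity (2^-1 * \sum_i (ln (mu i) * w i a b) *
      \sum_c \sum_d \sum_e \sum_f w i e f * invmx G e c * invmx G f d * v c d).
    congr (_ * _); under [RHS]eq_bigr do rewrite mulr_sumr.
    rewrite [RHS]exchange_big /=; apply: eq_bigr => c _.
    under [RHS]eq_bigr do rewrite mulr_sumr.
    rewrite [RHS]exchange_big /=; apply: eq_bigr => d _.
    under [RHS]eq_bigr do rewrite mulr_sumr.
    rewrite [RHS]exchange_big /=; apply: eq_bigr => e _.
    under [RHS]eq_bigr do rewrite mulr_sumr.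
    by rewrite [RHS]exchange_big.
  rewrite mulr_sumr; apply: eq_bigr => i _; rewrite mxE.
  rewrite (_ : inner2 G (w i) v = 2^-1 * \sum_c \sum_d \sum_e \sum_f
      w i e f * invmx G e c * invmx G f d * v c d); first by ring.
  rewrite /inner2; congr (_ * _).
  under eq_bigr do rewrite exchange_big /=.
  rewrite exchange_big /=; apply: eq_bigr => c _.
  under eq_bigr do rewrite exchange_big /=.
  by rewrite exchange_big.
rewrite [in RHS](cw v fv) scaler_sumr; apply: eq_bigr => i _.
by rewrite E scalerA.
Qed.

Lemma hatZ V (c : R) w : hat V (c *: w) = c *: hat V w.
Proof. by rewrite /hat -scalemxAr -scalemxAl. Qed.

Lemma form2_hat_eform V i j : V \in unitmx ->
  form2 (invmx V *m eform i j *m (invmx V)^T) /\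
  hat V (invmx V *m eform i j *m (invmx V)^T) = eform i j.
Proof.
move=> Vu; split.
  by rewrite /form2 !trmx_mul trmxK form2_eform mulNmx mulmxN mulmxA.
rewrite /hat !mulmxA mulmxV// mul1mx trmx_inv mulmxKV// unitmx_tr//.
Qed.

Lemma diag_posdef (d : 'rV[R]_n) : (forall i, 0 < d 0 i) -> posdef (diag_mx d).
Proof.
move=> d0; split=> [|v v0]; first exact: tr_diag_mx.
have E : quad (diag_mx d) v = \sum_i d 0 i * v 0 i ^+ 2.
  rewrite /quad mul_mx_diag mxE; apply: eq_bigr => i _; rewrite !mxE; ring.
have nn i : 0 <= d 0 i * v 0 i ^+ 2 by rewrite mulr_ge0 ?sqr_ge0// ltW.
rewrite E lt_neqAle sumr_ge0// andbT eq_sym psumr_eq0//.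
apply: contra v0 => /allP h; apply/eqP/rowP => i; rewrite [RHS]mxE; apply/eqP.
have := h i (mem_index_enum i).
by rewrite mulf_eq0 gt_eqF//= sqrf_eq0.
Qed.

Lemma frame_posdef G V S d : V *m G *m V^T = 1%:M -> V *m S *m V^T = diag_mx d ->
  (forall i, 0 < d 0 i) -> posdef S.
Proof.
move=> VG VS d0; rewrite (frame_diag VG VS).
apply: posdef_congr (diag_posdef d0) _.
by rewrite row_free_unit unitmx_inv (frame_unit VG).
Qed.

Lemma frame_exp G V P (p : 'rV[R]_n) :
  V *m G *m V^T = 1%:M -> V *m P *m V^T = diag_mx p ->
  V *m exp_tensor G P *m V^T = diag_mx (map_mx expR p).
Proof.
move=> VG VP; have Vu := frame_unit VG.
rewrite /exp_tensor (frame_diag_endo VG VP) mx_exp_diag//.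
rewrite -!mulmxA mulKVmx// -[RHS]mulmx1; congr (_ *m _).
by rewrite mulmxA.
Qed.

Lemma frame_diag_inj G V S S' d : V *m G *m V^T = 1%:M ->
  V *m S *m V^T = diag_mx d -> V *m S' *m V^T = diag_mx d -> S = S'.
Proof. by move=> VG VS VS'; rewrite (frame_diag VG VS) (frame_diag VG VS'). Qed.

Lemma frame_posdef_gt0 G V S d : V *m G *m V^T = 1%:M -> V *m S *m V^T = diag_mx d ->
  posdef S -> forall i, 0 < d 0 i.
Proof.
move=> VG VS Sp i.
have rf : row_free V by rewrite row_free_unit (frame_unit VG).
pose e : 'rV[R]_n := delta_mx 0 i.
have [_ /(_ e)] := posdef_congr Sp rf.
rewrite VS /quad => h.
have -> : d 0 i = (e *m diag_mx d *m e^T) 0 0.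
  rewrite mul_mx_diag mxE (bigD1 i)//= !mxE !eqxx mul1r mulr1 big1 ?addr0// => k ki.
  by rewrite !mxE (negbTE ki) !(mul0r, andbF).
apply: h; apply/eqP => /rowP/(_ i)/eqP; by rewrite !mxE !eqxx oner_eq0.
Qed.

(** Symmetric multipliers act on e_i ^ e_j as scalars: its components are
    supported on (i, j) and (j, i). *)
Lemma eform_sym (q : 'I_n -> 'I_n -> R) i j k l : (forall k l, q k l = q l k) ->
  q k l * eform i j k l = q i j * eform i j k l.
Proof.
move=> qs; rewrite /eform !mxE.
case: (boolP ((k == i) && (l == j))) => [/andP[/eqP-> /eqP->]//|_].
case: (boolP ((k == j) && (l == i))) => [/andP[/eqP-> /eqP->]|_].
  by rewrite (qs j i).
by rewrite subrr !mulr0.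
Qed.

(** For T = S ^ S, the forms e_i ^ e_j of a common frame are eigenforms of
    eigenvalue s_i s_j, so that ln T acts on them by ln s_i + ln s_j. *)
Theorem log_wedge2 G S : (2 < n)%N -> posdef G -> posdef S ->
  [/\ op2_posdef G (wedge2 S),
      forall a b c d, weyl G (op2_ln G (wedge2 S)) a b c d = 0
    & exp_tensor G (schouten G (op2_ln G (wedge2 S))) = S].
Proof.
move=> n3 Gp Sp; have [Gs _] := Gp; have [Ss _] := Sp.
have [V [s [VG VS]]] := simultaneous_diagonalisation Gp Ss.
have Vu := frame_unit VG; have Gu := frame_metric_unit VG.
have s0 := frame_posdef_gt0 VG VS Sp.
pose P := invmx V *m diag_mx (map_mx (@ln R) s) *m (invmx V)^T.
have VP : V *m P *m V^T = diag_mx (map_mx (@ln R) s).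
  by rewrite /P !mulmxA mulmxV// mul1mx trmx_inv mulmxKV// unitmx_tr.
have Ps : P^T = P by rewrite /P !trmx_mul trmxK tr_diag_mx mulmxA.
have [Lop LP] := op2_lnP Gp (wedge2_operator Ss).
have LK : op2_ln G (wedge2 S) = kulkarni G P.
  apply/funext => a; apply/funext => b; apply/funext => c; apply/funext => d.
  have [_ aL _] := Lop; have [_ aK _] := kulkarni_operator Gs Ps.
  apply: (op2_inj Gu aL aK) => w fw.
  rewrite [w](_ : _ = \sum_(ij : 'I_n * 'I_n) (2^-1 * hat V w ij.1 ij.2) *:
     (invmx V *m eform ij.1 ij.2 *m (invmx V)^T)); last first.
    have E : w = invmx V *m hat V w *m (invmx V)^T.
      by rewrite /hat trmx_inv !mulmxA mulVmx// mul1mx mulmxK// unitmx_tr.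
    rewrite {1}E {1}(form2_sum_eform (hat_form V fw)) mulmx_sumr mulmx_suml.
    by apply: eq_bigr => ij _; rewrite -scalemxAr -scalemxAl.
  rewrite !op2_sum; apply: eq_bigr => -[i j] _ /=; congr (_ *: _).
  have [fe he] := form2_hat_eform i j Vu.
  rewrite (LP (s 0 i * s 0 j) _ fe); last first.
    apply: (hat_inj VG); apply/matrixP => k l.
    rewrite (hat_wedge2 VG VS)// hatZ he [RHS]mxE.
    apply: (@eform_sym (fun k l => s 0 k * s 0 l) i j k l) => k' l'.
    by rewrite mulrC.
  rewrite lnM ?posrE//.
  apply: (hat_inj VG); apply/matrixP => k l.
  rewrite (hat_kulkarni VG VP)// hatZ he [LHS]mxE.
  rewrite (@eform_sym (fun k l => (map_mx (@ln R) s) 0 k + (map_mx (@ln R) s) 0 l) i j k l).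
    by rewrite !mxE.
  by move=> k' l'; rewrite addrC.
split.
- move=> w fw w0; rewrite (inner2_hat VG) mulr_gt0 ?invr_gt0//.
  have nn i j : 0 <= hat V w i j * hat V (op2 G (wedge2 S) w) i j.
    rewrite (hat_wedge2 VG VS)// mulrCA -expr2 mulr_ge0 ?sqr_ge0//.
    by rewrite mulr_ge0// ltW.
  have nn1 i : 0 <= \sum_j hat V w i j * hat V (op2 G (wedge2 S) w) i j.
    by apply: sumr_ge0.
  rewrite lt_neqAle sumr_ge0// andbT eq_sym psumr_eq0//.
  apply: contra w0 => /allP h; apply/eqP; apply: (hat_inj VG).
  apply/matrixP => i j; rewrite [in RHS]/hat mulmx0 mul0mx [RHS]mxE; apply/eqP.
  have := h i (mem_index_enum i); rewrite psumr_eq0// => /allP/(_ j (mem_index_enum j)).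
  rewrite (hat_wedge2 VG VS)// mulrCA -expr2 mulf_eq0 sqrf_eq0.
  by rewrite gt_eqF//= mulr_gt0.
- by move=> a b c d; rewrite LK kulkarni_weyl.
- rewrite LK kulkarni_schouten//; apply: (frame_diag_inj VG _ VS).
  rewrite (frame_exp VG VP); congr diag_mx; apply/rowP => i.
  by rewrite !mxE lnK// posrE.
Qed.

(** Conversely, if ln T is the Kulkarni product of G and P, an eigenform of T
    has components only where p_i + p_j is the logarithm of its eigenvalue, so
    that it is an eigenform of exp P ^ exp P for the same eigenvalue. *)
Theorem exp_weyl_flat G T : posdef G -> operator_tensor T -> op2_posdef G T ->
  (forall a b c d, weyl G (op2_ln G T) a b c d = 0) ->
  let S := exp_tensor G (schouten G (op2_ln G T)) in
  posdef S /\ T = wedge2 S.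
Proof.
move=> Gp Top Tp Wf S; have [Gs _] := Gp.
have [Lop LP] := op2_lnP Gp Top.
pose P := schouten G (op2_ln G T).
have Ps : P^T = P := schouten_sym Gs Lop.
have [V [p [VG VP]]] := simultaneous_diagonalisation Gp Ps.
have Vu := frame_unit VG; have Gu := frame_metric_unit VG.
have LK : op2_ln G T = kulkarni G P.
  apply/funext => a; apply/funext => b; apply/funext => c; apply/funext => d.
  exact/subr0_eq/Wf.
have VS := frame_exp VG VP; rewrite -/S in VS.
have Sp : posdef S.
  by apply: (frame_posdef VG VS) => i; rewrite mxE expR_gt0.
split=> //.
have [m [w [mu [fw ew cw]]]] := operator_eigenforms Gp Top.
have ew' i : op2 G (wedge2 S) (w i) = mu i *: w i.
  have [->|wi0] := eqVneq (w i) 0.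
    by have := op2_sum G (wedge2 S) (fun _ : 'I_0 => 0) (fun=> 0); rewrite !big_ord0 scaler0.
  have mu0 : 0 < mu i.
    have := Tp (w i) (fw i) wi0; rewrite ew inner2Z_r//.
    by rewrite pmulr_lgt0// (inner2_posdef VG).
  apply: (hat_inj VG); apply/matrixP => k l.
  rewrite (hat_wedge2 VG VS)// hatZ [RHS]mxE.
  have := LP _ _ (fw i) (ew i); rewrite LK => /(congr1 (hat V))/matrixP/(_ k l).
  rewrite (hat_kulkarni VG VP)// hatZ [RHS]mxE.
  have [->|h0] := eqVneq (hat V (w i) k l) 0; first by rewrite !mulr0.
  by move=> /(mulIf h0) E; rewrite !mxE -expRD E lnK// posrE.
have [_ aT _] := Top; have [_ aS _] := wedge2_operator Sp.1.
apply/funext => a; apply/funext => b; apply/funext => c; apply/funext => d.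
apply: (op2_inj Gu aT aS) => v fv.
by rewrite (cw v fv) !op2_sum; apply: eq_bigr => i _; rewrite ew ew'.
Qed.

End PointwiseTheorem.

(** * Positivity and algebraic recovery of the second fundamental form *)

Section Recover.
Context {R : realType} {n : nat}.
Implicit Types (G V S : 'M[R]_n) (T : tensor4 R n).

Lemma quad_sum S (X Y : 'rV[R]_n) :
  (X *m S *m Y^T) 0 0 = \sum_a \sum_c X 0 a * S a c * Y 0 c.
Proof.
rewrite exchange_big /= mxE; apply: eq_bigr => c _; rewrite !mxE mulr_suml.
by apply: eq_bigr => a _.
Qed.

Lemma wedge2_contract S (X Y : 'rV[R]_n) :
  \sum_a \sum_b \sum_c \sum_d wedge2 S a b c d * X 0 a * Y 0 b * X 0 c * Y 0 d =
  quad S X * quad S Y - (X *m S *m Y^T) 0 0 * (Y *m S *m X^T) 0 0.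
Proof.
have D (f g : 'I_n -> 'I_n -> R) : (\sum_a \sum_c f a c) * (\sum_b \sum_d g b d) =
    \sum_a \sum_b \sum_c \sum_d f a c * g b d.
  rewrite mulr_suml; apply: eq_bigr => a _; rewrite mulr_sumr; apply: eq_bigr => b _.
  by rewrite big_distrlr.
rewrite /quad !quad_sum !D -sumrB; apply: eq_bigr => a _.
rewrite -sumrB; apply: eq_bigr => b _.
rewrite [X in _ - X]exchange_big /= -sumrB; apply: eq_bigr => c _.
by rewrite -sumrB; apply: eq_bigr => d _; rewrite /wedge2; ring.
Qed.

Lemma row_free_pair V i j : V \in unitmx -> i != j ->
  row_free (col_mx (row i V) (row j V)).
Proof.
move=> Vu ij.
pose D : 'M[R]_(1 + 1, n) := col_mx (delta_mx 0 i) (delta_mx 0 j).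
have E : col_mx (row i V) (row j V) = D *m V by rewrite mul_col_mx -!rowE.
apply/row_freeP; exists (invmx V *m D^T).
rewrite E mulmxA mulmxK// tr_col_mx mul_col_row !trmx_delta !mul_delta_mx_cond.
rewrite !eqxx (negbTE ij) eq_sym (negbTE ij) !mulr0n !mulr1n.
rewrite [RHS]scalar_mx_block; congr block_mx; apply/matrixP => k l;
  by rewrite !ord1 !mxE.
Qed.

(** If the sectional curvatures of S ^ S are positive, then the eigenvalues of S
    relative to G have positive pairwise products, hence the same sign. *)
Lemma sectional_posdef G S (k : 'I_n) : (1 < n)%N -> posdef G -> S^T = S ->
  (forall X Y : 'rV[R]_n, row_free (col_mx X Y) ->
     0 < (\sum_a \sum_b \sum_c \sum_d wedge2 S a b c d * X 0 a * Y 0 b * X 0 c * Y 0 d)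
      / (quad G X * quad G Y - (X *m G *m Y^T) 0 0 ^+ 2)) ->
  S k k != 0 /\ (0 < S k k -> posdef S).
Proof.
move=> n1 Gp Ss sec.
have [V [s [VG VS]]] := simultaneous_diagonalisation Gp Ss.
have Vu := frame_unit VG.
have rowE (Q : 'M[R]_n) i j : (row i V *m Q *m (row j V)^T) 0 0 = (V *m Q *m V^T) i j.
  by rewrite -row_mul [LHS]mxE [RHS]mxE; apply: eq_bigr => l _; rewrite !mxE.
have pp i j : i != j -> 0 < s 0 i * s 0 j.
  move=> ij; have := sec _ _ (row_free_pair Vu ij).
  rewrite wedge2_contract /quad !rowE VG VS !mxE !eqxx (negbTE ij) eq_sym (negbTE ij).
  by rewrite !mulr0n !mulr1n mul0r subr0 expr0n subr0 mulr1 divr1.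
have skE : S k k = \sum_i s 0 i * invmx V k i ^+ 2.
  rewrite [in LHS](frame_diag VG VS) mxE; apply: eq_bigr => i _.
  by rewrite mul_mx_diag !mxE; ring.
have Vk0 : exists i, invmx V k i != 0.
  apply/existsP; apply: contraT; rewrite negb_exists => /forallP h.
  have : (invmx V *m V) k k = 1 by rewrite mulVmx// mxE eqxx.
  rewrite mxE big1 => [/esym/eqP|i _]; first by rewrite oner_eq0.
  by have := h i; rewrite negbK => /eqP ->; rewrite mul0r.
have [i0 i00] := Vk0.
have other (i : 'I_n) : exists j, i != j.
  have [j ji] : exists j : 'I_n, j != i.
    apply/existsP; apply: contraT; rewrite negb_exists => /forallP h.
    have : (#|'I_n| <= 1)%N.
      rewrite (cardD1 i) inE add1n ltnS leqn0; apply/eqP; apply: eq_card0 => j.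
      by rewrite !inE andbT; have := h j; rewrite negbK => ->.
    by rewrite card_ord leqNgt n1.
  by exists j; rewrite eq_sym.
have sne i : s 0 i != 0.
  have [j /pp] := other i; apply: contraTneq => ->.
  by rewrite mul0r ltxx.
have same i j : 0 < s 0 i -> 0 < s 0 j.
  have [<-//|ij] := eqVneq i j => si.
  by have := pp i j ij; rewrite pmulr_rgt0.
have pos_sum : 0 < s 0 i0 -> 0 < S k k.
  move=> p0; rewrite skE (bigD1 i0)//= ltr_pwDl//.
    by rewrite mulr_gt0// lt_neqAle sqr_ge0 andbT eq_sym sqrf_eq0.
  by apply: sumr_ge0 => i _; rewrite mulr_ge0 ?sqr_ge0// ltW// (same i0).
have neg_sum : s 0 i0 < 0 -> S k k < 0.
  move=> p0; rewrite skE (bigD1 i0)//= -oppr_gt0 opprD ltr_pwDl//.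
    by rewrite -mulNr mulr_gt0 ?oppr_gt0// lt_neqAle sqr_ge0 andbT eq_sym sqrf_eq0.
  rewrite -sumrN; apply: sumr_ge0 => i _; rewrite -mulNr mulr_ge0 ?sqr_ge0// oppr_ge0.
  rewrite leNgt; apply/negP => /(same i i0) /lt_trans/(_ p0).
  by rewrite ltxx.
have [p0|n0|/eqP] := ltgtP 0 (s 0 i0); last by rewrite eq_sym (negbTE (sne i0)).
- split; first by rewrite gt_eqF// pos_sum.
  by move=> _; apply: (frame_posdef VG VS) => i; exact: same p0.
- have h := neg_sum n0; split; first by rewrite lt_eqF.
  by move=> h'; have := lt_trans h h'; rewrite ltxx.
Qed.

(** The entries of a 3 x 3 positive symmetric block are polynomials in its 2 x 2
    minors divided by its determinant, which is the square root of the
    determinant of the adjugate block. *)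
Section Cofactors.
Variables (T : tensor4 R n) (i j k : 'I_n).
Definition cof11 := T j k j k.
Definition cof12 := - T j k i k.
Definition cof13 := T j k i j.
Definition cof22 := T i k i k.
Definition cof23 := T i k j i.
Definition cof33 := T i j i j.
Definition cof_det := cof11 * (cof22 * cof33 - cof23 ^+ 2) -
  cof12 * (cof12 * cof33 - cof13 * cof23) + cof13 * (cof12 * cof23 - cof13 * cof22).
Definition cof_diag := (cof22 * cof33 - cof23 ^+ 2) / Num.sqrt cof_det.
Definition cof_off := (cof13 * cof23 - cof12 * cof33) / Num.sqrt cof_det.
End Cofactors.

Lemma wedge2_recover S i j k : posdef S -> i != j -> i != k -> j != k ->
  [/\ 0 < cof_det (wedge2 S) i j k, S i i = cof_diag (wedge2 S) i j k
    & S i j = cof_off (wedge2 S) i j k].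
Proof.
move=> [Ss Sp] ij ik jk.
have sy a b : S a b = S b a by rewrite -[in RHS]Ss mxE.
have qE (x y z : R) : quad S (x *: delta_mx 0 i + y *: delta_mx 0 j + z *: delta_mx 0 k) =
    x ^+ 2 * S i i + y ^+ 2 * S j j + z ^+ 2 * S k k +
    2 * (x * y * S i j + x * z * S i k + y * z * S j k).
  have de (a b : 'I_n) : ((delta_mx 0 a : 'rV[R]_n) *m S *m (delta_mx 0 b : 'rV[R]_n)^T) 0 0 = S a b.
    by rewrite -rowE trmx_delta -colE !mxE.
  have mx2 (A B : 'M[R]_1) c d : (c *: A + d *: B) 0 0 = c * A 0 0 + d * B 0 0.
    by rewrite !mxE.
  have mx1 (A : 'M[R]_1) c : (c *: A) 0 0 = c * A 0 0 by rewrite mxE.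
  have qe (a : 'I_n) : quad S (delta_mx 0 a) = S a a by rewrite /quad de.
  rewrite (quad_line _ _ _ Ss) (quad_line _ _ _ Ss) quadZ !mulmxDl -!scalemxAl.
  by rewrite mx2 mx1 !de !qe; ring.
have nz (x y z : R) : (x != 0) || (y != 0) || (z != 0) ->
    0 < quad S (x *: delta_mx 0 i + y *: delta_mx 0 j + z *: delta_mx 0 k).
  move=> h; apply: Sp; apply: contraTneq h => /rowP h.
  have ij' := negbTE ij; have ik' := negbTE ik; have jk' := negbTE jk.
  have ji' : (j == i) = false by rewrite eq_sym.
  have ki' : (k == i) = false by rewrite eq_sym.
  have kj' : (k == j) = false by rewrite eq_sym.
  have E (l : 'I_n) : x * (l == i)%:R + y * (l == j)%:R + z * (l == k)%:R = 0.
    by have := h l; rewrite !mxE.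
  have := E i; have := E j; have := E k.
  rewrite !eqxx ij' ik' ji' jk' ki' kj' !mulr0 !mulr1 !addr0 !add0r => -> -> ->.
  by rewrite eqxx.
pose p := S i i; pose q := S i j; pose r := S i k.
pose s := S j j; pose t := S j k; pose u := S k k.
have p0 : 0 < p.
  have := nz 1 0 0; rewrite oner_eq0 => /(_ isT); rewrite qE -/p.
  by rewrite (_ : _ + _ = p)//; ring.
have m33 : 0 < p * s - q ^+ 2.
  have := nz (- q) p 0; rewrite (gt_eqF p0) orbT => /(_ isT); rewrite qE -/p -/q -/s.
  rewrite (_ : _ + _ = p * (p * s - q ^+ 2)); last by ring.
  by rewrite pmulr_rgt0.
pose D := p * s * u + 2 * q * r * t - p * t ^+ 2 - s * r ^+ 2 - u * q ^+ 2.
have D0 : 0 < D.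
  have := nz (q * t - r * s) (q * r - p * t) (p * s - q ^+ 2).
  rewrite (gt_eqF m33) orbT => /(_ isT); rewrite qE -/p -/q -/s -/r -/t -/u.
  rewrite (_ : _ + _ = (p * s - q ^+ 2) * D); last by rewrite /D; ring.
  by rewrite pmulr_rgt0.
have cE : cof_det (wedge2 S) i j k = D ^+ 2.
  rewrite /cof_det /cof11 /cof12 /cof13 /cof22 /cof23 /cof33 /wedge2.
  rewrite (sy j i) (sy k i) (sy k j) -/p -/q -/r -/s -/t -/u /D; ring.
have sE : Num.sqrt (cof_det (wedge2 S) i j k) = D.
  by rewrite cE sqrtr_sqr gtr0_norm.
split.
- by rewrite cE exprn_gt0.
- rewrite /cof_diag sE; apply: (mulIf (lt0r_neq0 D0)); rewrite divfK ?gt_eqF//.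
  rewrite /cof22 /cof23 /cof33 /wedge2 (sy j i) (sy k i) (sy k j) -/p -/q -/r -/s -/t -/u /D.
  ring.
- rewrite /cof_off sE; apply: (mulIf (lt0r_neq0 D0)); rewrite divfK ?gt_eqF//.
  rewrite /cof12 /cof13 /cof23 /cof33 /wedge2 (sy j i) (sy k i) (sy k j) -/p -/q -/r -/s -/t -/u /D.
  ring.
Qed.
End Recover.

(** * Connections and the Levi-Civita connection *)

Section Connections.
Context {R : realType} {n : nat} (U : set 'rV[R]_n) (Uo : open U).

(** The obstruction to the integrability of d_a F = A_a F. *)
Definition curvature_mx m (A : 'I_n -> 'rV[R]_n -> 'M[R]_m) (a b : 'I_n)
    (x : 'rV[R]_n) : 'M[R]_m :=
  dmx b (A a) x - dmx a (A b) x + A a x *m A b x - A b x *m A a x.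

Lemma curvature_mxE m (A : 'I_n -> 'rV[R]_n -> 'M[R]_m) a b x i j :
  curvature_mx A a b x i j = dmx b (A a) x i j - dmx a (A b) x i j +
    ((A a x *m A b x) i j - (A b x *m A a x) i j).
Proof.
rewrite /curvature_mx.
move: (dmx b _ _) (dmx a _ _) (A a x *m _) (A b x *m _) => P Q S T.
by rewrite !mxE addrA.
Qed.

Lemma curvature_mx_flat m (A : 'I_n -> 'rV[R]_n -> 'M[R]_m) a b x :
  curvature_mx A a b x = 0 <->
  dmx b (A a) x + A a x *m A b x = dmx a (A b) x + A b x *m A a x.
Proof.
rewrite /curvature_mx; move: (dmx b _ _) (dmx a _ _) (A a x *m _) (A b x *m _) => P Q S T.
rewrite (_ : P - Q + S - T = P + S - (Q + T)); last first.
  by rewrite opprD addrACA addrA.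
by split=> [/subr0_eq|->]; rewrite ?subrr.
Qed.

Let antisymmetrised_leibniz m (A B A' B' G : 'M[R]_m) :
  A' *m G + A *m (B *m G + G *m B^T) + ((B *m G + G *m B^T) *m A^T + G *m A'^T) =
  B' *m G + B *m (A *m G + G *m A^T) + ((A *m G + G *m A^T) *m B^T + G *m B'^T) ->
  (A' - B' + A *m B - B *m A) *m G + G *m (A' - B' + A *m B - B *m A)^T = 0.
Proof.
move=> /eqP; rewrite -subr_eq0 => /eqP E; rewrite -[RHS]E.
have tB (P Q : 'M[R]_m) : (P - Q)^T = P^T - Q^T by exact: linearB.
have tD (P Q : 'M[R]_m) : (P + Q)^T = P^T + Q^T by exact: linearD.
rewrite tB tD tB !trmx_mul.
rewrite !(mulmxBl, mulmxDl, mulmxBr, mulmxDr) !mulmxA.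
move: (A' *m G) (B' *m G) (A *m B *m G) (B *m A *m G) (G *m A'^T) (G *m B'^T)
  (G *m B^T *m A^T) (G *m A^T *m B^T) (A *m G *m B^T) (B *m G *m A^T).
move=> P1 P2 P3 P4 P5 P6 P7 P8 P9 P10.
by apply/matrixP => i j; rewrite !mxE; ring.
Qed.

(** The symmetry of the second derivatives of a parallel metric. *)
Lemma curvature_antisym m (A : 'I_n -> 'rV[R]_n -> 'M[R]_m) (G : 'rV[R]_n -> 'M[R]_m) :
  (forall a, smooth_mx U (A a)) -> smooth_mx U G ->
  (forall x a, U x -> dmx a G x = A a x *m G x + G x *m (A a x)^T) ->
  forall x a b, U x ->
    curvature_mx A a b x *m G x + G x *m (curvature_mx A a b x)^T = 0.
Proof.
move=> sA sG dG x a b Ux.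
have dd c d : dmx d (dmx c G) x =
    dmx d (A c) x *m G x + A c x *m (A d x *m G x + G x *m (A d x)^T) +
    ((A d x *m G x + G x *m (A d x)^T) *m (A c x)^T + G x *m (dmx d (A c) x)^T).
  have sAT := smooth_mx_tr (sA c).
  rewrite (dmx_eq_on Uo Ux d (fun y Uy => dG y c Uy)).
  rewrite (dmxD Ux d (smooth_mxM Uo (sA c) sG) (smooth_mxM Uo sG sAT)).
  rewrite (dmxM Uo Ux d (sA c) sG) (dmxM Uo Ux d sG sAT) dmx_tr.
  by rewrite (dG x d Ux).
have := dmxC Uo Ux b a sG; rewrite (dd a b) (dd b a).
exact: antisymmetrised_leibniz.
Qed.

Lemma frame_flat m (A : 'I_n -> 'rV[R]_n -> 'M[R]_m) (F : 'rV[R]_n -> 'M[R]_m) :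
  (forall a, smooth_mx U (A a)) -> smooth_mx U F ->
  (forall x, U x -> F x \in unitmx) ->
  (forall x a, U x -> dmx a F x = A a x *m F x) ->
  forall x a b, U x -> curvature_mx A a b x = 0.
Proof.
move=> sA sF uF dF x a b Ux.
have dd c d : dmx d (dmx c F) x = (dmx d (A c) x + A c x *m A d x) *m F x.
  rewrite (dmx_eq_on Uo Ux d (fun y Uy => dF y c Uy)) (dmxM Uo Ux d (sA c) sF) dF//.
  by rewrite mulmxDl mulmxA.
apply/curvature_mx_flat; apply: (can_inj (mulmxK (uF x Ux))).
by rewrite /= -(dd a b) -(dd b a); exact: (dmxC Uo Ux b a sF).
Qed.

(** Differentiate F^-1 F = 1. *)
Lemma dmx_inv m (F : 'rV[R]_n -> 'M[R]_m) x a :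
  smooth_mx U F -> (forall x, U x -> F x \in unitmx) -> U x ->
  dmx a (fun y => invmx (F y)) x = - (invmx (F x) *m dmx a F x *m invmx (F x)).
Proof.
move=> sF uF Ux; have sI := smooth_mx_inv Uo sF uF.
have := dmxM Uo Ux a sI sF.
rewrite (dmx_eq_on (G := fun=> 1%:M) Uo Ux a (fun y Uy => mulVmx (uF y Uy))) dmx_cst.
move=> /esym/eqP; rewrite addr_eq0 => /eqP h.
by rewrite -[LHS](mulmxK (uF x Ux)) h mulNmx.
Qed.

Lemma constant_on_ball (f : 'rV[R]_n -> R) x0 r :
  smooth_on U f -> (forall x, `|x - x0| < r -> U x) ->
  (forall x a, `|x - x0| < r -> pd a f x = 0) ->
  forall x, `|x - x0| < r -> f x = f x0.
Proof.
move=> sf rU df x xr.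
have r0 : 0 < r by exact: le_lt_trans xr.
have seg (t : R) : 0 <= t <= 1 -> `|x0 + t *: (x - x0) - x0| < r.
  apply: norm_segment; first by rewrite subrr normr0.
  by rewrite addrCA subrr addr0.
have [t t01|c c01] := mean_value_segment (z := x0) (w := x - x0) Uo sf.
  by apply: rU; exact: seg.
rewrite addrCA subrr addr0 big1 => [/subr0_eq//|a _].
by rewrite df ?mul0r//; exact: seg.
Qed.

End Connections.

Section LeviCivita.
Context {R : realType} {n : nat} (U : set 'rV[R]_n) (Uo : open U).
Variable g : 'rV[R]_n -> 'M[R]_n.
Hypothesis sg : smooth_mx U g.
Hypothesis gp : forall x, U x -> posdef (g x).

Definition gamma (a : 'I_n) (x : 'rV[R]_n) : 'M[R]_n :=
  \matrix_(b, c) christoffel g c a b x.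

Lemma metric_unit x : U x -> g x \in unitmx.
Proof. by move=> /gp; exact: posdef_unit. Qed.

Let gs x : U x -> (g x)^T = g x. Proof. by move=> /gp[]. Qed.

Lemma smooth_inv_metric : smooth_mx U (fun x => invmx (g x)).
Proof. exact: (smooth_mx_inv Uo sg (fun x Ux => metric_unit Ux)). Qed.

Lemma smooth_gamma a : smooth_mx U (gamma a).
Proof.
move=> b c; under eq_fun do rewrite mxE.
apply: (smooth_onM Uo (smooth_on_cst Uo _)); apply: (smooth_on_sum Uo) => l.
apply: (smooth_onM Uo (smooth_inv_metric c l)).
apply: (smooth_onB Uo _ (smooth_on_pd l (sg a b))).
exact: (smooth_onD Uo (smooth_on_pd a (sg b l)) (smooth_on_pd b (sg a l))).
Qed.

Lemma pd_metric_sym x a b c : U x -> pd c (fun y => g y a b) x = pd c (fun y => g y b a) x.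
Proof.
move=> Ux; apply: (pd_eq_on c Uo Ux) => y Uy.
by rewrite -[in LHS](gs Uy) mxE.
Qed.

Lemma gamma_sym x a b c : U x -> gamma a x b c = gamma b x a c.
Proof.
move=> Ux; rewrite !mxE /christoffel; congr (_ * _); apply: eq_bigr => l _.
congr (_ * (_ - _)); first by rewrite addrC.
exact: pd_metric_sym.
Qed.

Lemma gamma_lower x a b e : U x -> (gamma a x *m g x) b e =
  2^-1 * (pd a (fun y => g y b e) x + pd b (fun y => g y a e) x - pd e (fun y => g y a b) x).
Proof.
move=> Ux; rewrite mxE.
pose k l := pd a (fun y => g y b l) x + pd b (fun y => g y a l) x - pd l (fun y => g y a b) x.
have hs c l : invmx (g x) c l = invmx (g x) l c.
  by have := gs Ux => /(congr1 invmx); rewrite -trmx_inv => /matrixP/(_ c l); rewrite mxE => ->.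
transitivity (2^-1 * \sum_l k l * (invmx (g x) *m g x) l e).
  rewrite mulr_sumr.
  transitivity (\sum_c \sum_l 2^-1 * (k l * (invmx (g x) l c * g x c e))).
    apply: eq_bigr => c _; rewrite mxE /christoffel mulr_sumr mulr_suml.
    by apply: eq_bigr => l _; rewrite (hs c l) /k; ring.
  rewrite exchange_big /=; apply: eq_bigr => l _; rewrite -!mulr_sumr.
  by congr (_ * (_ * _)); rewrite mxE.
congr (_ * _); rewrite mulVmx ?metric_unit// (bigD1 e)//= mxE eqxx mulr1 big1 ?addr0//.
by move=> l /negbTE le; rewrite mxE le mulr0.
Qed.

Lemma gamma_metric x a : U x -> dmx a g x = gamma a x *m g x + g x *m (gamma a x)^T.
Proof.
move=> Ux; have -> : g x *m (gamma a x)^T = (gamma a x *m g x)^T by rewrite trmx_mul gs.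
apply/matrixP => b e; rewrite dmxE [RHS]mxE [(_^T) b e]mxE !gamma_lower//.
rewrite (pd_metric_sym e b a Ux).
by clear; lra.
Qed.

(** Koszul: the lowered coefficients L_abe are symmetric in a and b, and the
    derivatives of g are L_abe + L_aeb, which can be solved for L. *)
Lemma gamma_unique (C : 'I_n -> 'M[R]_n) x : U x ->
  (forall a b c, C a b c = C b a c) ->
  (forall a, dmx a g x = C a *m g x + g x *m (C a)^T) ->
  forall a, C a = gamma a x.
Proof.
move=> Ux Cs Cg a; apply: (can_inj (mulmxK (metric_unit Ux))).
pose L a b e := (C a *m g x) b e.
have Ls a' b e : L a' b e = L b a' e.
  by rewrite /L !mxE; apply: eq_bigr => c _; rewrite Cs.
have LE a' b e : pd a' (fun y => g y b e) x = L a' b e + L a' e b.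
  rewrite -dmxE Cg [LHS]mxE; congr (_ + _).
  by rewrite -[X in X *m _](gs Ux) -trmx_mul mxE.
apply/matrixP => b e; rewrite gamma_lower// !LE -/(L a b e).
rewrite (Ls b a e) (Ls e a b) (Ls e b a) (Ls b e a).
by rewrite (Ls a e b); move: (L a b e) (L b e a) (L e a b) => p q r; lra.
Qed.

Lemma gamma_curvature x a b c f : U x ->
  (curvature_mx gamma a b x *m g x) c f = riemann g x f c b a.
Proof.
move=> Ux; rewrite mxE /riemann; apply: eq_bigr => d _.
rewrite mulrC; congr (_ * _); first by rewrite -[in LHS](gs Ux) mxE.
rewrite /riemann_up curvature_mxE; congr (_ - _ + _).
- rewrite dmxE; congr (pd b _ x); apply/funext => y; exact: mxE.
- rewrite dmxE; congr (pd a _ x); apply/funext => y; exact: mxE.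
rewrite [(gamma a x *m _) c d]mxE [(gamma b x *m _) c d]mxE -sumrB.
have gE i j k : gamma i x j k = christoffel g k i j x by exact: mxE.
by apply: eq_bigr => e _; rewrite !gE; congr (_ - _); exact: mulrC.
Qed.

Let bianchi_identity (C : 'I_n -> 'I_n -> 'I_n -> R)
    (D : 'I_n -> 'I_n -> 'I_n -> 'I_n -> R) a b c d :
  (forall k i j, C k i j = C k j i) -> (forall k i j l, D l k i j = D l k j i) ->
  let rup b c d := D c a d b - D d a c b + \sum_e (C a c e * C e d b - C a d e * C e c b) in
  rup b c d + rup c d b + rup d b c = 0.
Proof.
move=> cs ds rup.
pose s p q r := \sum_e C a p e * C e q r.
have ss p q r : s p q r = s p r q by apply: eq_bigr => e _; rewrite (cs e q r).
have rE p q r : rup p q r = D q a r p - D r a q p + (s q r p - s r q p).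
  by rewrite /rup sumrB.
rewrite !rE (ds a d b) (ds a c b) (ds a d c) (ss c b d) (ss d b c) (ss b c d).
by ring.
Qed.

Let pair_symmetry (T : tensor4 R n) :
  (forall a b c d, T b a c d = - T a b c d) ->
  (forall a b c d, T a b d c = - T a b c d) ->
  (forall a b c d, T a b c d + T a c d b + T a d b c = 0) ->
  forall a b c d, T c d a b = T a b c d.
Proof.
move=> a1 a2 bianchi a b c d.
have h1 := bianchi a b c d; have h2 := bianchi b c d a.
have h3 := bianchi c d a b; have h4 := bianchi d a b c.
have e1 := a1 a b c d; have e2 := a1 c d a b; have e3 := a1 b c d a.
have e4 := a1 a c b d; have e5 := a2 a c d b; have e6 := a1 a d b c.
have e7 := a1 b d c a; have e8 := a2 b d a c.
by clear -h1 h2 h3 h4 e1 e2 e3 e4 e5 e6 e7 e8; lra.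
Qed.

(** Antisymmetry in the first pair comes from metric compatibility, the Bianchi
    identity from the symmetry of the connection, and the exchange of pairs from
    both. *)
Lemma riemann_operator x : U x -> operator_tensor (riemann g x).
Proof.
move=> Ux; pose T := riemann g x.
have a2 a b c d : T a b d c = - T a b c d.
  rewrite /T /riemann -sumrN; apply: eq_bigr => e _; rewrite -mulrN; congr (_ * _).
  rewrite /riemann_up opprD opprB; congr (_ + _).
  by rewrite -sumrN; apply: eq_bigr => f _; rewrite opprB.
have a1 a b c d : T b a c d = - T a b c d.
  rewrite /T -!gamma_curvature//.
  have := curvature_antisym Uo smooth_gamma sg (fun y e Uy => gamma_metric e Uy) d c Ux.
  have -> : g x *m (curvature_mx gamma d c x)^T = (curvature_mx gamma d c x *m g x)^T.
    by rewrite trmx_mul gs.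
  move: (_ *m _) => Q /matrixP/(_ a b); rewrite !mxE => /eqP.
  by rewrite addr_eq0 => /eqP.
have bianchi a b c d : T a b c d + T a c d b + T a d b c = 0.
  rewrite /T /riemann -!big_split /= big1// => e _; rewrite -!mulrDr.
  have cs k i j : christoffel g k i j x = christoffel g k j i x.
    by have := gamma_sym i j k Ux; rewrite !mxE.
  have cs' k i j l : pd l (christoffel g k i j) x = pd l (christoffel g k j i) x.
    apply: (pd_eq_on l Uo Ux) => y Uy.
    by have := gamma_sym i j k Uy; rewrite !mxE.
  rewrite [X in _ * X](_ : _ = 0) ?mulr0//.
  exact: (@bianchi_identity (fun k i j => christoffel g k i j x)
    (fun l k i j => pd l (christoffel g k i j) x) e b c d cs cs').
split; [exact: a1|exact: a2|exact: pair_symmetry a1 a2 bianchi].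
Qed.
End LeviCivita.

(** * The Gauss and Codazzi equations *)

Section Hypersurface.
Context {R : realType} {n : nat}.
Implicit Types (U : set 'rV[R]_n) (g h : 'rV[R]_n -> 'M[R]_n).

Definition gauss_codazzi g h (x : 'rV[R]_n) : Prop :=
  (forall a b c d, riemann g x a b c d = wedge2 (h x) a b c d) /\
  (forall a b c, covd2_skew g h a b c x = 0).

(** The coefficients in d_a F = A_a F of the frame F formed by the unit normal
    followed by the coordinate tangent vectors: the Gauss and Weingarten formulas.
    The normal comes first because 1 + n is convertible to n.+1. *)
Definition adapted_conn g h (a : 'I_n) (x : 'rV[R]_n) : 'M[R]_(1 + n) :=
  block_mx 0 (- ((col a (h x))^T *m invmx (g x))) (col a (h x)) (gamma g a x).

(** The Gram matrix of the adapted frame. *)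
Definition adapted_metric g (x : 'rV[R]_n) : 'M[R]_(1 + n) :=
  block_mx 1%:M 0 0 (g x).

Lemma open_ball_set (x0 : 'rV[R]_n) (r : R) : open [set x | `|x - x0| < r].
Proof.
rewrite (_ : mkset _ = ball x0 r); first exact: ball_open.
by apply/seteqP; split=> x; rewrite -ball_normE /= distrC.
Qed.

Section Conn.
Variables (U : set 'rV[R]_n) (Uo : open U) (g h : 'rV[R]_n -> 'M[R]_n).
Hypothesis sg : smooth_mx U g.
Hypothesis gp : forall x, U x -> posdef (g x).
Hypothesis sh : smooth_mx U h.

Let smooth_col a : smooth_mx U (fun x => col a (h x)).
Proof. by move=> b c; under eq_fun do rewrite mxE; exact: sh. Qed.

Lemma smooth_adapted_conn a : smooth_mx U (adapted_conn g h a).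
Proof.
apply: smooth_mx_block; first exact: (smooth_mx_cst Uo).
- apply: (smooth_mxN Uo); apply: (smooth_mxM Uo); last exact: smooth_inv_metric.
  exact: smooth_mx_tr.
- exact: smooth_col.
- exact: smooth_gamma.
Qed.

Lemma smooth_adapted_metric : smooth_mx U (adapted_metric g).
Proof. by apply: smooth_mx_block => //; exact: (smooth_mx_cst Uo). Qed.

Lemma adapted_metric_sym x : U x -> (adapted_metric g x)^T = adapted_metric g x.
Proof. by move=> /gp[gs _]; rewrite /adapted_metric tr_block_mx trmx1 !trmx0 gs. Qed.

Lemma adapted_metric_unit x : U x -> adapted_metric g x \in unitmx.
Proof.
move=> Ux; have gu := metric_unit gp Ux.
have : adapted_metric g x *m block_mx 1%:M 0 0 (invmx (g x)) = 1%:M.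
  rewrite /adapted_metric mulmx_block !mulmx0 !mul0mx !addr0 !add0r mulmx1 mulmxV//.
  by rewrite -scalar_mx_block.
by move=> /mulmx1_unit[].
Qed.

Lemma adapted_connM x a : U x -> adapted_conn g h a x *m adapted_metric g x =
  block_mx 0 (- (col a (h x))^T) (col a (h x)) (gamma g a x *m g x).
Proof.
move=> Ux; rewrite /adapted_conn /adapted_metric mulmx_block.
by rewrite !mulmx0 !mulmx1 !add0r !addr0 mulNmx mulmxKV// (metric_unit gp).
Qed.

Lemma adapted_conn_metric x a : U x -> dmx a (adapted_metric g) x =
  adapted_conn g h a x *m adapted_metric g x + adapted_metric g x *m (adapted_conn g h a x)^T.
Proof.
move=> Ux; rewrite -[X in _ + X *m _](adapted_metric_sym Ux) -trmx_mul adapted_connM//.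
rewrite tr_block_mx add_block_mx trmx0 addr0 linearN /= trmxK addNr subrr.
rewrite trmx_mul (gp Ux).1 -(gamma_metric Uo gp)//.
have := @dmx_block R n x _ _ _ _ a (fun=> 1%:M : 'M[R]_1) (fun=> 0) (fun=> 0) g.
by rewrite !dmx_cst.
Qed.

(** The upper blocks stay anonymous: antisymmetry determines them from the lower
    ones. *)
Lemma adapted_curvature x a b : U x -> exists UL UR,
  curvature_mx (adapted_conn g h) a b x =
  block_mx UL UR
    (dmx b (fun y => col a (h y)) x - dmx a (fun y => col b (h y)) x
     + gamma g a x *m col b (h x) - gamma g b x *m col a (h x))
    (curvature_mx (gamma g) a b x - col a (h x) *m (col b (h x))^T *m invmx (g x)
     + col b (h x) *m (col a (h x))^T *m invmx (g x)).
Proof.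
move=> Ux.
have E c d := @dmx_block R n x _ _ _ _ c (fun=> 0 : 'M[R]_1)
  (fun y => - ((col d (h y))^T *m invmx (g y))) (fun y => col d (h y)) (gamma g d).
have := E b a; rewrite -/(adapted_conn g h a) => Eba.
have := E a b; rewrite -/(adapted_conn g h b) => Eab.
rewrite /curvature_mx Eba Eab /adapted_conn !mulmx_block !opp_block_mx !add_block_mx.
eexists; eexists; congr block_mx.
- by rewrite !mulmx0 !add0r.
- rewrite !mulmxN !mulmxA opprD opprK.
  move: (dmx b _ _) (dmx a _ _) (gamma g a x *m _) (gamma g b x *m _).
  move: (col a _ *m _ *m _) (col b _ *m _ *m _) => P1 P2 P3 P4 P5 P6.
  by apply/matrixP => i j; rewrite !mxE; ring.
Qed.

Lemma codazzi_entry x a b c : U x ->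
  (dmx b (fun y => col a (h y)) x - dmx a (fun y => col b (h y)) x
     + gamma g a x *m col b (h x) - gamma g b x *m col a (h x)) c 0
  = 2 * covd2_skew g h c a b x.
Proof.
move=> Ux; rewrite /covd2_skew mulrA divff// mul1r /covd2.
have -> : (dmx b (fun y => col a (h y)) x - dmx a (fun y => col b (h y)) x
     + gamma g a x *m col b (h x) - gamma g b x *m col a (h x)) c 0 =
  dmx b (fun y => col a (h y)) x c 0 - dmx a (fun y => col b (h y)) x c 0
     + (gamma g a x *m col b (h x)) c 0 - (gamma g b x *m col a (h x)) c 0.
  by move: (dmx b _ _) (dmx a _ _) (_ *m _) (_ *m _) => P Q S T; rewrite !mxE.
have dE d e : dmx d (fun y => col e (h y)) x c 0 = pd d (fun y => h y c e) x.
  by rewrite dmxE; congr (pd _ _ _); apply/funext => y; rewrite mxE.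
have gE d e : (gamma g d x *m col e (h x)) c 0 = \sum_f christoffel g f d c x * h x f e.
  by rewrite mxE; apply: eq_bigr => f _; rewrite !mxE.
rewrite !dE !gE.
have -> : \sum_d christoffel g d b a x * h x c d = \sum_d christoffel g d a b x * h x c d.
  apply: eq_bigr => d _; congr (_ * _).
  by have := gamma_sym Uo gp b a d Ux; rewrite !mxE.
by ring.
Qed.

Lemma gauss_entry x a b c f : U x -> (h x)^T = h x ->
  ((curvature_mx (gamma g) a b x - col a (h x) *m (col b (h x))^T *m invmx (g x)
     + col b (h x) *m (col a (h x))^T *m invmx (g x)) *m g x) c f =
  riemann g x f c b a - wedge2 (h x) f c b a.
Proof.
move=> Ux hs.
rewrite mulmxDl mulmxBl !mulmxKV ?(metric_unit gp)//.
have -> : (curvature_mx (gamma g) a b x *m g x - col a (h x) *m (col b (h x))^T +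
   col b (h x) *m (col a (h x))^T) c f = (curvature_mx (gamma g) a b x *m g x) c f -
   (col a (h x) *m (col b (h x))^T) c f + (col b (h x) *m (col a (h x))^T) c f.
  by move: (curvature_mx _ _ _ _ *m _) (col a _ *m _) (col b _ *m _) => P Q S; rewrite !mxE.
rewrite (gamma_curvature gp)// /wedge2.
have cE d e : (col d (h x) *m (col e (h x))^T) c f = h x c d * h x f e.
  by rewrite mxE big_ord1 !mxE.
by rewrite !cE; ring.
Qed.

(** Gauss and Codazzi are the tangential blocks of the flatness of the adapted
    connection; its other blocks follow by antisymmetry. *)
Lemma gauss_codazziP x : U x -> (h x)^T = h x ->
  (forall a b, curvature_mx (adapted_conn g h) a b x = 0) <-> gauss_codazzi g h x.
Proof.
move=> Ux hs; split=> [K0|[ge ce] a b].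
- split=> [a b c d|a b c].
    have [UL [UR]] := adapted_curvature d c Ux; rewrite K0 => /(congr1 drsubmx).
    rewrite block_mxKdr => E.
    apply/subr0_eq; rewrite -(gauss_entry d c b a Ux hs) -E.
    by rewrite mxE big1// => k _; rewrite !mxE mul0r.
  have [UL [UR]] := adapted_curvature b c Ux; rewrite K0 => /(congr1 dlsubmx).
  rewrite block_mxKdl => /matrixP/(_ a 0) E.
  have := codazzi_entry b c a Ux; rewrite -E !mxE => /esym/eqP.
  by rewrite mulf_eq0 pnatr_eq0 /= => /eqP.
- have [UL [UR E]] := adapted_curvature a b Ux.
  have DL : dmx b (fun y => col a (h y)) x - dmx a (fun y => col b (h y)) x
     + gamma g a x *m col b (h x) - gamma g b x *m col a (h x) = 0.
    by apply/colP => c; rewrite codazzi_entry// ce mulr0 mxE.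
  have DR : curvature_mx (gamma g) a b x - col a (h x) *m (col b (h x))^T *m invmx (g x)
     + col b (h x) *m (col a (h x))^T *m invmx (g x) = 0.
    apply: (can_inj (mulmxK (metric_unit gp Ux))); rewrite mul0mx.
    by apply/matrixP => c f; rewrite gauss_entry// ge subrr mxE.
  rewrite DL DR in E.
  have := curvature_antisym Uo smooth_adapted_conn smooth_adapted_metric
    (fun y c Uy => adapted_conn_metric c Uy) a b Ux.
  rewrite -[X in _ + X *m _](adapted_metric_sym Ux) -trmx_mul E /adapted_metric mulmx_block.
  rewrite !mulmx0 !mul0mx !addr0 !add0r mulmx1 tr_block_mx add_block_mx !trmx0 !addr0 add0r.
  move=> h0.
  have UL0 : UL = 0.
    have := congr1 ulsubmx h0; rewrite block_mxKul => /matrixP/(_ 0 0).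
    rewrite !mxE => /eqP; rewrite -mulr2n mulrn_eq0 /= => /eqP e.
    by apply/matrixP => i j; rewrite !ord1 e mxE.
  have UR0 : UR = 0.
    have := congr1 ursubmx h0; rewrite block_mxKur => e.
    apply: (can_inj (mulmxK (metric_unit gp Ux))); rewrite mul0mx e.
    by apply/matrixP => i j; rewrite !mxE.
  by rewrite UL0 UR0; exact: (@block_mx0 R 1 n 1 n).
Qed.
End Conn.
End Hypersurface.

(** * Hypersurfaces in a chart *)

Section LocalHypersurfaces.
Context {R : realType} {n : nat}.

Lemma posdef_sub (U V : set 'rV[R]_n) (g : 'rV[R]_n -> 'M[R]_n) : V `<=` U ->
  (forall x, U x -> posdef (g x)) -> forall x, V x -> posdef (g x).
Proof. by move=> VU gp x /VU; exact: gp. Qed.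

(** The adapted frames (unit normal, coordinate tangent vectors) of an immersed
    hypersurface satisfy dF = A F for the adapted connection A of its metric
    and second fundamental form, which is flat since F is invertible. *)
Theorem immersion_gauss_codazzi (U : set 'rV[R]_n) (g : 'rV[R]_n -> 'M[R]_n)
    (u : 'I_n.+1 -> 'rV[R]_n -> R) x0 :
  open U -> U x0 -> smooth_mx U g -> (forall x, U x -> posdef (g x)) ->
  (forall t, smooth_on U (u t)) ->
  (forall x, U x -> forall a b, \sum_t pd a (u t) x * pd b (u t) x = g x a b) ->
  exists (r : R) (h : 'rV[R]_n -> 'M[R]_n),
    [/\ 0 < r, forall x, `|x - x0| < r -> U x,
        smooth_mx [set x | `|x - x0| < r] h &
        forall x, `|x - x0| < r -> (h x)^T = h x /\ gauss_codazzi g h x].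
Proof.
move=> Uo Ux0 sg gp su ug.
pose E (x : 'rV[R]_n) : 'M[R]_(n, 1 + n) := \matrix_(a, t) pd a (u t) x.
have sE : smooth_mx U E.
  by move=> a t; under eq_fun do rewrite mxE; exact: smooth_on_pd.
have EE x : U x -> E x *m (E x)^T = g x.
  move=> Ux; apply/matrixP => a b; rewrite -(ug x Ux) mxE.
  by apply: eq_bigr => t _; rewrite !mxE.
have [nu nu0 nuE] : exists2 nu : 'rV[R]_(1 + n), nu != 0 & nu *m (E x0)^T = 0.
  have : kermx (E x0)^T != 0.
    rewrite kermx_eq0 -row_leq_rank -ltnNge.
    by apply: (leq_ltn_trans (rank_leq_col _)); rewrite add1n.
  move=> /rowV0Pn[nu nuK nu0]; exists nu => //.
  by apply/eqP; rewrite -sub_kermx.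
have sH := smooth_inv_metric Uo sg gp.
(* The normal component of a fixed vector nu that is normal at x0. *)
pose N1 x : 'rV[R]_(1 + n) := nu - nu *m (E x)^T *m invmx (g x) *m E x.
have sN1 : smooth_mx U N1.
  have sc := smooth_mx_cst Uo nu.
  apply: (smooth_mxD Uo sc); apply: (smooth_mxN Uo).
  have s1 := smooth_mxM Uo sc (smooth_mx_tr sE).
  have s2 := smooth_mxM Uo s1 sH.
  exact: (smooth_mxM Uo s2 sE).
have N1E x : U x -> N1 x *m (E x)^T = 0.
  move=> Ux; rewrite /N1 mulmxBl -[_ *m E x *m _]mulmxA EE// mulmxKV ?subrr//.
  exact: (metric_unit gp).
pose q x := (N1 x *m (N1 x)^T) 0 0.
have sq : smooth_on U q by exact: (smooth_mxM Uo sN1 (smooth_mx_tr sN1)).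
have q0 : 0 < q x0.
  rewrite /q /N1 nuE !mul0mx subr0 mxE.
  rewrite lt_neqAle sumr_ge0 ?andbT => [|i _]; last by rewrite mxE -expr2 sqr_ge0.
  rewrite eq_sym psumr_eq0 => [|i _]; last by rewrite mxE -expr2 sqr_ge0.
  apply: contra nu0 => /allP h; apply/eqP/rowP => i; rewrite [RHS]mxE; apply/eqP.
  by have := h i (mem_index_enum i); rewrite mxE -expr2 sqrf_eq0.
have [r r0 rP] : exists2 r : R, 0 < r & forall x, `|x - x0| < r -> U x /\ 0 < q x.
  have /near_distP[r1 r10 r1U] := near_open Uo Ux0.
  have /continuous_distP/(_ _ q0)[r2 r20 r2q] := smooth_on_continuous sq Ux0.
  exists (Num.min r1 r2) => [|x]; first by rewrite lt_min r10.
  rewrite lt_min => /andP[x1 x2]; split; first exact: r1U.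
  have := r2q x x2; rewrite ltr_norml => /andP[h _].
  by rewrite -(ltrD2r (- q x0)) sub0r.
pose W := [set x : 'rV[R]_n | `|x - x0| < r].
have Wo : open W by exact: open_ball_set.
have WU : W `<=` U by move=> x /rP[].
have sub p m (F : 'rV[R]_n -> 'M[R]_(p, m)) : smooth_mx U F -> smooth_mx W F.
  by move=> sF i j; exact: smooth_on_sub WU (sF i j).
have gpW := posdef_sub WU gp.
pose N x := (Num.sqrt (q x))^-1 *: N1 x.
have sN : smooth_mx W N.
  move=> i j; under eq_fun do rewrite mxE.
  apply: (smooth_onM Wo _ (sub _ _ _ sN1 i j)).
  apply: (smooth_onV Wo (smooth_on_sqrt Wo (smooth_on_sub WU sq) _)) => x /rP[_ qx] //.
  by rewrite gt_eqF// sqrtr_gt0.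
pose F x : 'M[R]_(1 + n) := col_mx (N x) (E x).
have sF : smooth_mx W F.
  move=> i j; case: (split_ordP i) => k ->.
    by under eq_fun do rewrite col_mxEu; exact: sN.
  by under eq_fun do rewrite col_mxEd; exact: (sub _ _ _ sE).
have FF x : W x -> F x *m (F x)^T = adapted_metric g x.
  move=> Wx; have [Ux qx] := rP x Wx.
  have NE : N x *m (E x)^T = 0 by rewrite /N -scalemxAl N1E// scaler0.
  rewrite /F tr_col_mx mul_col_row NE EE//; congr block_mx.
    apply/matrixP => i j; rewrite !ord1 /N linearZ /= -scalemxAl -scalemxAr scalerA mxE.
    rewrite -/(q x) [RHS]mxE eqxx -invfM -expr2 sqr_sqrtr ?ltW// mulVf// gt_eqF//.
  by apply: trmx_inj; rewrite trmx_mul trmxK NE trmx0.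
have uF x : W x -> F x \in unitmx.
  move=> Wx; have := adapted_metric_unit gpW Wx; rewrite -FF// unitmx_mul.
  by move=> /andP[].
pose A a x := dmx a F x *m invmx (F x).
have sA a : smooth_mx W (A a).
  exact: (smooth_mxM Wo (smooth_mx_dmx a sF) (smooth_mx_inv Wo sF uF)).
have dF x a : W x -> dmx a F x = A a x *m F x.
  by move=> Wx; rewrite /A mulmxKV// uF.
have A_metric x a : W x ->
    dmx a (adapted_metric g) x = A a x *m adapted_metric g x + (A a x *m adapted_metric g x)^T.
  move=> Wx; rewrite -FF// mulmxA -dF//.
  rewrite -(dmx_eq_on Wo Wx a FF) (dmxM Wo Wx a sF (smooth_mx_tr sF)) dmx_tr.
  by rewrite trmx_mul trmxK.
have A_sym x a b k : W x -> A a x (rshift 1 b) k = A b x (rshift 1 a) k.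
  move=> Wx; rewrite /A [LHS]mxE [RHS]mxE; apply: eq_bigr => t _; congr (_ * _).
  have FE c y : F y (rshift 1 c) t = pd c (u t) y by rewrite col_mxEd mxE.
  have dE c d : dmx c F x (rshift 1 d) t = pd c (pd d (u t)) x.
    by rewrite [LHS]dmxE; congr (pd c _ x); apply/funext => y; exact: FE.
  exact: etrans (dE a b) (etrans (pd_comm a b Uo (su t) (WU _ Wx)) (esym (dE b a))).
clearbody A.
pose h (x : 'rV[R]_n) : 'M[R]_n := \matrix_(b, a) A a x (rshift 1 b) (lshift n 0).
have sh : smooth_mx W h.
  by move=> b a; under eq_fun do rewrite mxE; exact: sA.
have hs x : W x -> (h x)^T = h x.
  by move=> Wx; apply/matrixP => a b; rewrite !mxE A_sym.
have AE x a : W x -> A a x = adapted_conn g h a x.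
  move=> Wx.
  have col_h c : dlsubmx (A c x : 'M[R]_(1 + n, 1 + n)) = col c (h x).
    by apply/colP => b; rewrite !mxE.
  have blocks c : [/\ ulsubmx (A c x : 'M[R]_(1 + n, 1 + n)) = 0,
      ursubmx (A c x : 'M[R]_(1 + n, 1 + n)) = - ((col c (h x))^T *m invmx (g x)) &
      dmx c g x = drsubmx (A c x : 'M[R]_(1 + n, 1 + n)) *m g x +
         g x *m (drsubmx (A c x : 'M[R]_(1 + n, 1 + n)))^T].
    have := A_metric x c Wx; rewrite -{1 2}[A c x](@submxK _ 1 n 1 n) col_h.
    have := @dmx_block R n x _ _ _ _ c (fun=> 1%:M : 'M[R]_1) (fun=> 0) (fun=> 0) g.
    rewrite !dmx_cst -/(adapted_metric g) => ->.
    rewrite /adapted_metric mulmx_block !mulmx0 !mulmx1 !addr0 !add0r.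
    rewrite tr_block_mx add_block_mx => /eq_block_mx[e1 e2 _ e4].
    split; last by rewrite e4 trmx_mul (gpW _ Wx).1.
    - move: e1; move: (ulsubmx _) => Q /matrixP/(_ 0 0) e1.
      apply/matrixP => i j; rewrite !ord1 [RHS]mxE; move: e1; rewrite !mxE => /esym/eqP.
      by rewrite -mulr2n mulrn_eq0 /= => /eqP.
    - apply: (can_inj (mulmxK (metric_unit gpW Wx))).
      rewrite mulNmx mulmxKV ?(metric_unit gpW)//.
      by apply/eqP; rewrite -addr_eq0 -e2.
  have CE : drsubmx (A a x : 'M[R]_(1 + n, 1 + n)) = gamma g a x.
    have H := gamma_unique gpW (C := fun c => drsubmx (A c x : 'M[R]_(1 + n, 1 + n))) Wx.
    apply: (H _ _ a) => [c b d|c]; first by rewrite !mxE A_sym.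
    by have [] := blocks c.
  have [e1 e2 _] := blocks a.
  by rewrite -[LHS](@submxK _ 1 n 1 n) e1 e2 col_h CE.
exists r, h; split; [exact: r0|exact: WU|exact: sh|].
move=> x Wx; split; first exact: hs.
apply: (gauss_codazziP Wo (sub _ _ _ sg) gpW sh Wx (hs x Wx)).1 => a b.
apply: (frame_flat Wo (smooth_adapted_conn Wo (sub _ _ _ sg) gpW sh) sF uF) => // y c Wy.
by rewrite dF// AE.
Qed.

(** Fundamental theorem of hypersurfaces: flatness of the adapted connection gives
    a frame F with d_a F = A_a F, and F F^T stays equal to the Gram matrix because
    both satisfy the same equation. *)
Theorem gauss_codazzi_immersion (U : set 'rV[R]_n) (g h : 'rV[R]_n -> 'M[R]_n) x0 :
  open U -> U x0 -> smooth_mx U g -> (forall x, U x -> posdef (g x)) ->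
  smooth_mx U h -> (forall x, U x -> (h x)^T = h x /\ gauss_codazzi g h x) ->
  exists (r : R) (u : 'I_n.+1 -> 'rV[R]_n -> R),
    [/\ 0 < r, forall x, `|x - x0| < r -> U x,
        forall t, smooth_on [set x | `|x - x0| < r] (u t) &
        forall x, `|x - x0| < r ->
          forall a b, \sum_t pd a (u t) x * pd b (u t) x = g x a b].
Proof.
move=> Uo Ux0 sg gp sh gc.
have sA := smooth_adapted_conn Uo sg gp sh.
have flat x a b : U x -> curvature_mx (adapted_conn g h) a b x = 0.
  by move=> Ux; have [hs gch] := gc x Ux; apply: (gauss_codazziP Uo sg gp sh Ux hs).2.
(* The position vector is a further row of the linear system, with derivative the
   tangent rows of the frame. *)
pose e (a : 'I_n) : 'rV[R]_(1 + n) := row_mx 0 (delta_mx 0 a).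
pose B a (x : 'rV[R]_n) : 'M[R]_(1 + (1 + n)) := block_mx 0 (e a) 0 (adapted_conn g h a x).
have sB a : smooth_mx U (B a).
  by apply: smooth_mx_block => //; exact: (smooth_mx_cst Uo).
have eA x a b : U x -> e a *m adapted_conn g h b x = e b *m adapted_conn g h a x.
  move=> Ux; have [hs _] := gc x Ux.
  rewrite /e /adapted_conn !mul_row_block !mul0mx !add0r -!rowE; congr row_mx.
    by apply/rowP => i; rewrite !mxE -[in LHS]hs mxE.
  by apply/rowP => i; have := gamma_sym Uo gp b a i Ux; rewrite !mxE.
have flatB x : U x -> forall a b,
    dmx b (B a) x + B a x *m B b x = dmx a (B b) x + B b x *m B a x.
  move=> Ux a b.
  have dB c d : dmx d (B c) x = block_mx 0 0 0 (dmx d (adapted_conn g h c) x).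
    have := @dmx_block R n x _ _ _ _ d (fun=> 0 : 'M[R]_1) (fun=> e c) (fun=> 0)
      (adapted_conn g h c).
    by rewrite !dmx_cst.
  have key c d : dmx d (B c) x + B c x *m B d x = block_mx 0 (e c *m adapted_conn g h d x) 0
      (dmx d (adapted_conn g h c) x + adapted_conn g h c x *m adapted_conn g h d x).
    apply: etrans (congr2 +%R (dB c d) (erefl _)) _.
    rewrite /B mulmx_block !mulmx0 !mul0mx !add0r.
    by move: (dmx _ _ _) (_ *m _) (_ *m _) => P Q S; rewrite add_block_mx !add0r.
  apply: etrans (key a b) (etrans _ (esym (key b a))).
  have E := (curvature_mx_flat _ _ _ _).1 (flat x a b Ux).
  exact: (congr2 (fun P Q => block_mx 0 P 0 Q) (eA x a b Ux) E).
have [V [d [VG _]]] := simultaneous_diagonalisation (gp x0 Ux0) (trmx0 _ _ _).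
pose F0 : 'M[R]_(1 + n) := block_mx 1%:M 0 0 (invmx V).
have F0E : F0 *m F0^T = adapted_metric g x0.
  rewrite /F0 tr_block_mx mulmx_block !trmx0 trmx1 !mulmx0 !mul0mx mulmx1 !addr0 !add0r.
  by rewrite -(frame_metric VG).
have [r [Y [r0 rU Y0 sY dY]]] := linear_frobenius (x0 := x0) (p := n.+1)
  (col_mx 0 F0 : 'M[R]_(1 + (1 + n), 1 + n)) Uo Ux0 sB flatB.
pose F x : 'M[R]_(1 + n) := dsubmx (Y x : 'M[R]_(1 + (1 + n), 1 + n)).
pose u (t : 'I_n.+1) x := (usubmx (Y x : 'M[R]_(1 + (1 + n), 1 + n))) 0 t.
pose W1 := [set x : 'rV[R]_n | `|x - x0| < r].
have W1o : open W1 by exact: open_ball_set.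
have YE x : Y x = col_mx (usubmx (Y x : 'M[R]_(1 + (1 + n), 1 + n))) (F x).
  by rewrite vsubmxK.
have dYE x a : W1 x -> dmx a Y x = col_mx (e a *m F x) (adapted_conn g h a x *m F x).
  by move=> Wx; rewrite dY// YE /B mul_block_col !mul0mx !add0r.
have sF1 : smooth_mx W1 F.
  by move=> i j; under eq_fun do rewrite mxE; exact: sY.
have dF1 x a : W1 x -> dmx a F x = adapted_conn g h a x *m F x.
  move=> Wx; rewrite -[RHS](@col_mxKd _ 1 (1 + n) _ (e a *m F x)) -dYE//.
  apply/matrixP => i j; rewrite dmxE [RHS]mxE dmxE.
  by congr (pd _ _ _); apply/funext => y; rewrite mxE.
have du x a t : W1 x -> pd a (u t) x = F x (rshift 1 a) t.
  move=> Wx; transitivity ((dmx a Y x) (lshift (1 + n) 0) t).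
    by rewrite dmxE; congr (pd _ _ _); apply/funext => y; rewrite /u mxE.
  rewrite dYE// col_mxEu /e mxE (bigD1 (rshift 1 a))//= row_mxEr !mxE !eqxx mul1r.
  rewrite big1 ?addr0// => k; case: (split_ordP k) => l ->.
    by rewrite row_mxEl mxE mul0r.
  by move=> la; rewrite row_mxEr mxE (inj_eq (@rshift_inj _ _)) in la *; rewrite (negbTE la) andbF mul0r.
have Fx0 : F x0 = F0 by rewrite /F Y0 col_mxKd.
have uF0 : F x0 \in unitmx.
  have := adapted_metric_unit gp Ux0; rewrite -F0E -Fx0 unitmx_mul.
  by move=> /andP[].
have W1x0 : W1 x0 by rewrite /W1 /= subrr normr0.
have [r' r'0 r'P] : exists2 r' : R, 0 < r' &
    forall x, `|x - x0| < r' -> W1 x /\ F x \in unitmx.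
  have d0 : 0 < `|\det (F x0)| by rewrite normr_gt0 -unitfE -unitmxE.
  have sdet := smooth_on_det W1o sF1.
  have /continuous_distP/(_ _ d0)[r2 r20 r2P] := smooth_on_continuous sdet W1x0.
  exists (Num.min r r2) => [|x]; first by rewrite lt_min r0.
  rewrite lt_min => /andP[xr /r2P dx]; split=> //.
  rewrite unitmxE unitfE; apply: contraTneq dx => ->.
  by rewrite sub0r normrN ltxx.
pose W := [set x : 'rV[R]_n | `|x - x0| < r'].
have Wo : open W by exact: open_ball_set.
have WW1 : W `<=` W1 by move=> x /r'P[].
have WU : W `<=` U by move=> x /WW1/rU.
have sub p m (D : set 'rV[R]_n) (P : 'rV[R]_n -> 'M[R]_(p, m)) :
    W `<=` D -> smooth_mx D P -> smooth_mx W P.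
  by move=> WD sP i j; exact: smooth_on_sub WD (sP i j).
have gpW := posdef_sub WU gp.
have sF := sub _ _ _ _ WW1 sF1.
have uF x : W x -> F x \in unitmx by move=> /r'P[].
have sI := smooth_mx_inv Wo sF uF.
have sG := smooth_adapted_metric Wo (sub _ _ _ _ WU sg).
(* F^-1 G F^-T has zero derivative, hence stays equal to 1. *)
pose Z x := invmx (F x) *m adapted_metric g x *m (invmx (F x))^T.
have sIG := smooth_mxM Wo sI sG.
have sZ : smooth_mx W Z := smooth_mxM Wo sIG (smooth_mx_tr sI).
have dI x a : W x -> dmx a (fun y => invmx (F y)) x =
    - (invmx (F x) *m adapted_conn g h a x).
  move=> Wx; rewrite (dmx_inv Wo a sF uF Wx) dF1; last exact: WW1.
  by rewrite mulmxA mulmxK// uF.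
have dZ x a : W x -> dmx a Z x = 0.
  move=> Wx; rewrite (dmxM Wo Wx a sIG (smooth_mx_tr sI)) (dmxM Wo Wx a sI sG) dmx_tr.
  rewrite dI// (adapted_conn_metric Wo h gpW a Wx).
  rewrite linearN /= trmx_mul mulmxDr !mulmxDl !mulNmx !mulmxN !mulmxA.
  by rewrite addrA addNr add0r subrr.
have Zx0 : Z x0 = 1%:M.
  rewrite /Z -F0E -Fx0 mulmxA mulVmx// mul1mx -trmx_mul mulVmx// trmx1.
  by [].
have Z1 x : W x -> Z x = 1%:M.
  move=> Wx; rewrite -Zx0; apply/matrixP => i j.
  apply: (constant_on_ball (f := fun y => Z y i j) (r := r') Wo (sZ i j)) => //.
  by move=> y a Wy; rewrite -dmxE dZ// mxE.
have FF x : W x -> F x *m (F x)^T = adapted_metric g x.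
  move=> Wx; have := congr1 (fun Q => F x *m Q *m (F x)^T) (Z1 x Wx).
  rewrite mulmx1 /Z !mulmxA mulmxV ?uF// mul1mx trmx_inv mulmxKV ?unitmx_tr ?uF//.
exists r', u; split; [exact: r'0|exact: WU| |].
- move=> t; apply: smooth_on_sub WW1 _.
  rewrite (_ : u t = fun x => Y x (lshift (1 + n) 0) t); first exact: sY.
  by apply/funext => x; rewrite /u mxE.
- move=> x Wx a b; transitivity ((F x *m (F x)^T) (rshift 1 a) (rshift 1 b)).
    by rewrite mxE; apply: eq_bigr => t _; rewrite !du ?mxE//; exact: WW1.
  by rewrite FF// /adapted_metric block_mxEdr.
Qed.
End LocalHypersurfaces.

(** * Smoothness of the second fundamental form *)

Section SmoothCurvature.
Context {R : realType} {n : nat} (U : set 'rV[R]_n) (Uo : open U).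
Variable g : 'rV[R]_n -> 'M[R]_n.
Hypothesis sg : smooth_mx U g.
Hypothesis gp : forall x, U x -> posdef (g x).

Lemma smooth_christoffel k i j : smooth_on U (christoffel g k i j).
Proof.
have := smooth_gamma Uo sg gp i j k.
by rewrite (_ : (fun x => _) = christoffel g k i j)//; apply/funext => x; rewrite mxE.
Qed.

Lemma smooth_riemann a b c d : smooth_on U (fun x => riemann g x a b c d).
Proof.
apply: (smooth_on_sum Uo) => e; apply: (smooth_onM Uo (sg a e)).
have sc := smooth_christoffel.
apply: (smooth_onD Uo).
  exact: (smooth_onB Uo (smooth_on_pd c (sc e d b)) (smooth_on_pd d (sc e c b))).
apply: (smooth_on_sum Uo) => f.
exact: (smooth_onB Uo (smooth_onM Uo (sc e c f) (sc f d b))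
  (smooth_onM Uo (sc e d f) (sc f c b))).
Qed.

Section Cofactors.
Variable T : 'rV[R]_n -> tensor4 R n.
Hypothesis sT : forall a b c d, smooth_on U (fun x => T x a b c d).
Variables i j k : 'I_n.
Hypothesis det0 : forall x, U x -> 0 < cof_det (T x) i j k.

Let s11 := sT j k j k.
Let s12 := smooth_onN Uo (sT j k i k).
Let s13 := sT j k i j.
Let s22 := sT i k i k.
Let s23 := sT i k j i.
Let s33 := sT i j i j.
Let mul f1 f2 s1 s2 := @smooth_onM R n U Uo f1 f2 s1 s2.
Let sub f1 f2 s1 s2 := @smooth_onB R n U Uo f1 f2 s1 s2.

Lemma smooth_cof_det : smooth_on U (fun x => cof_det (T x) i j k).
Proof.
exact: (smooth_onD Uo
  (sub (mul s11 (sub (mul s22 s33) (mul s23 s23)))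
       (mul s12 (sub (mul s12 s33) (mul s13 s23))))
  (mul s13 (sub (mul s12 s23) (mul s13 s22)))).
Qed.

Let sroot : smooth_on U (fun x => (Num.sqrt (cof_det (T x) i j k))^-1).
Proof.
apply: (smooth_onV Uo (smooth_on_sqrt Uo smooth_cof_det det0)) => x Ux.
by rewrite gt_eqF// sqrtr_gt0 det0.
Qed.

Lemma smooth_cof_diag : smooth_on U (fun x => cof_diag (T x) i j k).
Proof. exact: (mul (sub (mul s22 s33) (mul s23 s23)) sroot). Qed.

Lemma smooth_cof_off : smooth_on U (fun x => cof_off (T x) i j k).
Proof. exact: (mul (sub (mul s13 s23) (mul s12 s33)) sroot). Qed.
End Cofactors.

Lemma third_index (i j : 'I_n) : (2 < n)%N -> exists k, (i != k) && (j != k).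
Proof.
move=> n3; apply/existsP; apply: contraT; rewrite negb_exists => /forallP h.
have : (#|'I_n| <= 2)%N.
  apply: (@leq_trans #|[set i; j]%SET|); last by rewrite cards2; case: (_ != _).
  apply: subset_leq_card; apply/fintype.subsetP => k _; rewrite !inE.
  by have := h k; rewrite negb_and !negbK ![_ == k]eq_sym.
by rewrite card_ord leqNgt n3.
Qed.

(** The exponential and the logarithm are only known pointwise, but S is an
    algebraic function of T by the cofactor formulas, which need three distinct
    indices. *)
Lemma smooth_wedge2_root (S : 'rV[R]_n -> 'M[R]_n) (T : 'rV[R]_n -> tensor4 R n) :
  (2 < n)%N -> (forall a b c d, smooth_on U (fun x => T x a b c d)) ->
  (forall x, U x -> posdef (S x) /\ T x = wedge2 (S x)) -> smooth_mx U S.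
Proof.
move=> n3 sT ST i j.
have [k /andP[ik jk]] := third_index i j n3.
have rec i' j' k' x : i' != j' -> i' != k' -> j' != k' -> U x ->
  [/\ 0 < cof_det (T x) i' j' k', S x i' i' = cof_diag (T x) i' j' k'
    & S x i' j' = cof_off (T x) i' j' k'].
  by move=> ij' ik' jk' Ux; have [Sp ->] := ST x Ux; exact: wedge2_recover.
have [->|ij] := eqVneq i j.
  have [l /andP[jl kl]] := third_index j k n3.
  apply: (smooth_on_ext (f := fun x => cof_diag (T x) j k l) Uo).
    by move=> x Ux; have [_ ->] := rec j k l x jk jl kl Ux.
  apply: smooth_cof_diag => // x Ux.
  by have [] := rec j k l x jk jl kl Ux.
apply: (smooth_on_ext (f := fun x => cof_off (T x) i j k) Uo).
  by move=> x Ux; have [_ _ ->] := rec i j k x ij ik jk Ux.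
apply: smooth_cof_off => // x Ux.
by have [] := rec i j k x ij ik jk Ux.
Qed.
End SmoothCurvature.

(** * Locality and sign of the Codazzi equation *)

Section CodazziLocality.
Context {R : realType} {n : nat} (U : set 'rV[R]_n) (Uo : open U).
Variable g : 'rV[R]_n -> 'M[R]_n.

Lemma covd2_skew_eq_on (S S' : 'rV[R]_n -> 'M[R]_n) x a b c :
  U x -> (forall y, U y -> S y = S' y) ->
  covd2_skew g S a b c x = covd2_skew g S' a b c x.
Proof.
move=> Ux SS; rewrite /covd2_skew /covd2 (SS x Ux).
have E d e f : pd f (fun y => S y d e) x = pd f (fun y => S' y d e) x.
  by apply: (pd_eq_on f Uo Ux) => y Uy; rewrite SS.
by rewrite (E a b c) (E a c b).
Qed.

Lemma covd2N (S : 'rV[R]_n -> 'M[R]_n) x a b c : smooth_mx U S -> U x ->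
  covd2 g (fun y => - S y) a b c x = - covd2 g S a b c x.
Proof.
move=> sS Ux; rewrite /covd2.
have -> : pd c (fun y => (- S y) a b) x = - pd c (fun y => S y a b) x.
  by rewrite -(pdN Uo Ux)//; congr (pd c _ x); apply/funext => y; rewrite mxE.
have s1 : \sum_d christoffel g d c a x * (- S x) d b =
    - \sum_d christoffel g d c a x * S x d b.
  by rewrite -sumrN; apply: eq_bigr => d _; rewrite mxE mulrN.
have s2 : \sum_d christoffel g d c b x * (- S x) a d =
    - \sum_d christoffel g d c b x * S x a d.
  by rewrite -sumrN; apply: eq_bigr => d _; rewrite mxE mulrN.
by rewrite s1 s2 !opprD.
Qed.

Lemma gauss_codazziN (h : 'rV[R]_n -> 'M[R]_n) x : smooth_mx U h -> U x ->
  gauss_codazzi g h x -> gauss_codazzi g (fun y => - h y) x.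
Proof.
move=> sh Ux [gh ch]; split=> [a b c d|a b c].
  by rewrite gh /wedge2 !mxE !mulrNN.
rewrite /covd2_skew (covd2N a b c sh Ux) (covd2N a c b sh Ux).
have := ch a b c; rewrite /covd2_skew.
move: (covd2 _ _ _ _ _ _) (covd2 _ _ _ _ _ _) => P Q; lra.
Qed.
End CodazziLocality.

(** * The equivalence in one chart *)

Section InOneChart.
Context {R : realType} {n : nat}.

(** Gauss' equation exhibits the curvature operator as h ^ h. Positive sectional
    curvature makes h definite, positive after a choice of normal, and then the
    algebra of the logarithm identifies e^P* with h near x0. *)
Lemma chart_forward (D : set 'rV[R]_n) (g : 'rV[R]_n -> 'M[R]_n)
    (u : 'I_n.+1 -> 'rV[R]_n -> R) x0 :
  (2 < n)%N -> open D -> D x0 -> smooth_mx D g -> (forall x, D x -> posdef (g x)) ->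
  (forall x, D x -> forall X Y : 'rV[R]_n, row_free (col_mx X Y) -> 0 < sectional g x X Y) ->
  (forall t, smooth_on D (u t)) ->
  (forall x, D x -> forall a b, \sum_t pd a (u t) x * pd b (u t) x = g x a b) ->
  [/\ op2_posdef (g x0) (riemann g x0),
      forall i j k l, weyl_star g x0 i j k l = 0
    & forall i j k, covd2_skew g (exp_schouten_star g) i j k x0 = 0].
Proof.
move=> n3 Do Dx0 sg gp sec su ug.
have [r [h0 [r0 rD sh0 gc0]]] := immersion_gauss_codazzi Do Dx0 sg gp su ug.
pose W := [set x : 'rV[R]_n | `|x - x0| < r].
have Wo : open W by exact: open_ball_set.
have Wx0 : W x0 by rewrite /W /= subrr normr0.
have n0 : (0 < n)%N by apply: ltn_trans n3.
pose k : 'I_n := Ordinal n0.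
have wedge h x : gauss_codazzi g h x -> riemann g x = wedge2 (h x).
  move=> [gh _]; apply/funext => a; apply/funext => b.
  by apply/funext => c; apply/funext => d; exact: gh.
have definite h x : W x -> (h x)^T = h x -> gauss_codazzi g h x ->
    h x k k != 0 /\ (0 < h x k k -> posdef (h x)).
  move=> Wx hs gch; have Dx := rD x Wx.
  apply: (sectional_posdef k (ltnW n3) (gp x Dx) hs) => X Y XY.
  have := sec x Dx X Y XY; rewrite /sectional /dotp -/(quad _ X) -/(quad _ Y).
  by rewrite (wedge h x gch).
(* The sign of the second fundamental form is that of the unit normal. *)
have [h [sh gc hk]] : exists h : 'rV[R]_n -> 'M[R]_n, [/\ smooth_mx W h,
    forall x, W x -> (h x)^T = h x /\ gauss_codazzi g h x & 0 < h x0 k k].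
  have [hs0 gch0] := gc0 x0 Wx0.
  have [hk0 _] := definite h0 x0 Wx0 hs0 gch0.
  have [hn|hp|/eqP] := ltgtP (h0 x0 k k) 0; last by rewrite (negbTE hk0).
    exists (fun x => - h0 x); split; first exact: (smooth_mxN Wo).
      move=> x Wx; have [hs gch] := gc0 x Wx; split; first by rewrite linearN /= hs.
      exact: (gauss_codazziN Wo sh0 Wx gch).
    by rewrite mxE oppr_gt0.
  by exists h0; split.
have ck := smooth_on_continuous (sh k k) Wx0.
have [r2 r20 r2P] : exists2 r2 : R, 0 < r2 & forall x, `|x - x0| < r2 -> W x /\ 0 < h x k k.
  have /near_distP[r1 r10 r1W] := near_open Wo Wx0.
  have /continuous_distP/(_ _ hk)[r2 r20 r2P] := ck.
  exists (Num.min r1 r2) => [|x]; first by rewrite lt_min r10.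
  rewrite lt_min => /andP[x1 x2]; split; first exact: r1W.
  have := r2P x x2; rewrite ltr_norml => /andP[hx _].
  by rewrite -(ltrD2r (- h x0 k k)) sub0r.
pose V := [set x : 'rV[R]_n | `|x - x0| < r2].
have Vo : open V by exact: open_ball_set.
have Vx0 : V x0 by rewrite /V /= subrr normr0.
have log x : V x -> [/\ op2_posdef (g x) (riemann g x),
      forall i j k l, weyl_star g x i j k l = 0 & exp_schouten_star g x = h x].
  move=> /r2P[Wx hx]; have [hs gch] := gc x Wx.
  have [_ /(_ hx) hp] := definite h x Wx hs gch.
  rewrite /weyl_star /exp_schouten_star /schouten_star /ln_riemann (wedge h x gch).
  exact: (log_wedge2 n3 (gp x (rD x Wx)) hp).
have [h1 h2 _] := log x0 Vx0; split=> // i j l.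
rewrite (covd2_skew_eq_on (S' := h) Vo g i j l Vx0); last by move=> y /log[].
by have [_ [_]] := gc x0 Wx0; exact.
Qed.

(** Conversely e^P* satisfies Gauss' equation by the algebra of the logarithm, is
    smooth because the curvature is, and satisfies Codazzi's by hypothesis. *)
Lemma chart_backward (D : set 'rV[R]_n) (g : 'rV[R]_n -> 'M[R]_n) x0 :
  (2 < n)%N -> open D -> D x0 -> smooth_mx D g -> (forall x, D x -> posdef (g x)) ->
  (forall x, D x -> [/\ op2_posdef (g x) (riemann g x),
      forall i j k l, weyl_star g x i j k l = 0
    & forall i j k, covd2_skew g (exp_schouten_star g) i j k x = 0]) ->
  exists (r : R) (u : 'I_n.+1 -> 'rV[R]_n -> R),
    [/\ 0 < r, forall x, `|x - x0| < r -> D x,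
        forall t, smooth_on [set x | `|x - x0| < r] (u t) &
        forall x, `|x - x0| < r ->
          forall a b, \sum_t pd a (u t) x * pd b (u t) x = g x a b].
Proof.
move=> n3 Do Dx0 sg gp H.
have root x : D x -> posdef (exp_schouten_star g x) /\
    riemann g x = wedge2 (exp_schouten_star g x).
  move=> Dx; have [h1 h2 _] := H x Dx.
  exact: (exp_weyl_flat (gp x Dx) (riemann_operator Do sg gp Dx) h1 h2).
have sS := smooth_wedge2_root Do n3 (smooth_riemann Do sg gp) root.
apply: (gauss_codazzi_immersion Do Dx0 sg gp sS) => x Dx.
have [[Ss _] RS] := root x Dx; have [_ _ cod] := H x Dx.
by split=> //; split=> [a b c d|//]; rewrite RS.
Qed.
End InOneChart.

(** * From charts to manifolds *)

Local Notation coord := Defs.coord.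

Section Charts.
Context {R : realType} {n : nat} (M : manifold R n).

Lemma open_chart_image (c : chart M) (V : set M) :
  open V -> open (coord c @` (V `&` dom c)).
Proof.
move=> Vo; pose I := coord c @` dom c.
have Io : open I := @coord_open R n M c.
have -> : coord c @` (V `&` dom c) = I `&` param c @^-1` V.
  apply/seteqP; split=> [_ [p [Vp dp] <-]|x [[p dp <-]]] /=.
    by split; [exists p|rewrite /= coordK].
  by rewrite coordK// => Vp; exists p.
rewrite openE => x [Ix Vx]; rewrite /interior.
have := @param_continuous R n M c; rewrite continuous_open_subspace// => /(_ x (mem_set Ix)) cx.
apply: filterI; first exact: open_nbhs_nbhs.
by apply: cx; exact: open_nbhs_nbhs.
Qed.

Lemma open_chart_preimage (c : chart M) (W : set 'rV[R]_n) :
  open W -> open (dom c `&` coord c @^-1` W).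
Proof.
move=> Wo; have Do := @dom_open R n M c.
rewrite openE => p [dp Wp]; rewrite /interior.
have := @Defs.coord_continuous R n M c; rewrite continuous_open_subspace// => /(_ p (mem_set dp)) cp.
apply: filterI; first exact: open_nbhs_nbhs.
by apply: cp; exact: open_nbhs_nbhs.
Qed.

Variable g : metric M.

Lemma chart_posdef c x : (coord c @` dom c) x -> posdef (g c x).
Proof.
move=> Ix; split; first exact: Defs.metric_sym.
by move=> v v0; apply: (Defs.metric_pos g Ix).
Qed.

Lemma chart_smooth c : smooth_mx (coord c @` dom c) (g c).
Proof. by move=> a b; exact: Defs.metric_smooth. Qed.

End Charts.

Theorem theorem4p5 (R : realType) (n : nat) (hn : (3 <= n)%N)
    (M : manifold R n) (g : metric M)
    (hsec : positive_sectional_curvature g) :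
  locally_immersible g n.+1 <->
  [/\ positive_curvature_operator g,
      weyl_star_vanishes g
    & exp_schouten_star_codazzi g].
Proof.
split=> [imm|[Hpos Hweyl Hcod]].
- have chart_case c x : (coord c @` dom c) x -> [/\ op2_posdef (g c x) (riemann (g c) x),
      forall i j k l, weyl_star (g c) x i j k l = 0
    & forall i j k, covd2_skew (g c) (exp_schouten_star (g c)) i j k x = 0].
    move=> [p dp <-]; have [U [Uo Up] [u su ug]] := imm p.
    pose D := coord c @` (U `&` dom c).
    have DI : D `<=` coord c @` dom c by move=> _ [q [_ dq] <-]; exists q.
    have sgD : smooth_mx D (g c).
      by move=> a b; apply: smooth_on_sub DI _; exact: Defs.metric_smooth.
    apply: (chart_forward (u := fun t => u t \o param c) (D := D)) => //.
    + exact: open_chart_image.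
    + by exists p.
    + by move=> y /DI; exact: chart_posdef.
    + by move=> y /DI Iy X Y; exact: hsec.
    + by move=> t; exact: su.
    + by move=> y Dy a b; exact: ug.
  by split=> c x Ix; have [] := chart_case c x Ix.
move=> p; have [c dp] := dom_cover p.
have Ip : (coord c @` dom c) (coord c p) by exists p.
have [|r [u [r0 rI su ug]]] := chart_backward hn (@coord_open R n M c) Ip
    (@chart_smooth _ _ M g c) (fun x Ix => chart_posdef g Ix).
  by move=> x Ix; split; [exact: Hpos|exact: Hweyl|exact: Hcod].
pose W := [set x : 'rV[R]_n | `|x - coord c p| < r].
have Wo : open W by exact: open_ball_set.
pose U := dom c `&` coord c @^-1` W.
have Uo : open U by exact: open_chart_preimage.
exists U; first by split=> //; split=> //; rewrite /W /= subrr normr0.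
have inW c' x : (coord c' @` (U `&` dom c')) x -> W (coord c (param c' x)).
  by move=> [q [[dq Wq] dq'] <-]; rewrite coordK.
have inD c' : coord c' @` (U `&` dom c') `<=` coord c' @` (dom c' `&` dom c).
  by move=> _ [q [[dq _] dq'] <-]; exists q.
have sphi c' k : smooth_on (coord c' @` (U `&` dom c')) (fun x => coord c (param c' x) 0 k).
  by apply: smooth_on_sub (@inD c') _; exact: transition_smooth.
have D'o c' : open (coord c' @` (U `&` dom c')) by exact: open_chart_image.
exists (fun t => u t \o coord c) => [t c'|c' x Dx a b].
  exact: (smooth_on_comp (phi := fun x => coord c (param c' x)) (D'o c') Wo (su t)
    (sphi c') (inW c')).
have Wx := inW c' x Dx.
have dE t e : pd e (u t \o coord c \o param c') x =
    \sum_k pd k (u t) (coord c (param c' x)) * pd e (fun y => coord c (param c' y) 0 k) x.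
  exact: (pd_comp (phi := fun x => coord c (param c' x)) Dx e Wo (su t) (sphi c') Wx).
rewrite (Defs.metric_transform g (inD c' x Dx)).
transitivity (\sum_t \sum_k \sum_l pd a (fun y => coord c (param c' y) 0 k) x *
    pd b (fun y => coord c (param c' y) 0 l) x *
    (pd k (u t) (coord c (param c' x)) * pd l (u t) (coord c (param c' x)))).
  apply: eq_bigr => t _; rewrite !dE big_distrlr /=; apply: eq_bigr => k _.
  by apply: eq_bigr => l _; ring.
rewrite exchange_big /=; apply: eq_bigr => k _.
rewrite exchange_big /=; apply: eq_bigr => l _.
by rewrite -mulr_sumr ug.
Qed.
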